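(* Let $s_0 > s_1 > \dots > s_k$ be real numbers, and let $F(s)=\int_0^\infty e^{-st}f(t)\,dt$ be the Laplace transform of a piecewise continuous function $f$ supported in $[1,\infty)$ such that $f(t) = O(t^{-M})$ as $t\to\infty$ for all $M\in\mathbb{R}$, $\int_0^\infty t^{-s_i} f(t)\,dt = 0$ for all $i<k$, and $\int_0^\infty t^{-s_k} f(t)\,dt = 1$. Let $\Delta \in \mathcal{D}(\{s_i\}_{i=0}^k)$ be a spectrally elliptic operator on a Hilbert space $\mathcal{H}$ and let $h\in\mathcal{B}(\mathcal{H})$ be bounded. Then, for any orthonormal basis $\{\phi_\lambda\}_{\lambda\in\sigma(\Delta)}$ of $\mathcal{H}$ diagonalizing $\Delta$, $$\operatorname{res}_{s=s_k} \Gamma(s) \operatorname{tr} h\Delta^{-s} = \lim_{\Lambda\to\infty} \epsilon(\Lambda)^{s_k} \sum_{\lambda\in\sigma(\Delta)\cap[0,\Lambda]} \langle h\phi_\lambda,\phi_\lambda\rangle\, F(\lambda\,\epsilon(\Lambda)),$$ where $\epsilon(\Lambda) = \Lambda^{-1}\log(\Lambda^m)$ for any $m > s_0 - s_k$.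
   Context: A positive, invertible, self-adjoint, unbounded operator $\Delta$ with compact resolvent on a Hilbert space is called spectrally elliptic if $\operatorname{tr} e^{-t\Delta}$ admits an asymptotic expansion $\sum_{i=0}^\infty c_i t^{-s_i}$ as $t \to 0^+$, where the $s_i$ are decreasingly ordered reals. The set $\Pi$ of exponents $s_i$ is called the heat spectrum of $\Delta$. For a finite set of reals $s_0 > \dots > s_k$, $\mathcal{D}(\{s_i\}_{i=0}^k)$ is the set of all spectrally elliptic operators $\Delta$ whose heat spectrum $\Pi$ satisfies $\Pi \cap [s_k,\infty) \subset \{s_i\}_{i=0}^k$, i.e. whose heat trace admits an asymptotic expansion $\operatorname{tr} e^{-t\Delta} = \sum_{i=0}^k c_i t^{-s_i} + O(t^{-s_{k+1}})$ as $t\to 0^+$ for some $s_{k+1} < s_k$. $\mathcal{B}(\mathcal{H})$ is the algebra of bounded operators on $\mathcal{H}$. $\sigma(\Delta)$ is the spectrum of $\Delta$, consisting of eigenvalues, counted with multiplicities, so the basis $\{\phi_\lambda\}$ is indexed by eigenvalues with multiplicity and $\Delta\phi_\lambda=\lambda\phi_\lambda$. $\Gamma(s)\operatorname{tr} h\Delta^{-s}$, with $\Gamma(s)$ the Gamma function, is understood as the meromorphic continuation of this function from $\operatorname{Re} s$ large, where the trace converges; $\operatorname{res}_{s=a}$ is the residue at $s=a$.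
   Formalization: The bounded operator h is additionally assumed to satisfy tr h e^{-tΔ} = Σ_{i≤k} c_i t^{-s_i} + O(t^{-s'}) as t→0+ for some s' < s_k; for arbitrary bounded h the claim fails, e.g. Δ = diag(n), h = diag(n^{iτ}), τ ≠ 0. *)

(* Defs.v *)
From HB Require Import structures.
From mathcomp Require Import all_boot all_order all_algebra finmap complex.
From mathcomp Require Import all_classical all_reals all_analysis.
From mathcomp.analysis.showcase Require Import summability.

Set Implicit Arguments.
Unset Strict Implicit.
Unset Printing Implicit Defensive.

Import Order.TTheory GRing.Theory Num.Theory.
Import numFieldNormedType.Exports.

Local Open Scope classical_set_scope.
Local Open Scope ring_scope.
Local Open Scope complex_scope.

(* The complex numbers, as a normed module over themselves.  The norm of a
   complex number is itself an element of R[i]; real bounds are injected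
   by _%:C. *)
Notation C R := (R[i]^o).

Section Functions.
Context {R : realType}.

Definition cint (A : set R) (f : R -> C R) : C R :=
  (\int[lebesgue_measure]_(x in A) complex.Re (f x))
  +i* (\int[lebesgue_measure]_(x in A) complex.Im (f x)).

(* x ^ z = exp (z ln x) for x > 0 *)
Definition cpow (x : R) (z : C R) : C R :=
  (expR (complex.Re z * ln x))%:C *
  (cos (complex.Im z * ln x) +i* sin (complex.Im z * ln x)).

(* Euler's integral: this is the Gamma function on the half-plane Re z > 0
   only. *)
Definition cGamma (z : C R) : C R :=
  cint `]0, +oo[ (fun t => cpow t (z - 1) * (expR (- t))%:C).

Definition laplace (f : R -> C R) (x : R) : C R :=
  cint `[0, +oo[ (fun t => (expR (- (x * t)))%:C * f t).

Definition piecewise_continuous (f : R -> C R) : Prop :=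
  forall a b : R, exists d : seq R, forall x, a <= x <= b ->
    [/\ x \notin d -> {for x, continuous f},
        exists l : C R, f y @[y --> x^'-] --> l &
        exists l : C R, f y @[y --> x^'+] --> l].

Definition rapidly_decreasing (f : R -> C R) : Prop :=
  forall M : R, exists K : R,
    \forall t \near +oo, `|f t| <= (K * t `^ (- M))%:C.

Definition cutoff_scale (m L : R) : R := L^-1 * ln (L `^ m).

(* Near p (and away from p),
   Z z = a_0 (z - p)^-1 + ... + a_{n-1} (z - p)^-n + g z, g holomorphic. *)
Definition principal_part (Z : C R -> C R) (p : C R) (n : nat)
    (a : nat -> C R) : Prop :=
  exists g : C R -> C R,
    (\forall z \near p, derivable g z 1) /\
    (\forall z \near p^', Z z = \sum_(j < n) a j * (z - p) ^- j.+1 + g z).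

(* The value of Z at a pole or at a removable singularity is irrelevant. *)
Definition meromorphic_on (U : set (C R)) (Z : C R -> C R) : Prop :=
  forall p, U p -> exists n a, principal_part Z p n a.

Definition is_residue (Z : C R -> C R) (p r : C R) : Prop :=
  exists n a, principal_part Z p n.+1 a /\ a 0%N = r.

End Functions.

(* Complex Hilbert spaces; the inner product is linear on the left. *)
Record hilbert (R : realType) := Hilbert {
  hilbert_sort :> completeNormedModType [the numFieldType of R[i]];
  ip : {dot hilbert_sort for Num.conj};
  ip_norm : forall x, `|x| ^+ 2 = ip x x }.

Record linop (R : realType) (H : hilbert R) := Linop {
  dom : set H;
  linop_fun :> H -> H;
  dom0 : dom 0;
  dom_lin : forall (a : R[i]) x y, dom x -> dom y -> dom (a *: x + y);
  linopP : forall (a : R[i]) x y, dom x -> dom y ->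
    linop_fun (a *: x + y) = a *: linop_fun x + linop_fun y }.

Section Operators.
Context {R : realType} {H : hilbert R}.
Implicit Types (D : linop H) (T h : H -> H).

Definition bounded_operator T : Prop :=
  linear T /\ exists M : R, forall x, `|T x| <= M%:C * `|x|.

Definition compact_operator T : Prop :=
  linear T /\ precompact (T @` [set x | `|x| <= 1]).

Definition unbounded D : Prop :=
  ~ exists M : R, forall x, dom D x -> `|D x| <= M%:C * `|x|.

Definition positive D : Prop := forall x, dom D x -> 0 <= ip H (D x) x.

(* The second clause says that the graph of the adjoint is the graph of D. *)
Definition selfadjoint D : Prop :=
  closure (dom D) = setT /\
  forall y z, (forall x, dom D x -> ip H (D x) y = ip H x z) <->
              (dom D y /\ z = D y).

(* T = (D - z)^-1, as an everywhere defined bounded operator *)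
Definition resolvent D (z : C R) T : Prop :=
  [/\ bounded_operator T,
      forall x, dom D (T x) /\ D (T x) - z *: T x = x &
      forall x, dom D x -> T (D x - z *: x) = x].

Definition invertible D : Prop := exists T, resolvent D 0 T.

Definition compact_resolvent D : Prop :=
  forall z T, resolvent D z T -> compact_operator T.

Definition orthonormal_basis (I : choiceType) (e : I -> H) : Prop :=
  (forall i j, ip H (e i) (e j) = (i == j)%:R) /\
  closure [set x | exists (r : seq I) (c : I -> R[i]),
                     x = \sum_(i <- r) c i *: e i] = setT.

(* T is trace class with trace c: a bounded operator is trace class iff its
   diagonal is (unconditionally, i.e. absolutely) summable in every
   orthonormal basis, the sum being then independent of the basis. *)
Definition is_trace T (c : C R) : Prop :=
  bounded_operator T /\
  forall (I : choiceType) (e : I -> H), orthonormal_basis e ->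
    partial_sum (fun i => ip H (T (e i)) (e i) : C R) @ totally --> c.

(* T = g(D), for D self-adjoint with compact resolvent: as the eigenvectors of
   D span a dense subspace, g(D) is the only bounded operator acting as g(l)
   on the eigenspace of l. *)
Definition functional_calculus D (g : R -> C R) T : Prop :=
  bounded_operator T /\
  forall (l : R) x, dom D x -> D x = l%:C *: x -> T x = (g l : R[i]) *: x.

(* tr (h g(D)) = c *)
Definition is_trace_calculus h D (g : R -> C R) (c : C R) : Prop :=
  exists T, functional_calculus D g T /\ is_trace (h \o T) c.

(* tr (h e^(-tD)) = sum_(i < n) c_i t^(-s_i) + O(t^(-s')) as t -> 0+;
   c_i = 0 is allowed. *)
Definition heat_expansion_upto h D (n : nat) (s : 'I_n -> R) (c : 'I_n -> C R)
    (s' : R) : Prop :=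
  exists theta : R -> C R,
    (forall t, 0 < t ->
       is_trace_calculus h D (fun l => (expR (- (t * l)))%:C) (theta t)) /\
    exists K : R, \forall t \near 0^'+,
      `|theta t - \sum_(i < n) c i * (t `^ (- s i))%:C|
        <= (K * t `^ (- s'))%:C.

Definition heat_expansion D (s : nat -> R) (c : nat -> C R) : Prop :=
  (forall i j : nat, (i < j)%N -> s j < s i) /\
  forall n : nat,
    heat_expansion_upto id D (fun i : 'I_n => s i) (fun i : 'I_n => c i) (s n).

Definition spectrally_elliptic_with D (s : nat -> R) : Prop :=
  [/\ positive D, invertible D, selfadjoint D, unbounded D &
      compact_resolvent D] /\
  exists c, heat_expansion D s c.

Definition spectrally_elliptic D : Prop :=
  exists s, spectrally_elliptic_with D s.

(* The class of the spectrally elliptic operators whose heat spectrum,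
   range p, meets [s_k, +oo[ in a subset of {s_0, ..., s_k}. *)
Definition elliptic_class (k : nat) (s : 'I_k.+1 -> R) : set (linop H) :=
  [set D | exists p, spectrally_elliptic_with D p /\
             range p `&` `[s ord_max, +oo[ `<=` range s].

(* r is the residue at a of a meromorphic continuation of
   Gamma(z) tr (h D^(-z)), from some half-plane Re z > x on which the trace
   exists, to a half-plane containing a.  Half-planes being connected, the
   continuation Z is unique up to its values at isolated points. *)
Definition zeta_residue h D (a r : C R) : Prop :=
  exists (x y : R) (Z : C R -> C R),
    [/\ 0 <= x /\ y < complex.Re a,
        forall z : C R, x < complex.Re z ->
          exists c, is_trace_calculus h D (fun l => cpow l (- z)) c /\
                    Z z = cGamma z * c,
        meromorphic_on [set z | y < complex.Re z] Z &
        is_residue Z a r].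

End Operators.

(* Main.v *)
Require Import Defs.
From HB Require Import structures.
From mathcomp Require Import all_boot all_order all_algebra finmap complex.
From mathcomp Require Import all_classical all_reals all_analysis.
From mathcomp.analysis Require Import measurable_realfun.
From mathcomp.analysis.showcase Require Import summability.
From mathcomp Require Import ring lra.

(** Write phi_i, lam_i for the eigenbasis and its eigenvalues, a_i for
    <h phi_i, phi_i>, and theta(t) = tr (h e^(-tD)) = sum_i a_i e^(-t lam_i).
    Both sides of the formula are equal to c_k, the coefficient of t^(-s_k) in
    the expansion of theta at 0.  Two estimates hold for the eigenvalues:
    lam_i >= l0 > 0, because D is positive with a bounded inverse
    (eigenvalues_bounded_below), and sum_i e^(-t lam_i) = O(t^(-s_0)) on ]0, 1],
    because D is elliptic and no exponent of its heat trace exceeds s_0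
    (heat_expansion_bound).

    The residue.  Euler's integral gives
    Gamma(z) l^(-z) = int_0^oo t^(z-1) e^(-tl) dt, hence, for Re z large,
    Gamma(z) tr (h D^(-z)) = int_0^oo t^(z-1) theta(t) dt.  Subtracting
    sum_i c_i t^(-s_i) from theta on ]0, 1] leaves a remainder that is
    O(t^(-s')) at 0, with s' < s_k, and rapidly decreasing at infinity, so its
    Mellin transform is holomorphic for Re z > s' (derivable_mellin); what was
    subtracted contributes sum_i c_i / (z - s_i).  This is the continuation
    zeta_cont (zeta_cont_principal, zeta_cont_eq).  The operators D^(-z) are
    built as sums over the eigenbasis; that the trace of h D^(-z) can be
    computed in any orthonormal basis is diag_op_trace, and the summability of
    lam_i^(-Re z) is itself read off from Euler's integral (zeta_summable).

    The limit.  By dominated convergence the sum over the whole spectrum is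
    sum_i a_i F(lam_i eps) = int f(t) theta(t eps) dt.  Inserting the expansion
    of theta, the moment conditions on f remove all terms but the last, and
    eps^(s_k) times the integral tends to c_k (heat_integral_expansion).  The
    eigenvalues above L contribute an error that has to be negligible: as f is
    supported in [1, +oo[, |F(x)| = O(e^(-x)), and with eps L = m ln L this tail
    is at most a power of L times L^(-m'), m' < m, where m > s_0 - s_k makes
    the total exponent negative (cutoff_error, cutoff_sum_cvg). *)

Set Implicit Arguments.
Unset Strict Implicit.
Unset Printing Implicit Defensive.

Import Order.TTheory GRing.Theory Num.Theory.
Import numFieldNormedType.Exports.
Import ComplexField.Normc.

Local Open Scope classical_set_scope.
Local Open Scope ring_scope.
Local Open Scope complex_scope.

#[local] Existing Instance totally_filter.

(** * Modulus, limits and derivatives of complex-valued functions *)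

Section ComplexModulus.
Context {R : realType}.
Implicit Types (z w : R[i]) (x y : R).

Lemma normcC0 : normc (0 : C R) = 0.
Proof. exact: normc0. Qed.

Lemma normc_ge0 z : 0 <= normc z.
Proof. by case: z => a b; exact: sqrtr_ge0. Qed.

Lemma normr_normc z : `|z| = (normc z)%:C.
Proof. by []. Qed.

Lemma normcB z w : normc (z - w) = normc (w - z).
Proof. by rewrite -normcN opprB. Qed.

Lemma normc_leB z w : normc (z - w) <= normc z + normc w.
Proof. by rewrite (le_trans (le_normcD _ _))// normcN. Qed.

Lemma normc_real x : normc x%:C = `|x|.
Proof. by rewrite /= expr0n addr0 sqrtr_sqr. Qed.

Lemma normc_Re z : `|complex.Re z| <= normc z.
Proof.
case: z => a b /=; rewrite -sqrtr_sqr ler_wsqrtr// lerDl; exact: sqr_ge0.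
Qed.

Lemma normc_Im z : `|complex.Im z| <= normc z.
Proof.
case: z => a b /=; rewrite -sqrtr_sqr ler_wsqrtr// lerDr; exact: sqr_ge0.
Qed.

Lemma normc_le z : normc z <= `|complex.Re z| + `|complex.Im z|.
Proof.
case: z => a b /=.
rewrite -[leRHS]ger0_norm ?addr_ge0// -[leRHS]sqrtr_sqr ler_wsqrtr//.
rewrite sqrrD !real_normK ?num_real// lerD2r lerDl.
by rewrite mulrn_wge0// mulr_ge0.
Qed.

Lemma normc_sum (I : Type) (r : seq I) (P : pred I) (F : I -> R[i]) :
  normc (\sum_(i <- r | P i) F i) <= \sum_(i <- r | P i) normc (F i).
Proof.
elim/big_rec2: _ => [|i y z _ le]; first by rewrite normc0.
by rewrite (le_trans (le_normcD _ _))// lerD2l.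
Qed.

Lemma cReM_real x z : complex.Re (x%:C * z) = x * complex.Re z.
Proof. by case: z => a b /=; rewrite mul0r subr0. Qed.

Lemma cImM_real x z : complex.Im (x%:C * z) = x * complex.Im z.
Proof. by case: z => a b /=; rewrite mul0r addr0. Qed.

Lemma cReD z w : complex.Re (z + w) = complex.Re z + complex.Re w.
Proof. by case: z w => [? ?] [? ?]. Qed.

Lemma cImD z w : complex.Im (z + w) = complex.Im z + complex.Im w.
Proof. by case: z w => [? ?] [? ?]. Qed.

Lemma cReN z : complex.Re (- z) = - complex.Re z.
Proof. by case: z. Qed.

Lemma cImN z : complex.Im (- z) = - complex.Im z.
Proof. by case: z. Qed.

Lemma cReM z w : complex.Re (z * w) =
  complex.Re z * complex.Re w - complex.Im z * complex.Im w.
Proof. by case: z w => [? ?] [? ?]. Qed.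

Lemma cImM z w : complex.Im (z * w) =
  complex.Re z * complex.Im w + complex.Im z * complex.Re w.
Proof. by case: z w => [? ?] [? ?]. Qed.

Lemma complex_eq z w :
  complex.Re z = complex.Re w -> complex.Im z = complex.Im w -> z = w.
Proof. by case: z w => [? ?] [? ?] /= -> ->. Qed.

Lemma cRe_sum (I : Type) (r : seq I) (P : pred I) (F : I -> R[i]) :
  complex.Re (\sum_(i <- r | P i) F i) = \sum_(i <- r | P i) complex.Re (F i).
Proof. by apply: (big_morph (@complex.Re R) cReD). Qed.

Lemma cIm_sum (I : Type) (r : seq I) (P : pred I) (F : I -> R[i]) :
  complex.Im (\sum_(i <- r | P i) F i) = \sum_(i <- r | P i) complex.Im (F i).
Proof. by apply: (big_morph (@complex.Im R) cImD). Qed.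

Lemma normc_eq0 z : normc z <= 0 -> z = 0.
Proof. by move=> z0; apply: eq0_normc; apply/eqP; rewrite eq_le z0 normc_ge0. Qed.

Lemma posC_Re (e : R[i]) : 0 < e -> 0 < complex.Re e /\ e = (complex.Re e)%:C.
Proof. by case: e => a b; rewrite ltcE /= => /andP[/eqP -> ->]. Qed.

End ComplexModulus.

Section ComplexLimits.
Context {R : realType}.

(** The norm of R[i] takes its values in R[i]; all estimates are carried out
    with the real modulus instead. *)
Lemma cvgCP (T : Type) (F : set_system T) (FF : Filter F) (f : T -> C R)
    (l : C R) :
  f x @[x --> F] --> l <->
  forall e : R, 0 < e -> \forall x \near F, normc (f x - l : R[i]) <= e.
Proof.
split=> [/cvgrPdistC_le fl e e0 | H].
  have := fl e%:C; rewrite ltcR => /(_ e0).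
  by apply: filterS => x; rewrite normr_normc lecR.
apply/cvgrPdistC_le => e /posC_Re [e0 ->].
by have := H _ e0; apply: filterS => x; rewrite normr_normc lecR.
Qed.

Lemma cvg_Re (T : Type) (F : set_system T) (FF : Filter F) (f : T -> C R)
    (l : C R) : f x @[x --> F] --> l ->
  complex.Re (f x) @[x --> F] --> complex.Re l.
Proof.
move=> /cvgCP fl; apply/cvgrPdistC_le => e e0.
have := fl _ e0; apply: filterS => x; apply: le_trans.
by rewrite -cReN -cReD normc_Re.
Qed.

Lemma cvg_Im (T : Type) (F : set_system T) (FF : Filter F) (f : T -> C R)
    (l : C R) : f x @[x --> F] --> l ->
  complex.Im (f x) @[x --> F] --> complex.Im l.
Proof.
move=> /cvgCP fl; apply/cvgrPdistC_le => e e0.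
have := fl _ e0; apply: filterS => x; apply: le_trans.
by rewrite -cImN -cImD normc_Im.
Qed.

Lemma cvg_complex (T : Type) (F : set_system T) (FF : Filter F) (f : T -> C R)
    (l : C R) : complex.Re (f x) @[x --> F] --> complex.Re l ->
  complex.Im (f x) @[x --> F] --> complex.Im l -> f x @[x --> F] --> l.
Proof.
move=> /cvgrPdistC_le fr /cvgrPdistC_le fi; apply/cvgCP => e e0.
have e2 : 0 < e / 2 by rewrite divr_gt0.
apply: filterS2 (fr _ e2) (fi _ e2) => x xr xi.
rewrite (le_trans (normc_le _))// cReD cImD cReN cImN (splitr e).
exact: lerD.
Qed.

Lemma nearC (p : C R) (P : C R -> Prop) (e : R) : 0 < e ->
  (forall z, normc (z - p : R[i]) < e -> P z) -> \forall z \near p, P z.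
Proof.
move=> e0 H; apply/nbhs_ballP; exists e%:C; first by rewrite /= ltcR.
by move=> z /=; rewrite /ball /= normr_normc ltcR normcB => /H.
Qed.

Lemma nearC_dnbhs (p : C R) (P : C R -> Prop) (e : R) : 0 < e ->
  (forall z, z != p -> normc (z - p : R[i]) < e -> P z) ->
  \forall z \near p^', P z.
Proof.
move=> e0 H; rewrite /dnbhs near_withinE.
by apply: (nearC e0) => z ze zp; apply: H.
Qed.

(** The form in which holomorphy is proved: a quadratic error bound passes
    under an integral sign, whereas a mere little-o does not. *)
Lemma derivableC_quadratic (g : C R -> C R) (z : C R) (l : R[i]) (K d : R) :
  0 < d ->
  (forall h : R[i], normc h < d ->
     normc (g (z + h) - g z - l * h : R[i]) <= K * normc h ^+ 2) ->
  derivable g z 1.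
Proof.
move=> d0 H; apply/cvg_ex; exists (l : C R).
apply/cvgCP => e e0.
pose K' := `|K| + 1.
have K0 : 0 < K' by rewrite ltr_pwDr.
apply: (@nearC_dnbhs _ _ (Num.min d (e / K'))).
  by rewrite lt_min d0 divr_gt0.
move=> h h0; rewrite subr0 lt_min => /andP[hd he].
have nh : 0 < normc h.
  rewrite lt_neqAle normc_ge0 andbT eq_sym; apply: contra h0 => /eqP.
  by move/eq0_normc => ->.
have -> : (h^-1 *: (g (h *: (1 : C R) + z) - g z) - l : R[i]) =
          h^-1 * (g (z + h) - g z - l * h).
  have -> : h *: (1 : C R) + z = z + h by rewrite addrC; congr (_ + _); exact: mulr1.
  change (h^-1 * (g (z + h) - g z) - l = h^-1 * (g (z + h) - g z - l * h)).
  by field.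
rewrite normcM normcV ler_pdivrMl//.
apply: le_trans (H _ hd) _.
rewrite expr2 mulrA mulrC ler_pM2l//.
apply: le_trans (_ : K' * normc h <= _).
  by rewrite ler_wpM2r ?(ltW nh)// (le_trans (ler_norm _))// lerDl.
by rewrite mulrC -ler_pdivlMr// ltW.
Qed.

End ComplexLimits.

Section UnorderedSums.
Context {I : choiceType}.

Lemma partial_sumE (V : zmodType) (u : I -> V) (J : {fset I}) :
  partial_sum u J = \sum_(i <- J) u i.
Proof. by rewrite /partial_sum big_seq_fsetE. Qed.

End UnorderedSums.

(** * Dilations of the half-line *)

Notation Rpos R := (`](0%R : Real.sort R), +oo[%classic).

Section Scaling.
Context {R : realType}.
Notation mu := (@lebesgue_measure R).
Local Open Scope ereal_scope.

Let measurable_dilation (r : R) : measurable_fun [set: measurableTypeR R]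
  ((fun x : R => (r * x)%R) : measurableTypeR R -> measurableTypeR R).
Proof. exact: mulrl_measurable. Qed.

(* The image of Lebesgue measure under x |-> r x, bundled as a measure. *)
Let dilated (r : R) : {measure set (measurableTypeR R) -> \bar R} :=
  measure_function_pushforward__canonical__measure_function_Measure
    mu (measurable_dilation r).

(** Half-open intervals determine a measure, and there the identity is
    r (b/r - a/r) = b - a. *)
Lemma lebesgue_measure_scale (r : R) (r0 : (0 < r)%R) (A : set R) :
  measurable A -> mu A = mscale (NngNum (ltW r0)) (dilated r) A.
Proof.
apply: lebesgue_measure_unique => X [[a b] _ /= <-].
rewrite /mscale/= /pushforward.
have -> : ((fun x : R => (r * x)%R) @^-1` `]a, b]) =
    [set` `]r^-1 * a, r^-1 * b]%R].
  by apply/seteqP; split => x /=; rewrite !in_itv /= ltr_pdivrMl// ler_pdivlMl.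
rewrite !lebesgue_measure_itv/= !lte_fin ltr_pM2l ?invr_gt0//.
case: ifP => _; last by rewrite mule0.
by rewrite -!EFinB -EFinM -mulrBr mulrA mulfV ?gt_eqF// mul1r.
Qed.

Lemma ge0_integral_scale (r : R) (D : set R) (f : R -> \bar R) : (0 < r)%R ->
  measurable D -> measurable_fun D f -> (forall x, D x -> 0 <= f x) ->
  \int[mu]_(x in D) f x =
  r%:E * \int[mu]_(x in [set x | D (r * x)%R]) f (r * x)%R.
Proof.
move=> r0 mD mf f0.
rewrite (eq_measure_integral (mscale (NngNum (ltW r0)) (dilated r))); last first.
  by move=> A mA _; exact: lebesgue_measure_scale.
rewrite ge0_integral_mscale//= ge0_integral_pushforward//.
by move=> x; rewrite inE; exact: f0.
Qed.

Lemma Rintegral_scale (r : R) (f : R -> R) : (0 < r)%R ->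
  mu.-integrable (Rpos R) (EFin \o f) ->
  (mu.-integrable (Rpos R) (fun x => (f (r * x))%:E) /\
  \int[mu]_(x in (Rpos R)) f x = r * \int[mu]_(x in (Rpos R)) f (r * x))%R.
Proof.
move=> r0 fi.
have E : [set x : R | (Rpos R) (r * x)%R] = (Rpos R).
  by apply/seteqP; split => x /=; rewrite !in_itv /= !andbT pmulr_rgt0.
have mf : measurable_fun (Rpos R) (EFin \o f) := measurable_int _ fi.
have mr : measurable_fun (Rpos R) (fun x : R => (r * x)%R).
  exact: mulrl_measurable.
have mfr : measurable_fun (Rpos R) (fun x : R => (f (r * x))%:E).
  apply: (@measurable_comp _ _ _ R R (\bar R) (Rpos R) (EFin \o f) (Rpos R)
    (fun x => (r * x)%R)) => //.
  by move=> _ [x /= x0 <-]; move: x0; rewrite /= !in_itv/= !andbT pmulr_rgt0.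
have S (g : R -> \bar R) : measurable_fun (Rpos R) g -> (forall x, 0 <= g x) ->
    \int[mu]_(x in (Rpos R)) g x = r%:E * \int[mu]_(x in (Rpos R)) g (r * x)%R.
  by move=> mg g0; rewrite (@ge0_integral_scale r)// E.
have fri : mu.-integrable (Rpos R) (fun x => (f (r * x))%:E).
  apply/integrableP; split => //.
  move/integrableP : fi => [_].
  rewrite (S (fun x => `|(f x)%:E|))//; last exact: measurableT_comp.
  move=> H; rewrite ltNge leye_eq; apply/negP => /eqP H'.
  by move: H; rewrite H' mulry gtr0_sg// mul1e ltxx.
split => //.
rewrite /Rintegral -[X in (_ = X * _)%R]/(fine r%:E) -fineM//; last first.
  exact: integrable_fin_num.
congr fine.
rewrite [LHS]integralE (S (EFin \o f)^\+)//; last exact: measurable_funepos.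
rewrite (S (EFin \o f)^\-)//; last exact: measurable_funeneg.
rewrite [X in _ = _ * X]integralE [RHS]muleBr//.
  by congr (_ * _ - _ * _); apply: eq_integral => x _;
    rewrite !(funeposE, funenegE).
apply: fin_num_adde_defl; rewrite fin_numN.
exact: (integrable_neg_fin_num _ fri).
Qed.

End Scaling.

(** * Integrals of complex-valued functions *)

Section ComplexIntegral.
Context {R : realType}.
Notation mu := (@lebesgue_measure R).
Implicit Types (A : set R) (f g : R -> C R) (G : R -> R).

Definition cmeasurable A f :=
  measurable_fun A (fun x => complex.Re (f x)) /\
  measurable_fun A (fun x => complex.Im (f x)).

Definition cintegrable A f :=
  mu.-integrable A (fun x => (complex.Re (f x))%:E) /\
  mu.-integrable A (fun x => (complex.Im (f x))%:E).

Lemma integrable_le A (F G : R -> R) : measurable A ->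
  mu.-integrable A (fun x => (G x)%:E) -> measurable_fun A F ->
  (forall x, A x -> `|F x| <= G x) -> mu.-integrable A (fun x => (F x)%:E).
Proof.
move=> mA iG mF FG; apply: le_integrable iG => //; first exact/measurable_EFinP.
by move=> x Ax /=; rewrite lee_fin (le_trans (FG _ Ax))// ler_norm.
Qed.

Lemma integrable_scalel A (k : R) (F : R -> R) : measurable A ->
  mu.-integrable A (fun x => (F x)%:E) ->
  mu.-integrable A (fun x => (k * F x)%:E).
Proof. by move=> mA iF; under eq_fun do rewrite EFinM; exact: integrableZl. Qed.

Lemma cintegrable_le A f G : measurable A ->
  mu.-integrable A (fun x => (G x)%:E) -> cmeasurable A f ->
  (forall x, A x -> normc (f x : R[i]) <= G x) -> cintegrable A f.
Proof.
move=> mA iG [mr mi] fG; split; apply: (integrable_le _ iG) => // x Ax.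
  by rewrite (le_trans (normc_Re _))// fG.
by rewrite (le_trans (normc_Im _))// fG.
Qed.

Lemma cmeasurableM A f g : cmeasurable A f -> cmeasurable A g ->
  cmeasurable A (fun x => f x * g x).
Proof.
move=> [fr fi] [gr gi]; split.
  under eq_fun do rewrite cReM.
  by apply: measurable_funB; apply: measurable_funM.
under eq_fun do rewrite cImM.
by apply: measurable_funD; apply: measurable_funM.
Qed.

Lemma cmeasurableD A f g : cmeasurable A f -> cmeasurable A g ->
  cmeasurable A (fun x => f x + g x).
Proof.
move=> [fr fi] [gr gi]; split.
  by under eq_fun do rewrite cReD; apply: measurable_funD.
by under eq_fun do rewrite cImD; apply: measurable_funD.
Qed.

Lemma cmeasurable_real A G : measurable_fun A G ->
  cmeasurable A (fun x => (G x)%:C).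
Proof. by move=> mG; split => //=; exact: measurable_cst. Qed.

Lemma cmeasurable_cst A (z : R[i]) : cmeasurable A (fun=> z).
Proof. by split; exact: measurable_cst. Qed.

Lemma cmeasurable_sum A (I : Type) (r : seq I) (F : I -> R -> C R) :
  (forall i, cmeasurable A (F i)) ->
  cmeasurable A (fun x => \sum_(i <- r) F i x).
Proof.
move=> mF; elim: r => [|i r IH].
  under eq_fun do rewrite big_nil; exact: cmeasurable_cst.
by under eq_fun do rewrite big_cons; exact: cmeasurableD.
Qed.

Lemma cmeasurable_cvg A (F : nat -> R -> C R) f :
  (forall n, cmeasurable A (F n)) ->
  (forall x, A x -> F n x @[n --> \oo] --> f x) -> cmeasurable A f.
Proof.
move=> mF Ff; split.
  apply: (measurable_fun_cvg (fun n => (mF n).1)) => x Ax.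
  by apply: cvg_Re; exact: Ff.
apply: (measurable_fun_cvg (fun n => (mF n).2)) => x Ax.
by apply: cvg_Im; exact: Ff.
Qed.

Lemma cmeasurable_itv_if (i : interval R) (A : set R) (f g : R -> C R) : measurable A ->
  cmeasurable A f -> cmeasurable A g ->
  cmeasurable A (fun x => if x \in i then f x else g x).
Proof.
move=> mA [fr fi] [gr gi].
have mi : measurable_fun A (fun x : R => x \in i).
  apply: (measurable_fun_bool true) => //.
  by rewrite [X in _ `&` X](_ : _ = [set` i])//; exact: measurableI.
have mif (u v : R -> R) : measurable_fun A u -> measurable_fun A v ->
    measurable_fun A (fun x => if x \in i then u x else v x).
  by move=> mu mv; apply: measurable_fun_if => //; apply: measurable_funS;
    (try exact: subIsetl).
split.
  by apply: (eq_measurable_fun _ _ (mif _ _ fr gr)) => x _ /=; case: ifP.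
by apply: (eq_measurable_fun _ _ (mif _ _ fi gi)) => x _ /=; case: ifP.
Qed.

Lemma cintegrableD A f g : measurable A -> cintegrable A f -> cintegrable A g ->
  cintegrable A (fun x => f x + g x).
Proof.
move=> mA [fr fi] [gr gi]; split.
  by under eq_fun do rewrite cReD EFinD; exact: integrableD.
by under eq_fun do rewrite cImD EFinD; exact: integrableD.
Qed.

Lemma cintegrableZ A (c : R[i]) f : measurable A -> cintegrable A f ->
  cintegrable A (fun x => c * f x).
Proof.
move=> mA [fr fi]; split.
  under eq_fun do rewrite cReM EFinB !EFinM.
  by apply: integrableB => //; exact: integrableZl.
under eq_fun do rewrite cImM EFinD !EFinM.
by apply: integrableD => //; exact: integrableZl.
Qed.

Lemma eq_cint A f g : (forall x, A x -> f x = g x) -> cint A f = cint A g.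
Proof.
move=> fg; rewrite /cint; congr (_ +i* _); apply: eq_Rintegral => x.
  by rewrite inE => Ax; rewrite fg.
by rewrite inE => Ax; rewrite fg.
Qed.

Lemma cintD A f g : measurable A -> cintegrable A f -> cintegrable A g ->
  cint A (fun x => f x + g x) = cint A f + cint A g :> R[i].
Proof.
move=> mA [fr fi] [gr gi]; rewrite /cint; apply: complex_eq => /=.
  by rewrite -RintegralD//; apply: eq_Rintegral => x _; rewrite cReD.
by rewrite -RintegralD//; apply: eq_Rintegral => x _; rewrite cImD.
Qed.

Lemma cintZ A (c : R[i]) f : measurable A -> cintegrable A f ->
  cint A (fun x => c * f x) = c * cint A f :> R[i].
Proof.
move=> mA [fr fi]; rewrite /cint; apply: complex_eq; rewrite ?cReM ?cImM/=.
  rewrite -!RintegralZl// -RintegralB//; try exact: integrable_scalel.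
  by apply: eq_Rintegral => x _; rewrite cReM.
rewrite -!RintegralZl// -RintegralD//; try exact: integrable_scalel.
by apply: eq_Rintegral => x _; rewrite cImM.
Qed.

Lemma cint0 A : cint A (fun=> 0) = 0 :> R[i].
Proof.
rewrite /cint /=; have -> : \int[mu]_(x in A) (0 : R) = 0; last by [].
by rewrite /Rintegral integral0.
Qed.

Lemma cintegrable0 A : cintegrable A (fun=> 0).
Proof. by split; exact: integrable0. Qed.

Lemma cintegrable_sum A (I : Type) (r : seq I) (F : I -> R -> C R) :
  measurable A -> (forall i, cintegrable A (F i)) ->
  cintegrable A (fun x => \sum_(i <- r) F i x).
Proof.
move=> mA iF; elim: r => [|i r IH].
  under eq_fun do rewrite big_nil; exact: cintegrable0.
by under eq_fun do rewrite big_cons; exact: cintegrableD.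
Qed.

Lemma cint_sum A (I : Type) (r : seq I) (F : I -> R -> C R) :
  measurable A -> (forall i, cintegrable A (F i)) ->
  cint A (fun x => \sum_(i <- r) F i x) = \sum_(i <- r) cint A (F i) :> R[i].
Proof.
move=> mA iF; elim: r => [|i r IH].
  by rewrite big_nil; under eq_fun do rewrite big_nil; exact: cint0.
rewrite big_cons -IH -cintD//; last exact: cintegrable_sum.
by under eq_fun do rewrite big_cons.
Qed.

(** The factor 2 is the price of estimating the real and imaginary parts
    separately. *)
Lemma normc_cint_le A f G : measurable A ->
  mu.-integrable A (fun x => (G x)%:E) -> cmeasurable A f ->
  (forall x, A x -> normc (f x : R[i]) <= G x) ->
  normc (cint A f : R[i]) <= 2 * \int[mu]_(x in A) G x.
Proof.
move=> mA iG mf fG; have [ir ii] := cintegrable_le mA iG mf fG.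
rewrite (le_trans (normc_le _))// mulr2n mulrDl !mul1r lerD//=.
  apply: le_trans (@le_normr_Rintegral _ _ _ mu A
    (fun x => complex.Re (f x)) mA ir) _.
  apply: le_Rintegral => //; first exact: integrable_norm.
  by move=> x Ax; rewrite (le_trans (normc_Re _))// fG.
apply: le_trans (@le_normr_Rintegral _ _ _ mu A
    (fun x => complex.Im (f x)) mA ii) _.
apply: le_Rintegral => //; first exact: integrable_norm.
by move=> x Ax; rewrite (le_trans (normc_Im _))// fG.
Qed.

Lemma Rintegral_dominated A (F : nat -> R -> R) (f G : R -> R) : measurable A ->
  mu.-integrable A (fun x => (G x)%:E) -> (forall n, measurable_fun A (F n)) ->
  (forall n x, A x -> `|F n x| <= G x) ->
  (forall x, A x -> F n x @[n --> \oo] --> f x) ->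
  \int[mu]_(x in A) F n x @[n --> \oo] --> \int[mu]_(x in A) f x.
Proof.
move=> mA iG mF FG Ff.
have mf : measurable_fun A f by exact: measurable_fun_cvg mF Ff.
have mF' n : measurable_fun A (fun x => (F n x)%:E).
  by apply/measurable_EFinP; exact: mF.
have mf' : measurable_fun A (fun x => (f x)%:E) by apply/measurable_EFinP.
have Ff' : {ae mu, forall x, A x -> (F n x)%:E @[n --> \oo] --> (f x)%:E}.
  apply: aeW => x Ax; apply: cvg_EFin; last exact: Ff.
  by near=> n.
have FG' : {ae mu, forall x n, A x -> (`|(F n x)%:E| <= (G x)%:E)%E}.
  by apply: aeW => x n Ax; rewrite lee_fin; exact: FG.
have [ifin _ H] :=   @dominated_convergence _ _ _ mu A mA _ _ _ mF' mf' Ff' iG FG'.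
by apply: fine_cvg; rewrite fineK//; apply: integrable_fin_num.
Unshelve. all: end_near. Qed.

Lemma cint_dominated A (F : nat -> R -> C R) f G : measurable A ->
  mu.-integrable A (fun x => (G x)%:E) -> (forall n, cmeasurable A (F n)) ->
  (forall n x, A x -> normc (F n x : R[i]) <= G x) ->
  (forall x, A x -> F n x @[n --> \oo] --> f x) ->
  cint A (F n) @[n --> \oo] --> cint A f.
Proof.
move=> mA iG mF FG Ff; apply: cvg_complex => /=.
  apply: (Rintegral_dominated _ iG) => //; first by move=> n; exact: (mF n).1.
    by move=> n x Ax; rewrite (le_trans (normc_Re _))// FG.
  by move=> x Ax; apply: cvg_Re; exact: Ff.
apply: (Rintegral_dominated _ iG) => //; first by move=> n; exact: (mF n).2.
  by move=> n x Ax; rewrite (le_trans (normc_Im _))// FG.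
by move=> x Ax; apply: cvg_Im; exact: Ff.
Qed.

Lemma cint_support A B f : (forall x, A x -> ~ B x -> f x = 0) ->
  (forall x, B x -> A x) -> cint A f = cint B f.
Proof.
move=> f0 BA; rewrite /cint; congr (_ +i* _);
  rewrite [LHS]Rintegral_mkcond [RHS]Rintegral_mkcond;
  apply: eq_Rintegral => x _; rewrite /patch; case: ifPn; rewrite ?inE ?notin_setE.
- move=> Ax; case: ifPn; rewrite ?inE ?notin_setE// => nB.
  by rewrite f0.
- by move=> nA; case: ifPn => //; rewrite inE => /BA.
- move=> Ax; case: ifPn; rewrite ?inE ?notin_setE// => nB.
  by rewrite f0.
- by move=> nA; case: ifPn => //; rewrite inE => /BA.
Qed.

Lemma cint_scale (r : R) f : 0 < r -> cintegrable (Rpos R) f ->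
  cintegrable (Rpos R) (fun x => f (r * x)) /\
  cint (Rpos R) f = r%:C * cint (Rpos R) (fun x => f (r * x)) :> R[i].
Proof.
move=> r0 [fr fi].
have [ir er] := Rintegral_scale r0 fr; have [ii ei] := Rintegral_scale r0 fi.
by split => //; apply: complex_eq; rewrite ?cReM_real ?cImM_real.
Qed.

End ComplexIntegral.

(** * Primitives and complex powers *)

Section PowerPrimitives.
Context {R : realType}.
Notation mu := (@lebesgue_measure R).
Implicit Types a b t e : R.

Lemma is_derive_expR_cos a b t : 0 < t ->
  is_derive t 1 (fun x : R => expR (a * ln x) * cos (b * ln x))
    ((a * (expR (a * ln t) * cos (b * ln t)) -
      b * (expR (a * ln t) * sin (b * ln t))) / t).
Proof.
move=> t0; have dl := is_derive1_ln t0.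
by apply: is_derive_eq; rewrite /GRing.scale /=; ring.
Qed.

Lemma is_derive_expR_sin a b t : 0 < t ->
  is_derive t 1 (fun x : R => expR (a * ln x) * sin (b * ln x))
    ((a * (expR (a * ln t) * sin (b * ln t)) +
      b * (expR (a * ln t) * cos (b * ln t))) / t).
Proof.
move=> t0; have dl := is_derive1_ln t0.
by apply: is_derive_eq; rewrite /GRing.scale /=; ring.
Qed.

Lemma continuous_expR_cos a b t : 0 < t ->
  {for t, continuous (fun x : R => expR (a * ln x) * cos (b * ln x))}.
Proof.
by move=> t0; apply: differentiable_continuous; apply/derivable1_diffP;
  case: (is_derive_expR_cos a b t0).
Qed.

Lemma continuous_expR_sin a b t : 0 < t ->
  {for t, continuous (fun x : R => expR (a * ln x) * sin (b * ln x))}.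
Proof.
by move=> t0; apply: differentiable_continuous; apply/derivable1_diffP;
  case: (is_derive_expR_sin a b t0).
Qed.

Lemma FTC_positive (F f : R -> R) a b : 0 < a -> a < b ->
  (forall t, 0 < t -> is_derive t 1 F (f t)) ->
  (forall t, 0 < t -> {for t, continuous f}) ->
  mu.-integrable `[a, b] (fun x => (f x)%:E) /\
  \int[mu]_(x in `[a, b]) f x = F b - F a.
Proof.
move=> a0 ab dF cf.
have cF t : 0 < t -> {for t, continuous F}.
  move=> t0; apply: differentiable_continuous; apply/derivable1_diffP.
  by case: (dF t t0).
have cfw : {within `[a, b], continuous f}.
  apply: continuous_in_subspaceT => x; rewrite inE /= in_itv /= => /andP[ax _].
  exact/cf/lt_le_trans/ax.
split.
  by apply: continuous_compact_integrable => //; exact: segment_compact.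
rewrite /Rintegral (@continuous_FTC2 _ f F)//.
- split.
  + move=> x; rewrite in_itv /= => /andP[ax _].
    by case: (dF x (lt_trans a0 ax)).
  + exact/cvg_at_right_filter/cF.
  + exact/cvg_at_left_filter/cF/(lt_trans a0).
- move=> x; rewrite in_itv /= => /andP[ax _]; rewrite derive1E.
  by have /@derive_val := dF x (lt_trans a0 ax).
Qed.

End PowerPrimitives.

Section ComplexPowers.
Context {R : realType}.
Implicit Types (x t : R) (z w : R[i]).

Lemma Re_cpow x z : complex.Re (cpow x z) =
  expR (complex.Re z * ln x) * cos (complex.Im z * ln x).
Proof. by rewrite /cpow cReM_real. Qed.

Lemma Im_cpow x z : complex.Im (cpow x z) =
  expR (complex.Re z * ln x) * sin (complex.Im z * ln x).
Proof. by rewrite /cpow cImM_real. Qed.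

Lemma powR_expR x (a : R) : 0 < x -> x `^ a = expR (a * ln x).
Proof. by move=> x0; rewrite /powR gt_eqF. Qed.

Lemma normc_cpow x z : 0 < x -> normc (cpow x z : R[i]) = x `^ complex.Re z.
Proof.
move=> x0; rewrite /cpow normcM normc_real ger0_norm ?expR_ge0//.
by rewrite /= cos2Dsin2 sqrtr1 mulr1 powR_expR.
Qed.

Lemma cpowD x z w : cpow x (z + w) = cpow x z * cpow x w :> R[i].
Proof.
apply: complex_eq.
  by rewrite [RHS]cReM !(Re_cpow, Im_cpow) cReD cImD !mulrDl expRD cosD; ring.
by rewrite [RHS]cImM !(Re_cpow, Im_cpow) cReD cImD !mulrDl expRD sinD; ring.
Qed.

Lemma cpowM x y z : 0 < x -> 0 < y ->
  cpow (x * y) z = cpow x z * cpow y z :> R[i].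
Proof.
move=> x0 y0; apply: complex_eq.
  by rewrite [RHS]cReM !(Re_cpow, Im_cpow) lnM// !mulrDr expRD cosD; ring.
by rewrite [RHS]cImM !(Re_cpow, Im_cpow) lnM// !mulrDr expRD sinD; ring.
Qed.

Lemma cpow_real x (a : R) : 0 < x -> cpow x a%:C = (x `^ a)%:C :> R[i].
Proof.
by move=> x0; rewrite powR_expR//; apply: complex_eq;
  rewrite ?Re_cpow ?Im_cpow /= mul0r ?cos0 ?sin0 ?mulr1 ?mulr0.
Qed.

Lemma cmeasurable_expR (A : set R) (l : R) :
  cmeasurable A (fun t => (expR (- (t * l)))%:C).
Proof.
apply/cmeasurable_real/measurable_funTS; apply: continuous_measurable_fun => t.
apply: continuous_comp; last exact: continuous_expR.
by apply: continuousN; apply: continuousM => //; exact: cst_continuous.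
Qed.

Lemma measurable_cpow (A : set R) z : cmeasurable A (fun t => cpow t z).
Proof.
have ml (b : R) : measurable_fun A (fun x => b * ln x).
  by apply: measurable_funM => //; apply: measurable_funTS; exact: measurable_ln.
split.
  under eq_fun do rewrite Re_cpow.
  apply: measurable_funM; apply: measurableT_comp (ml _);
    apply: continuous_measurable_fun; first exact: continuous_expR.
  exact: continuous_cos.
under eq_fun do rewrite Im_cpow.
apply: measurable_funM; apply: measurableT_comp (ml _);
  apply: continuous_measurable_fun; first exact: continuous_expR.
exact: continuous_sin.
Qed.

End ComplexPowers.

(** * Integrals of powers *)

Section PowerIntegrals.
Context {R : realType}.
Notation mu := (@lebesgue_measure R).
Implicit Types a b t e : R.

Let e_ (n : nat) : R := n.+2%:R^-1.

Let e_gt0 n : 0 < e_ n. Proof. by rewrite invr_gt0. Qed.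

Let e_lt1 n : e_ n < 1.
Proof. by rewrite invf_lt1 // ltr1n. Qed.

Let e_small t : 0 < t -> \forall n \near \oo, e_ n <= t.
Proof.
move=> t0; have := near_infty_natSinv_lt (PosNum t0).
apply: filterS => n /= /ltW; apply: le_trans.
by rewrite lef_pV2 ?posrE// ler_nat.
Qed.

Let unit_bigcup : \bigcup_n `[e_ n, 1]%classic = `]0, 1]%classic :> set R.
Proof.
apply/seteqP; split => [x [n _] /= | x /=].
  by rewrite !in_itv /= => /andP[ex ->]; rewrite (lt_le_trans (e_gt0 n)).
rewrite in_itv /= => /andP[x0 x1].
have [n _ Hn] := e_small x0.
by exists n => //=; rewrite in_itv /= Hn/=.
Qed.

(** Monotone convergence along the segments [1/(n+2), 1], on which t^a / a is a
    primitive; the integrals stay below 1/a. *)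
Lemma integrable_powR_unit a : 0 < a ->
  mu.-integrable `]0, 1] (fun t => (t `^ (a - 1))%:E).
Proof.
move=> a0.
have mp (D : set R) : measurable_fun D (fun t : R => (t `^ (a - 1))%:E).
  apply/measurable_EFinP; apply: measurable_funTS; exact: measurable_powR.
have I n : (\int[mu]_(t in `[e_ n, 1%R]) (t `^ (a - 1))%:E <= (a^-1)%:E)%E.
  pose f (t : R) := expR ((a - 1) * ln t).
  have df t : 0 < t -> is_derive t 1 (fun x : R => expR (a * ln x) / a) (f t).
    move=> t0; have dl := is_derive1_ln t0.
    apply: is_derive_eq; rewrite /f mulrBl mul1r expRB lnK ?posrE//.
    by rewrite /GRing.scale /=; field; rewrite !gt_eqF.
  have cf t : 0 < t -> {for t, continuous f}.
    move=> t0; have dl := is_derive1_ln t0.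
    apply: differentiable_continuous; apply/derivable1_diffP.
    exact: ex_derive.
  have [fi fE] := FTC_positive (e_gt0 n) (e_lt1 n) df cf.
  rewrite (_ : (\int[mu]_(t in `[e_ n, 1%R]) _)%E =
     (\int[mu]_(t in `[e_ n, 1%R]) (f t)%:E)%E); last first.
    apply: eq_integral => x; rewrite inE /= in_itv /= => /andP[ex _].
    by rewrite powR_expR// (lt_le_trans (e_gt0 n)).
  rewrite -[leLHS]fineK; last exact: integrable_fin_num.
  rewrite lee_fin; rewrite /Rintegral in fE; rewrite fE ln1 mulr0 expR0 mul1r.
  by rewrite gerBl divr_ge0 ?expR_ge0// ltW.
apply/integrableP; split; first exact: mp.
rewrite (_ : (\int[mu]_(x in `]0%R, 1%R]) _)%E =
  (\int[mu]_(x in `]0%R, 1%R]) (x `^ (a - 1))%:E)%E); last first.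
  by apply: eq_integral => x _; rewrite /= ger0_norm ?powR_ge0.
apply: (@le_lt_trans _ _ (a^-1)%:E); last exact: ltry.
rewrite -unit_bigcup.
have H : (\int[mu]_(x in `[e_ n, 1%R]) (x `^ (a - 1))%:E)%E @[n --> \oo] -->
    (\int[mu]_(x in \bigcup_n `[e_ n, 1%R]%classic) (x `^ (a - 1))%:E)%E.
  apply: ge0_nondecreasing_set_cvg_integral => //.
  - move=> n m nm; apply/subsetPset => x /=; rewrite !in_itv /= => /andP[ex ->].
    by rewrite andbT (le_trans _ ex)// lef_pV2 ?posrE// ler_nat.
  - by move=> n; exact: mp.
  - by move=> n x _; rewrite lee_fin powR_ge0.
rewrite -(cvg_lim _ H)//; apply: lime_le; first by apply/cvg_ex; eexists; exact: H.
by apply: nearW => n; exact: I.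
Qed.

Lemma integrable_inv_sqr : mu.-integrable `[1, +oo[ (fun t => (t `^ (- 2))%:E).
Proof.
have mp (D : set R) : measurable_fun D (fun t : R => (t `^ (- 2))%:E).
  apply/measurable_EFinP; apply: measurable_funTS; exact: measurable_powR.
have pE t : 0 <= t -> t `^ (- 2) = t ^- 2.
  by move=> t0; rewrite -powR_invn.
have dF (t : R) : 0 < t -> is_derive t 1 (fun x : R => - x^-1) (t ^- 2).
  move=> t0; have t1 : t != 0 by rewrite gt_eqF.
  have dV : is_derive t 1 (fun x : R => x^-1) (- t ^- 2).
    apply: DeriveDef; first exact: derivableV.
    by rewrite deriveV// derive_id /GRing.scale /= mulr1.
  by apply: is_derive_eq; rewrite opprK.
apply/integrableP; split; first exact: mp.
rewrite (_ : (\int[mu]_(x in `[1%R, +oo[) _)%E =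
  (\int[mu]_(x in `[1%R, +oo[) (x ^- 2)%:E)%E); last first.
  apply: eq_integral => x; rewrite inE /= in_itv /= andbT => x1.
  by rewrite ger0_norm ?powR_ge0// pE// (le_trans ler01).
rewrite (@ge0_continuous_FTC2y _ _ (fun x : R => - x^-1) _ 0).
- by rewrite -EFinB ltry.
- by move=> x x1; rewrite invr_ge0 exprn_ge0// (le_trans ler01).
- apply: continuous_in_subspaceT => x; rewrite inE /= in_itv /= andbT => x1.
  apply: cvgV; last exact: exprn_continuous.
  by rewrite expf_neq0// gt_eqF// (lt_le_trans ltr01).
- rewrite -oppr0; apply: cvgN; apply/(@gtr0_cvgV0 _ _ _ _ id) => //.
  exact: nbhs_pinfty_gt.
- by move=> x x1; case: (dF x (lt_trans ltr01 x1)).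
- by apply: cvg_at_right_filter; apply: cvgN; apply: cvgV => //; exact: oner_neq0.
- move=> x; rewrite in_itv /= andbT => x1; rewrite derive1E.
  by have /@derive_val := dF x (lt_trans ltr01 x1).
Qed.

(** The integrable majorant used throughout: it keeps the singularity t^(a-1)
    at 0, and at infinity takes a fixed integrable power because all functions
    integrated below decay rapidly there. *)
Definition two_powers a t : R := if t <= 1 then t `^ (a - 1) else t `^ (- 2).

Lemma two_powers_ge0 a t : 0 <= two_powers a t.
Proof. by rewrite /two_powers; case: ifP => _; exact: powR_ge0. Qed.

Lemma integrable_two_powers a : 0 < a ->
  mu.-integrable (Rpos R) (fun t => (two_powers a t)%:E).
Proof.
move=> a0.
have i1 := integrable_powR_unit a0.
have i2 : mu.-integrable `]1, +oo[ (fun t => (t `^ (- 2))%:E).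
  apply: integrableS integrable_inv_sqr => //.
  by move=> x /=; rewrite !in_itv /= !andbT => /ltW.
have E : Rpos R = `]0, 1]%classic `|` `]1, +oo[%classic.
  apply/seteqP; split => x /=; rewrite !in_itv /= !andbT.
    by move=> x0; have [x1|x1] := leP x 1; [left; rewrite x0|right].
  by move=> [/andP[]//|]; exact: lt_trans.
rewrite E.
have {}i1 : mu.-integrable `]0, 1] (fun t => (two_powers a t)%:E).
  apply: eq_integrable i1 => //.
  by move=> x; rewrite inE /= in_itv /= /two_powers => /andP[_ ->].
have {}i2 : mu.-integrable `]1, +oo[ (fun t => (two_powers a t)%:E).
  apply: eq_integrable i2 => //.
  by move=> x; rewrite inE /= in_itv /= /two_powers andbT ltNge => /negbTE ->.
move/integrableP: i1 => [m1 b1]; move/integrableP: i2 => [m2 b2].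
apply/integrableP; split; first exact/measurable_funU.
rewrite ge0_integral_setU//.
- by rewrite lte_add_pinfty.
- by apply: measurableT_comp => //; apply/measurable_funU.
- apply/disj_setPS => x [] /=; rewrite !in_itv /= andbT => /andP[_ x1].
  by rewrite ltNge x1.
Qed.

Lemma cintegrable_two_powers (f : R -> C R) a K : 0 < a ->
  cmeasurable (Rpos R) f ->
  (forall t, 0 < t -> normc (f t : R[i]) <= K * two_powers a t) ->
  cintegrable (Rpos R) f.
Proof.
move=> a0 mf fK; apply: (@cintegrable_le _ _ _ (fun t => K * two_powers a t)) => //.
  by apply: integrable_scalel => //; exact: integrable_two_powers.
by move=> t /=; rewrite in_itv /= andbT => /fK.
Qed.

(** t^w is a primitive of w t^(w-1); the fundamental theorem of calculus is
    applied to its real and imaginary parts. *)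
Lemma cint_cpow_segment (w : R[i]) e : 0 < e -> e < 1 ->
  w * cint `[e, 1] (fun t => cpow t (w - 1)) = 1 - cpow e w :> R[i].
Proof.
move=> e0 e1.
pose g := fun t : R => cpow t (w - 1) : C R.
set a := complex.Re w; set b := complex.Im w.
pose P (t : R) := expR (a * ln t) * cos (b * ln t).
pose Q (t : R) := expR (a * ln t) * sin (b * ln t).
have gE t : 0 < t -> complex.Re (g t) = P t / t /\ complex.Im (g t) = Q t / t.
  move=> t0; have -> : g t = cpow t w * (t^-1)%:C :> R[i].
    rewrite /g cpowD; congr (_ * _).
    rewrite -[(-1)]/(- (1%:C)) -rmorphN /= cpow_real//.
    by rewrite -powR_inv1// ltW.
  by rewrite mulrC cReM_real cImM_real Re_cpow Im_cpow ![t^-1 * _]mulrC.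
have cV (f : R -> R) t : 0 < t -> {for t, continuous f} ->
    {for t, continuous (fun x => f x / x)}.
  by move=> t0 cf; apply: continuousM => //; apply: continuousV; rewrite ?gt_eqF//.
have cP t : 0 < t -> {for t, continuous (fun x => P x / x)}.
  by move=> t0; apply: cV => //; exact: continuous_expR_cos.
have cQ t : 0 < t -> {for t, continuous (fun x => Q x / x)}.
  by move=> t0; apply: cV => //; exact: continuous_expR_sin.
have integ (f : R -> R) : (forall t, 0 < t -> {for t, continuous f}) ->
    mu.-integrable `[e, 1] (fun t => (f t)%:E).
  move=> cf; apply: continuous_compact_integrable; first exact: segment_compact.
  apply: continuous_in_subspaceT => x; rewrite inE /= in_itv /= => /andP[ex _].
  exact/cf/(lt_le_trans (e0) ex).
have pos t : `[e, 1]%classic t -> 0 < t.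
  by rewrite /= in_itv /= => /andP[+ _]; exact: lt_le_trans.
have ig : cintegrable `[e, 1] g.
  split; [move: (integ _ cP)|move: (integ _ cQ)]; apply: eq_integrable => // x;
    rewrite inE => /pos x0.
    by rewrite (gE x x0).1.
  by rewrite (gE x x0).2.
rewrite -cintZ//.
have cPQ (c d : R) t : 0 < t ->
    {for t, continuous (fun x => (c * P x + d * Q x) / x)}.
  move=> t0; apply: cV => //; apply: continuousD; apply: continuousM;
    try exact: cst_continuous; first exact: continuous_expR_cos.
  exact: continuous_expR_sin.
apply: complex_eq.
  rewrite cReD cReN Re_cpow -/(P _).
  have [t t0|t t0|_ E] := @FTC_positive _ P (fun t => (a * P t + (- b) * Q t) / t) _ _ e0 e1.
  - by apply: is_derive_eq (is_derive_expR_cos a b t0) _; rewrite -/(P t) -/(Q t) mulNr.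
  - exact: cPQ.
  have -> : complex.Re (1 : R[i]) = P 1 by rewrite /P ln1 !mulr0 expR0 cos0 mulr1.
  rewrite -E; apply: eq_Rintegral => x; rewrite inE => /pos x0.
  by rewrite cReM (gE x x0).1 (gE x x0).2 /a /b; ring.
rewrite cImD cImN Im_cpow -/(Q _).
have [t t0|t t0|_ E] := @FTC_positive _ Q (fun t => (b * P t + a * Q t) / t) _ _ e0 e1.
- by apply: is_derive_eq (is_derive_expR_sin a b t0) _; rewrite -/(P t) -/(Q t) addrC.
- exact: cPQ.
have -> : complex.Im (1 : R[i]) = Q 1 by rewrite /Q ln1 !mulr0 expR0 sin0 mulr0.
rewrite -E; apply: eq_Rintegral => x; rewrite inE => /pos x0.
by rewrite cImM (gE x x0).1 (gE x x0).2 /a /b; ring.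
Qed.

(** On [e, 1] the integral is (1 - e^w) / w, and e^w tends to 0 with e because
    Re w > 0.  This is where the poles of the zeta function come from. *)
Lemma cint_cpow_unit (w : R[i]) : 0 < complex.Re w ->
  cint `]0, 1] (fun t => cpow t (w - 1)) = w^-1 :> R[i].
Proof.
move=> w0.
have w1 : w != 0 by apply: contraTneq w0 => ->; rewrite ltxx.
pose g := fun t : R => cpow t (w - 1) : C R.
pose F n := fun t : R => if t \in `[e_ n, 1] then g t else 0.
have step n : w * cint `]0, 1] (F n) = 1 - cpow (e_ n) w.
  have -> : cint `]0, 1] (F n) = cint `[e_ n, 1] g.
    rewrite (@cint_support _ _ `[e_ n, 1]%classic).
    - by apply: eq_cint => x /= xe; rewrite /F xe.
    - by move=> x _ /negP xe; rewrite /F (negbTE xe).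
    - move=> x /=; rewrite !in_itv /= => /andP[ex ->].
      by rewrite (lt_le_trans (e_gt0 n)).
  exact: cint_cpow_segment (e_gt0 n) (e_lt1 n).
have L1 : (cint `]0, 1] (F n) : C R) @[n --> \oo] --> (cint `]0, 1] g : C R).
  apply: (@cint_dominated _ _ _ _ (fun t => t `^ (complex.Re w - 1))) => //.
  - exact: integrable_powR_unit.
  - by move=> n; apply: cmeasurable_itv_if => //; exact: measurable_cpow.
  - move=> n t /=; rewrite in_itv /= => /andP[t0 t1]; rewrite /F; case: ifP => _.
      by rewrite normc_cpow// cReD cReN.
    by rewrite normcC0 powR_ge0.
  - move=> t /=; rewrite in_itv /= => /andP[t0 t1].
    apply: cvg_near_cst; have := e_small t0; apply: filterS => n en.
    by rewrite /F in_itv /= en t1.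
have L2 : (cint `]0, 1] (F n) : C R) @[n --> \oo] --> (w^-1 : C R).
  apply/cvgCP => eps eps0.
  have eps1 : 0 < eps * normc w.
    rewrite mulr_gt0// lt_neqAle normc_ge0 andbT eq_sym.
    by apply: contra w1 => /eqP/eq0_normc ->.
  have := e_small (powR_gt0 (complex.Re w)^-1 eps1).
  apply: filterS => n en.
  have -> : cint `]0, 1] (F n) - w^-1 = - (w^-1 * cpow (e_ n) w) :> R[i].
    by apply: (mulfI w1); rewrite mulrBr step; field.
  rewrite normcN normcM normcV ler_pdivrMl; last first.
    by move: eps1; rewrite pmulr_rgt0.
  rewrite mulrC normc_cpow//.
  apply: (@le_trans _ _ (((eps * normc w) `^ (complex.Re w)^-1) `^ complex.Re w)).
    by apply: ge0_ler_powR => //; rewrite ?nnegrE ?powR_ge0//; exact: ltW.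
  by rewrite -powRrM mulVf ?gt_eqF// powRr1// ltW.
exact: (cvg_unique (@norm_hausdorff _ (C R)) L1 L2).
Qed.

End PowerIntegrals.

(** * Elementary estimates of the exponential *)

Section ElementaryBounds.
Context {R : realType}.
Implicit Types x y t : R.

Lemma mvt_bound (f df : R -> R) (c y : R) :
  (forall x, is_derive x 1 f (df x)) -> f 0 = 0 -> 0 <= y ->
  (forall x, 0 <= x <= y -> `|df x| <= c) -> `|f y| <= c * y.
Proof.
move=> dF f0 y0 bF.
have cf : {within `[0, y], continuous f}.
  apply: continuous_subspaceT => x; apply: differentiable_continuous.
  by apply/derivable1_diffP; case: (dF x).
have [x xy] := MVT_segment y0 (fun x _ => dF x) cf.
rewrite f0 !subr0 => ->; rewrite normrM (ger0_norm y0) ler_wpM2r//.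
by apply: bF; move: xy; rewrite in_itv.
Qed.

Lemma cosB1_le_norm y : `|cos y - 1| <= `|y|.
Proof.
wlog y0 : y / 0 <= y => [H|].
  have [/H//|/ltW yn] := leP 0 y.
  by rewrite -cosN -[in leRHS]normrN H// oppr_ge0.
rewrite (ger0_norm y0) -[leRHS]mul1r.
apply: (@mvt_bound (fun x => cos x - 1) (fun x => - sin x)) => //.
- by move=> x; apply: is_derive_eq; rewrite subr0.
- by rewrite cos0 subrr.
- by move=> x _; rewrite normrN sin_max.
Qed.

Lemma cosB1_le y : `|cos y - 1| <= y ^+ 2.
Proof.
wlog y0 : y / 0 <= y => [H|].
  have [/H//|/ltW yn] := leP 0 y.
  by rewrite -cosN -[in leRHS]sqrrN H// oppr_ge0.
rewrite expr2; apply: (@mvt_bound (fun x => cos x - 1) (fun x => - sin x)) => //.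
- by move=> x; apply: is_derive_eq; rewrite subr0.
- by rewrite cos0 subrr.
move=> x /andP[x0 xy]; rewrite normrN.
apply: le_trans xy; rewrite -[leRHS]mul1r.
apply: (@mvt_bound sin cos) => //; first exact: sin0.
by move=> z _; exact: cos_max.
Qed.

Lemma sinBid_le y : `|sin y - y| <= y ^+ 2.
Proof.
wlog y0 : y / 0 <= y => [H|].
  have [/H//|/ltW yn] := leP 0 y.
  have := H (- y); rewrite oppr_ge0 sinN sqrrN => /(_ yn).
  by rewrite -opprD normrN.
rewrite expr2; apply: (@mvt_bound (fun x => sin x - x) (fun x => cos x - 1)) => //.
- by rewrite sin0 subrr.
by move=> x /andP[x0 xy]; rewrite (le_trans (cosB1_le_norm _))// ger0_norm.
Qed.

Lemma expRB1_le_id x : expR x - 1 <= x * expR x.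
Proof.
have := expR_ge1Dx (- x); rewrite -(ler_pM2r (expR_gt0 x)) mulrDl mul1r.
by rewrite expRN mulVf ?gt_eqF ?expR_gt0// mulNr; lra.
Qed.

Lemma expRB1_le x : `|expR x - 1| <= `|x| * expR `|x|.
Proof.
have e1 : 1 <= expR `|x| by rewrite -expR0 ler_expR.
rewrite ler_norml; apply/andP; split.
  have h : `|x| <= `|x| * expR `|x| by rewrite ler_peMr.
  have := expR_ge1Dx x; have := ler_norm (- x); rewrite normrN; lra.
apply: le_trans (expRB1_le_id _) _.
apply: (@le_trans _ _ (`|x| * expR x)).
  by rewrite ler_wpM2r ?expR_ge0// ler_norm.
by rewrite ler_wpM2l// ler_expR ler_norm.
Qed.

Lemma expRB1x_le x : `|expR x - 1 - x| <= x ^+ 2 * expR `|x|.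
Proof.
rewrite ger0_norm; last by have := expR_ge1Dx x; lra.
apply: (@le_trans _ _ (x * (expR x - 1))).
  by have := expRB1_le_id x; lra.
rewrite (le_trans (ler_norm _))// normrM.
apply: le_trans (ler_wpM2l (normr_ge0 _) (expRB1_le _)) _.
by rewrite mulrA -expr2 real_normK ?num_real.
Qed.

(** Second order Taylor estimate of exp at the origin, for the complex number
    x + iy.  It is applied to x + iy = h ln t, for which exp is t^h. *)
Lemma cexp_quadratic x y (u : R) : `|x| <= u -> `|y| <= u ->
  normc ((expR x * cos y - 1 - x) +i* (expR x * sin y - y)) <=
    4 * u ^+ 2 * expR u.
Proof.
move=> xu yu; have u0 : 0 <= u by apply: le_trans xu.
have x2 : x ^+ 2 <= u ^+ 2.
  by rewrite -real_normK ?num_real// ler_sqr ?nnegrE.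
have y2 : y ^+ 2 <= u ^+ 2.
  by rewrite -real_normK ?num_real// ler_sqr ?nnegrE.
have xy : `|x| * `|y| <= u ^+ 2 by rewrite expr2 ler_pM.
have eu : expR `|x| <= expR u by rewrite ler_expR.
have ex : expR x <= expR u by rewrite ler_expR (le_trans (ler_norm _)).
have e0 := expR_ge0 u; have q0 := sqr_ge0 u.
apply: le_trans (normc_le _) _ => /=.
have -> : expR x * cos y - 1 - x = (expR x - 1 - x) + expR x * (cos y - 1) by ring.
have -> : expR x * sin y - y = expR x * (sin y - y) + y * (expR x - 1) by ring.
have b1 : `|expR x - 1 - x| <= u ^+ 2 * expR u.
  by apply: le_trans (expRB1x_le _) _; rewrite ler_pM ?sqr_ge0 ?expR_ge0.
have b2 : `|expR x * (cos y - 1)| <= u ^+ 2 * expR u.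
  rewrite normrM ger0_norm ?expR_ge0// mulrC ler_pM ?expR_ge0//.
  exact: le_trans (cosB1_le _) _.
have b3 : `|expR x * (sin y - y)| <= u ^+ 2 * expR u.
  rewrite normrM ger0_norm ?expR_ge0// mulrC ler_pM ?expR_ge0//.
  exact: le_trans (sinBid_le _) _.
have b4 : `|y * (expR x - 1)| <= u ^+ 2 * expR u.
  rewrite normrM (le_trans (ler_wpM2l _ (expRB1_le _)))// mulrA [X in X * _]mulrC.
  by rewrite ler_pM ?mulr_ge0 ?expR_ge0.
have t1 := ler_normD (expR x - 1 - x) (expR x * (cos y - 1)).
have t2 := ler_normD (expR x * (sin y - y)) (y * (expR x - 1)).
lra.
Qed.

(** A single term of the exponential series, of degree above |b|, already
    dominates t^(-b) on [1, +oo[. *)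
Lemma expRN_le_power (kappa b : R) : 0 < kappa ->
  exists2 K, 0 <= K & forall t, 1 <= t -> expR (- (kappa * t)) <= K * t `^ b.
Proof.
move=> k0; pose n := Num.truncn `|b|.
exists (n.+1`!%:R / kappa ^+ n.+1); first by rewrite divr_ge0// exprn_ge0// ltW.
move=> t t1; have t0 : 0 < t by rewrite (lt_le_trans ltr01).
apply: (@le_trans _ _ (n.+1`!%:R / (kappa * t) ^+ n.+1)).
  have p : 0 < (kappa * t) ^+ n.+1 / n.+1`!%:R.
    by rewrite divr_gt0 ?exprn_gt0 ?mulr_gt0// ltr0n fact_gt0.
  rewrite expRN -[leRHS]invf_div lef_pV2 ?posrE ?expR_gt0//.
  by apply: le_trans (expR_ge1Dxn n _); rewrite ?lerDr// mulr_ge0// ltW.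
rewrite exprMn invfM mulrA ler_wpM2l//.
  by rewrite divr_ge0// exprn_ge0// ltW.
rewrite -powR_invn ?(ltW t0)// ler_powR// lerNl.
have := truncnS_gt `|b|; rewrite -/n => /ltW; apply: le_trans.
by rewrite (le_trans (ler_norm _))// normrN.
Qed.

End ElementaryBounds.

(** * Gamma integral and Mellin transform *)

Section GammaScaling.
Context {R : realType}.

Lemma cintegrable_Gamma (z : R[i]) : 0 < complex.Re z ->
  cintegrable (Rpos R) (fun t => cpow t (z - 1) * (expR (- t))%:C).
Proof.
move=> z0.
have [K K0 HK] := @expRN_le_power R 1 (- 1 - complex.Re z) ltr01.
apply: (@cintegrable_two_powers _ _ (complex.Re z) (1 + K)) => //.
  apply: cmeasurableM; first exact: measurable_cpow.
  rewrite [X in cmeasurable _ X](_ : _ = fun t => (expR (- (t * 1)))%:C).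
    exact: cmeasurable_expR.
  by apply/funext => t; rewrite mulr1.
move=> t t0; rewrite normcM normc_real (ger0_norm (expR_ge0 _)) normc_cpow//.
rewrite cReD cReN /two_powers; case: ifPn => [t1|].
  apply: (@le_trans _ _ (t `^ (complex.Re z - 1))).
    by rewrite ler_piMr ?powR_ge0// -expR0 ler_expR oppr_le0 ltW.
  by rewrite ler_peMl ?powR_ge0// lerDl.
rewrite -ltNge => /ltW t1.
apply: (@le_trans _ _ (t `^ (complex.Re z - 1) * (K * t `^ (- 1 - complex.Re z)))).
  by rewrite ler_wpM2l ?powR_ge0// -[t in expR (- t)]mul1r HK.
rewrite mulrCA -powRD; last by rewrite (gt_eqF t0) implybT.
have -> : complex.Re z - 1 + (- 1 - complex.Re z) = - 2 by ring.
by rewrite ler_wpM2r ?powR_ge0// lerDr.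
Qed.

(** The substitution t -> l t in Euler's integral: the Mellin transform of
    exp(-l t) is Gamma(z) l^(-z), which links heat traces to zeta functions. *)
Lemma cint_Gamma_scale (z : R[i]) (l : R) : 0 < complex.Re z -> 0 < l ->
  cint (Rpos R) (fun t => cpow t (z - 1) * (expR (- (t * l)))%:C) =
    cGamma z * cpow l (- z) :> R[i].
Proof.
move=> z0 l0; have [_ E] := cint_scale l0 (cintegrable_Gamma z0).
rewrite /cGamma E.
have [Il _] := cint_scale l0 (cintegrable_Gamma z0).
have -> : cint (Rpos R) (fun t => cpow t (z - 1) * (expR (- (t * l)))%:C) =
   cpow l (1 - z) * cint (Rpos R)
     (fun t => cpow (l * t) (z - 1) * (expR (- (l * t)))%:C) :> R[i].
  rewrite -cintZ//; apply: eq_cint => t /=; rewrite in_itv /= andbT => t0.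
  have h : cpow l (1 - z) * cpow (l * t) (z - 1) = cpow t (z - 1) :> R[i].
    rewrite cpowM// mulrA -cpowD [1 - z + _]addrA subrK subrr.
    rewrite (_ : cpow l 0 = 1 :> R[i]) ?mul1r//.
    by apply: complex_eq; rewrite ?Re_cpow ?Im_cpow /= !mul0r expR0 ?cos0 ?sin0 mul1r.
  by rewrite [t * l]mulrC -[in LHS]h; exact/esym/mulrA.
have h : cpow l (1 - z) = l%:C * cpow l (- z) :> R[i].
  by rewrite cpowD (cpow_real 1 l0) powRr1// ltW.
by rewrite h; exact: mulrAC.
Qed.

End GammaScaling.

Section MellinTransform.
Context {R : realType}.
Variables (rho : R -> C R) (s' K : R).
Hypothesis mrho : cmeasurable (Rpos R) rho.
Hypothesis rho0 : forall t, 0 < t -> t <= 1 ->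
  normc (rho t : R[i]) <= K * t `^ (- s').
Hypothesis rhoy : forall N : R, exists K', forall t, 1 <= t ->
  normc (rho t : R[i]) <= K' * t `^ (- N).

(** The factor exp(d |ln t|) leaves room for the powers t^h and the logarithms
    met when differentiating in the exponent; its price is a loss of d in the
    exponent at 0. *)
Lemma mellin_two_powers (sigma d : R) :
  exists2 M, 0 <= M & forall t, 0 < t ->
    t `^ (sigma - 1) * normc (rho t : R[i]) * expR (d * `|ln t|) <=
      M * two_powers (sigma - s' - d) t.
Proof.
have [K' HK'] := rhoy (sigma + 1 + d).
exists (`|K| + `|K'|); first by rewrite addr_ge0.
move=> t t0; rewrite /two_powers; case: ifPn => [t1|].
  have -> : expR (d * `|ln t|) = t `^ (- d).
    by rewrite powR_expR// ler0_norm ?ln_le0// mulrN mulNr.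
  apply: (@le_trans _ _ (t `^ (sigma - 1) * (K * t `^ (- s')) * t `^ (- d))).
    by rewrite ler_wpM2r ?powR_ge0// ler_wpM2l ?powR_ge0// rho0.
  rewrite mulrCA -mulrA -!powRD; try by rewrite (gt_eqF t0) implybT.
  rewrite (_ : sigma - 1 - s' - d = sigma - s' - d - 1); last by ring.
  by rewrite ler_wpM2r ?powR_ge0// (le_trans (ler_norm _))// lerDl.
rewrite -ltNge => /ltW t1.
have -> : expR (d * `|ln t|) = t `^ d.
  by rewrite powR_expR// ger0_norm// ln_ge0.
apply: (@le_trans _ _ (t `^ (sigma - 1) * (K' * t `^ (- (sigma + 1 + d))) * t `^ d)).
  by rewrite ler_wpM2r ?powR_ge0// ler_wpM2l ?powR_ge0// HK'.
rewrite mulrCA -mulrA -!powRD; try by rewrite (gt_eqF t0) implybT.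
rewrite (_ : sigma - 1 - (sigma + 1 + d) + d = - 2); last by ring.
by rewrite ler_wpM2r ?powR_ge0// (le_trans (ler_norm _))// lerDr.
Qed.

Lemma cintegrable_mellin (z : R[i]) : s' < complex.Re z ->
  cintegrable (Rpos R) (fun t => cpow t (z - 1) * rho t).
Proof.
move=> sz; have [M M0 HM] := mellin_two_powers (complex.Re z) 0.
apply: (@cintegrable_two_powers _ _ (complex.Re z - s' - 0) M).
- by rewrite subr0 subr_gt0.
- by apply: cmeasurableM => //; exact: measurable_cpow.
move=> t t0; have := HM t t0; rewrite mul0r expR0 mulr1.
by rewrite normcM normc_cpow// cReD cReN.
Qed.

(** Differentiation under the integral.  The integrand of the difference
    quotient has error t^(z-1) rho(t) (t^h - 1 - h ln t); the last factor is at
    most 4 |h ln t|^2 exp(|h ln t|), and |ln t|^2 is absorbed by another small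
    power of t. *)
Lemma derivable_mellin (z : C R) : s' < complex.Re z ->
  derivable (fun w : C R => (cint (Rpos R) (fun t => cpow t (w - 1) * rho t) : C R)) z 1.
Proof.
(* One d bounds |h|, another absorbs |ln t|^2; the two that remain keep the
   exponent b positive. *)
move=> sz; pose d := (complex.Re z - s') / 4.
have d0 : 0 < d by rewrite divr_gt0// subr_gt0.
pose b := complex.Re z - s' - (d + d).
have b0 : 0 < b by rewrite /b /d; lra.
have [M M0 HM] := mellin_two_powers (complex.Re z) (d + d).
have dle (x : R) : 0 <= x -> x <= d^-1 * expR (d * x) /\
    x ^+ 2 <= 2 / d ^+ 2 * expR (d * x).
  move=> x0; have dx : 0 <= d * x by rewrite mulr_ge0// ltW.
  have h1 := expR_ge1Dx (d * x); have h2 := expR_ge1Dxn 1 dx.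
  split; first by rewrite ler_pdivlMl//; lra.
  rewrite mulrAC ler_pdivlMr ?exprn_gt0// -exprMn [x * d]mulrC.
  by move: h2; rewrite (_ : 2`!%:R = 2)//; lra.
have lnE t : expR ((d + d) * `|ln t|) = expR (d * `|ln t|) * expR (d * `|ln t|).
  by rewrite mulrDl expRD.
have le1 t : 1 <= expR (d * `|ln t|).
  by rewrite -expR0 ler_expR mulr_ge0// ltW.
have mln : cmeasurable (Rpos R) (fun t => (ln t)%:C).
  by apply: cmeasurable_real; apply: measurable_funTS; exact: measurable_ln.
have mz := cmeasurableM (@measurable_cpow _ (Rpos R) (z - 1)) mrho.
have inorm t : 0 < t -> normc (cpow t (z - 1) * rho t : R[i]) =
    t `^ (complex.Re z - 1) * normc (rho t : R[i]).
  by move=> t0; rewrite normcM normc_cpow// cReD cReN.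
pose l : R[i] := cint (Rpos R) (fun t => (cpow t (z - 1) * rho t) * (ln t)%:C).
have il : cintegrable (Rpos R) (fun t => (cpow t (z - 1) * rho t) * (ln t)%:C).
  apply: (@cintegrable_two_powers _ _ b (d^-1 * M)) => //; first exact: cmeasurableM.
  move=> t t0; rewrite normcM inorm// normc_real.
  have [h _] := dle _ (normr_ge0 (ln t)).
  rewrite -[leRHS]mulrA; apply: le_trans (ler_wpM2l _ (HM t t0)); last first.
    by rewrite invr_ge0 ltW.
  rewrite mulrCA ler_wpM2l ?mulr_ge0 ?powR_ge0 ?normc_ge0//.
  apply: le_trans h _; rewrite ler_wpM2l ?invr_ge0 ?(ltW d0)//.
  by rewrite lnE ler_peMr ?expR_ge0.
pose K2 : R := 2 * \int[lebesgue_measure]_(t in Rpos R)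
  ((8 / d ^+ 2 * M) * two_powers b t).
apply: (@derivableC_quadratic _ _ z l K2 d d0) => h hd.
have iz := cintegrable_mellin sz.
have szh : s' < complex.Re (z + h).
  rewrite cReD; have := le_lt_trans (normc_Re h) hd.
  by rewrite ltr_norml /d => /andP[+ _]; lra.
have izh := cintegrable_mellin szh.
have -> : cint (Rpos R) (fun t => cpow t (z + h - 1) * rho t) -
    cint (Rpos R) (fun t => cpow t (z - 1) * rho t) - l * h =
    cint (Rpos R) (fun t => (cpow t (z - 1) * rho t) *
       (cpow t h - 1 - h * (ln t)%:C)) :> R[i].
  rewrite -[LHS]/(_ + - _ + - (l * h)) -[- cint _ _]mulN1r -cintZ// -cintD//; last first.
    exact: cintegrableZ.
  rewrite [l * h]mulrC -mulNr -cintZ// -cintD//; last 2 first.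
  - by apply: cintegrableD => //; exact: cintegrableZ.
  - exact: cintegrableZ.
  apply: eq_cint => t _.
  have -> : cpow t (z + h - 1) = cpow t (z - 1) * cpow t h :> R[i].
    by rewrite -cpowD; congr cpow; ring.
  by move: (cpow t (z - 1)) (cpow t h) (rho t) ((ln t)%:C) => A B C D; ring.
have bnd t : 0 < t -> normc ((cpow t (z - 1) * rho t) *
     (cpow t h - 1 - h * (ln t)%:C) : R[i]) <=
     normc h ^+ 2 * ((8 / d ^+ 2 * M) * two_powers b t).
  move=> t0; rewrite normcM inorm//.
  pose u := normc h * `|ln t|.
  have Q : normc (cpow t h - 1 - h * (ln t)%:C : R[i]) <= 4 * u ^+ 2 * expR u.
    have -> : cpow t h - 1 - h * (ln t)%:C =
        (expR (complex.Re h * ln t) * cos (complex.Im h * ln t) - 1 - complex.Re h * ln t)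
        +i* (expR (complex.Re h * ln t) * sin (complex.Im h * ln t) - complex.Im h * ln t)
        :> R[i].
      apply: complex_eq; rewrite ?cReD ?cImD ?cReN ?cImN ?Re_cpow ?Im_cpow
        [h * _]mulrC ?cReM_real ?cImM_real /= ?subr0; ring.
    apply: cexp_quadratic; rewrite normrM ler_wpM2r//; first exact: normc_Re.
    exact: normc_Im.
  have ud : u <= d * `|ln t| by rewrite ler_wpM2r// ltW.
  have [_ h2] := dle _ (normr_ge0 (ln t)).
  have nh := normc_ge0 h.
  have Q2 : normc (cpow t h - 1 - h * (ln t)%:C : R[i]) <=
      normc h ^+ 2 * (8 / d ^+ 2) * expR ((d + d) * `|ln t|).
    apply: le_trans Q _; rewrite lnE [leRHS]mulrA.
    rewrite ler_pM ?expR_ge0 ?ler_expR// ?mulr_ge0 ?sqr_ge0//.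
    rewrite /u exprMn -[leRHS]mulrA mulrCA ler_wpM2l ?sqr_ge0//.
    by move: h2; lra.
  apply: le_trans (ler_wpM2l _ Q2) _; first by rewrite mulr_ge0 ?powR_ge0 ?normc_ge0.
  have := HM t t0; rewrite -/b => HMt.
  rewrite [leLHS](_ : _ = normc h ^+ 2 * (8 / d ^+ 2 *
     (t `^ (complex.Re z - 1) * normc (rho t : R[i]) *
       expR ((d + d) * `|ln t|)))); last by ring.
  rewrite ler_wpM2l ?sqr_ge0// -[leRHS]mulrA ler_wpM2l//.
  by rewrite divr_ge0// sqr_ge0.
have i2 := integrable_two_powers b0.
have i3 : lebesgue_measure.-integrable (Rpos R)
    (fun t => ((8 / d ^+ 2 * M) * two_powers b t)%:E) by exact: integrable_scalel.
apply: le_trans (@normc_cint_le _ _ _ (fun t => normc h ^+ 2 *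
    ((8 / d ^+ 2 * M) * two_powers b t)) _ _ _ _) _ => //.
- exact: integrable_scalel.
- apply: cmeasurableM => //; apply: cmeasurableD.
    apply: cmeasurableD; first exact: measurable_cpow.
    exact: cmeasurable_cst.
  rewrite [X in cmeasurable _ X](_ : _ = fun t => (- h) * (ln t)%:C).
    by apply: cmeasurableM => //; exact: cmeasurable_cst.
  by apply/funext => t; rewrite mulNr.
- by move=> t /=; rewrite in_itv /= andbT => /bnd.
by rewrite RintegralZl// /K2; rewrite le_eqVlt; apply/orP; left; apply/eqP; ring.
Qed.

End MellinTransform.

(** * Sums over a discrete spectrum *)

Section SpectralSums.
Context {R : realType} {I : choiceType}.
Variables (lam : I -> R) (l0 : R) (B : R -> R).
Hypothesis l0_gt0 : 0 < l0.
Hypothesis lam_ge : forall i, l0 <= lam i.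
Hypothesis heat_le : forall t, 0 < t -> forall J : {fset I},
  \sum_(i <- J) expR (- (t * lam i)) <= B t.

Lemma lam_gt0 i : 0 < lam i.
Proof. exact: lt_le_trans (lam_ge i). Qed.

(** Each eigenvalue at most L contributes at least exp(-L) to the heat trace at
    time 1, so their number is bounded. *)
Lemma finite_spectrum L : finite_set [set i | lam i <= L].
Proof.
apply: contrapT => /infinite_set_fset H.
pose n := (Num.truncn (expR L * B 1)).+1.
have [J JL nJ] := H n.
have := heat_le ltr01 J; apply/negP; rewrite -ltNge.
apply: (@lt_le_trans _ _ (\sum_(i <- J) expR (- L))); last first.
  rewrite big_seq [leRHS]big_seq; apply: ler_sum => i iJ.
  by rewrite ler_expR mul1r lerN2; apply: JL.
rewrite big_const_seq count_predT iter_addr_0 -mulr_natl.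
rewrite expRN ltr_pdivlMr ?expR_gt0// mulrC.
apply: (lt_le_trans (truncnS_gt _)).
by rewrite ler_nat; exact: nJ.
Qed.

(** fset_set is empty on infinite sets; finite_spectrum rules this case out. *)
Definition spectrum_upto L : {fset I} := fset_set [set i | lam i <= L].

Lemma in_spectrum_upto L i : (i \in spectrum_upto L) = (lam i <= L).
Proof.
by rewrite in_fset_set; [apply/idP/idP; rewrite inE|exact: finite_spectrum].
Qed.

Lemma spectrum_upto_cofinal (J : {fset I}) :
  \forall L \near +oo, (J `<=` spectrum_upto L)%fset.
Proof.
near=> L; apply/fsubsetP => i iJ; rewrite in_spectrum_upto.
apply: (@le_trans _ _ (\sum_(j <- J) lam j)).
  rewrite (big_fsetD1 i)//= lerDl sumr_ge0// => j _; exact/ltW/lam_gt0.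
by near: L; apply: nbhs_pinfty_ge; exact: num_real.
Unshelve. all: end_near. Qed.

Lemma cvg_spectrum_upto (u : I -> C R) (l : C R) :
  partial_sum u J @[J --> totally] --> l ->
  (\sum_(i <- spectrum_upto L) u i) @[L --> +oo] --> l.
Proof.
move=> /cvgCP H; apply/cvgCP => e e0.
have [J _ HJ] := H e e0.
apply: filterS (spectrum_upto_cofinal J) => L JL.
by have := HJ _ JL; rewrite /= partial_sumE.
Qed.

Lemma cvg_spectrum_upto_nat (u : I -> C R) (l : C R) :
  partial_sum u J @[J --> totally] --> l ->
  (\sum_(i <- spectrum_upto n%:R) u i) @[n --> \oo] --> l.
Proof.
move=> /cvg_spectrum_upto; apply: cvg_comp; exact: cvgr_idn.
Qed.

(** Unordered sums over the spectrum are exchanged with integrals through the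
    finite sets of eigenvalues at most n: they form a cofinal sequence, and
    dominated convergence applies to sequences only. *)
Lemma cint_heat_sum (a : I -> R[i]) (M : R) (theta w : R -> C R) (G : R -> R) :
  (forall i, normc (a i) <= M) ->
  (forall t, 0 < t ->
     partial_sum (fun i => a i * (expR (- (t * lam i)))%:C : C R) J
       @[J --> totally] --> theta t) ->
  cmeasurable (Rpos R) w ->
  lebesgue_measure.-integrable (Rpos R) (fun t => (G t)%:E) ->
  (forall t, 0 < t -> forall J : {fset I},
     normc (w t : R[i]) * \sum_(i <- J) expR (- (t * lam i)) <= G t) ->
  [/\ cmeasurable (Rpos R) theta,
   (forall i, cintegrable (Rpos R) (fun t => w t * (expR (- (t * lam i)))%:C)) &
   (\sum_(i <- spectrum_upto n%:R)
      a i * cint (Rpos R) (fun t => w t * (expR (- (t * lam i)))%:C) : C R)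
     @[n --> \oo] --> (cint (Rpos R) (fun t => w t * theta t) : C R)].
Proof.
move=> aM ath mw iG wG.
have me i := @cmeasurable_expR _ (Rpos R) (lam i).
pose S n t : C R := \sum_(i <- spectrum_upto n%:R) a i * (expR (- (t * lam i)))%:C.
have mS n : cmeasurable (Rpos R) (S n).
  by apply: cmeasurable_sum => i; apply: cmeasurableM => //; exact: cmeasurable_cst.
have Sth t : Rpos R t -> S n t @[n --> \oo] --> theta t.
  by rewrite /= in_itv /= andbT => t0; apply: cvg_spectrum_upto_nat; exact: ath.
have mth : cmeasurable (Rpos R) theta by exact: cmeasurable_cvg Sth.
have ie i : cintegrable (Rpos R) (fun t => w t * (expR (- (t * lam i)))%:C).
  apply: (cintegrable_le _ iG) => //; first exact: cmeasurableM.
  move=> t /=; rewrite in_itv /= andbT => t0.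
  have := wG t t0 [fset i]%fset; rewrite big_seq_fset1.
  by rewrite normcM normc_real ger0_norm ?expR_ge0.
split => //.
have E n : \sum_(i <- spectrum_upto n%:R)
      a i * cint (Rpos R) (fun t => w t * (expR (- (t * lam i)))%:C) =
    cint (Rpos R) (fun t => w t * S n t) :> R[i].
  rewrite (eq_bigr (fun i => cint (Rpos R)
     (fun t => a i * (w t * (expR (- (t * lam i)))%:C)))); last first.
    by move=> i _; rewrite cintZ.
  rewrite -cint_sum//; last by move=> i; exact: cintegrableZ.
  apply: eq_cint => t _; rewrite /S mulr_sumr; apply: eq_bigr => i _.
  exact: mulrCA.
rewrite [X in X @ _ --> _](_ : _ = fun n => cint (Rpos R) (fun t => w t * S n t) : C R);
  last exact/funext.
apply: (@cint_dominated R (Rpos R) (fun n t => w t * S n t)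
  (fun t => w t * theta t) (fun t => `|M| * G t)).
- exact: measurable_itv.
- by apply: integrable_scalel => //; exact: measurable_itv.
- by move=> n; exact: cmeasurableM.
- move=> n t /=; rewrite in_itv /= andbT => t0.
  rewrite normcM.
  have h : normc (S n t : R[i]) <= `|M| * \sum_(i <- spectrum_upto n%:R) expR (- (t * lam i)).
    rewrite mulr_sumr; apply: le_trans (normc_sum _ _ _) _.
    apply: ler_sum => i _; rewrite normcM normc_real (ger0_norm (expR_ge0 _)).
    by rewrite ler_wpM2r ?expR_ge0// (le_trans (aM i))// ler_norm.
  apply: le_trans (ler_wpM2l (normc_ge0 _) h) _.
  by rewrite mulrCA ler_wpM2l// wG.
- move=> t Rt; apply/cvgCP => e e0.
  have w1 : 0 < normc (w t : R[i]) + 1 by rewrite ltr_wpDl ?normc_ge0.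
  have /cvgCP/(_ (e / (normc (w t : R[i]) + 1))) := Sth t Rt.
  rewrite divr_gt0// => /(_ isT); apply: filterS => n.
  rewrite ler_pdivlMr//; apply: le_trans.
  have -> : w t * S n t - w t * theta t = w t * (S n t - theta t) :> R[i].
    by move: (w t) (S n t) (theta t) => A X Y; ring.
  by rewrite normcM mulrC ler_wpM2l ?normc_ge0// lerDl.
Qed.

(** Split exp(-e lam) into exp(-(1-eta) e lam) and exp(-eta e lam): the first
    factor is small above L, the second is summed by the heat trace at the
    smaller time eta e. *)
Lemma heat_tail_le (L e eta : R) (J : {fset I}) : 0 < e -> 0 < eta -> eta <= 1 ->
  (forall i, i \in J -> L <= lam i) ->
  \sum_(i <- J) expR (- (e * lam i)) <=
    expR (- ((1 - eta) * (e * L))) * B (eta * e).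
Proof.
move=> e0 eta0 eta1 JL.
apply: (@le_trans _ _ (\sum_(i <- J) expR (- ((1 - eta) * (e * L))) *
    expR (- ((eta * e) * lam i)))); last first.
  by rewrite -mulr_sumr ler_wpM2l ?expR_ge0// heat_le// mulr_gt0.
rewrite big_seq [leRHS]big_seq; apply: ler_sum => i iJ.
rewrite -expRD ler_expR -opprD lerN2.
have h : (1 - eta) * (e * L) <= (1 - eta) * (e * lam i).
  by rewrite ler_wpM2l ?subr_ge0// ler_wpM2l ?(ltW e0)// JL.
by lra.
Qed.

End SpectralSums.

(** * Hilbert spaces and orthonormal bases *)

Section HilbertBasics.
Context {R : realType} {H : hilbert R}.
Implicit Types (x y u v : H) (a : R[i]).

Lemma ipDl x y u : ip H (x + y) u = ip H x u + ip H y u.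
Proof. exact: linearDl. Qed.

Lemma ipZl a x u : ip H (a *: x) u = a * ip H x u.
Proof. exact: linearZl_LR. Qed.

Lemma ipNl x u : ip H (- x) u = - ip H x u.
Proof. exact: linearNl. Qed.

Lemma ipBl x y u : ip H (x - y) u = ip H x u - ip H y u.
Proof. by rewrite ipDl ipNl. Qed.

Lemma ip0l u : ip H 0 u = 0.
Proof. exact: linear0l. Qed.

Lemma ip_suml (I : Type) (r : seq I) (F : I -> H) u :
  ip H (\sum_(i <- r) F i) u = \sum_(i <- r) ip H (F i) u.
Proof. by apply: (big_morph (fun x => ip H x u)) => [x y|]; rewrite ?ipDl ?ip0l. Qed.

Lemma ip_sym x y : ip H x y = conjc (ip H y x).
Proof. by rewrite [LHS]hermC /= expr0 mul1r. Qed.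

Lemma ipDr x y u : ip H u (x + y) = ip H u x + ip H u y.
Proof. exact: linearD. Qed.

Lemma ipZr a x u : ip H u (a *: x) = conjc a * ip H u x.
Proof. exact: linearZ. Qed.

Lemma ip0r u : ip H u 0 = 0.
Proof. exact: linear0. Qed.

Lemma ip_sumr (I : Type) (r : seq I) (F : I -> H) u :
  ip H u (\sum_(i <- r) F i) = \sum_(i <- r) ip H u (F i).
Proof. by apply: (big_morph (ip H u)) => [x y|]; rewrite ?ipDr ?ip0r. Qed.

(** The norm of H as a real number; `|x| itself lies in R[i]. *)
Definition hnorm x : R := complex.Re `|x|.

Lemma normr_hnorm x : `|x| = (hnorm x)%:C.
Proof.
rewrite /hnorm; have := normr_ge0 x.
by move: (`|x|) => [a b]; rewrite lecE /= => /andP[/eqP ->].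
Qed.

Lemma hnorm_ge0 x : 0 <= hnorm x.
Proof. by rewrite -lecR -normr_hnorm; exact: normr_ge0. Qed.

Lemma hnormD x y : hnorm (x + y) <= hnorm x + hnorm y.
Proof. by rewrite -lecR rmorphD /= -!normr_hnorm ler_normD. Qed.

Lemma hnormN x : hnorm (- x) = hnorm x.
Proof. by rewrite /hnorm normrN. Qed.

Lemma hnormB x y : hnorm (x - y) = hnorm (y - x).
Proof. by rewrite -hnormN opprB. Qed.

Lemma hnormZ a x : hnorm (a *: x) = normc a * hnorm x.
Proof.
apply: (@complexI R); rewrite rmorphM /= -!normr_hnorm normrZ.
by rewrite normr_normc.
Qed.

Lemma hnorm0 : hnorm 0 = 0.
Proof. by rewrite /hnorm normr0. Qed.

Lemma hnorm_eq0 x : hnorm x <= 0 -> x = 0.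
Proof.
move=> x0; apply/eqP; rewrite -normr_eq0 normr_hnorm.
by rewrite (_ : hnorm x = 0)//; apply/eqP; rewrite eq_le x0 hnorm_ge0.
Qed.

Lemma hnorm_sum (I : Type) (r : seq I) (F : I -> H) :
  hnorm (\sum_(i <- r) F i) <= \sum_(i <- r) hnorm (F i).
Proof.
elim/big_rec2: _ => [|i y z _ le]; first by rewrite hnorm0.
by rewrite (le_trans (hnormD _ _))// lerD2l.
Qed.

Lemma ip_hnorm x : ip H x x = (hnorm x ^+ 2)%:C.
Proof. by rewrite -ip_norm normr_hnorm -rmorphXn. Qed.

Lemma hnorm_pythagoras x y : ip H x y = 0 ->
  hnorm (x + y) ^+ 2 = hnorm x ^+ 2 + hnorm y ^+ 2.
Proof.
move=> xy; apply: (@complexI R); rewrite rmorphD /= -!ip_hnorm.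
have yx : ip H y x = 0 by rewrite ip_sym xy; exact: conjc0.
by rewrite ipDl !ipDr xy yx addr0 add0r.
Qed.

Lemma cauchy_schwarz x y : normc (ip H x y) <= hnorm x * hnorm y.
Proof.
have [y0|y0] := eqVneq (hnorm y) 0.
  have /hnorm_eq0 -> : hnorm y <= 0 by rewrite y0.
  by rewrite ip0r normc0 hnorm0 mulr0.
have yp : 0 < hnorm y by rewrite lt_neqAle eq_sym y0 hnorm_ge0.
pose a : R[i] := ip H x y / (hnorm y ^+ 2)%:C.
have n0 : (hnorm y ^+ 2)%:C != 0 :> R[i].
  by rewrite (fmorph_eq0 (real_complex R)) expf_neq0.
have o : ip H (x - a *: y) (a *: y) = 0.
  by rewrite ipZr ipBl ipZl ip_hnorm /a divfK// subrr mulr0.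
have := hnorm_pythagoras o; rewrite subrK => E.
have : hnorm (a *: y) ^+ 2 <= hnorm x ^+ 2 by rewrite E lerDr sqr_ge0.
rewrite ler_sqr ?nnegrE ?hnorm_ge0// hnormZ /a normcM normcV normc_real.
rewrite ger0_norm ?sqr_ge0// -mulrA expr2 invfM mulfVK//.
by rewrite ler_pdivrMr.
Qed.

End HilbertBasics.

Section OrthonormalBases.
Context {R : realType} {H : hilbert R} {J : choiceType}.
Variable e : J -> H.
Hypothesis eb : orthonormal_basis e.
Implicit Types (x y u v : H) (A : {fset J}).

Lemma ip_basis i j : ip H (e i) (e j) = (i == j)%:R.
Proof. by case: eb. Qed.

Definition basis_proj A u := \sum_(i <- A) ip H u (e i) *: e i.

Lemma basis_projB A u v : basis_proj A (u - v) = basis_proj A u - basis_proj A v.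
Proof.
rewrite /basis_proj -sumrB; apply: eq_bigr => i _.
by rewrite ipBl scalerBl.
Qed.

Lemma ip_combination A (c : J -> R[i]) j :
  ip H (\sum_(i <- A) c i *: e i) (e j) = if j \in A then c j else 0.
Proof.
rewrite ip_suml; case: ifPn => jA.
  rewrite (big_fsetD1 j)//= ipZl ip_basis eqxx mulr1 big_seq big1 ?addr0// => i.
  by rewrite !inE => /andP[ij _]; rewrite ipZl ip_basis (negbTE ij) mulr0.
rewrite big_seq big1// => i iA; rewrite ipZl ip_basis.
by case: eqP => [E|_]; [rewrite -E iA in jA|rewrite mulr0].
Qed.

Lemma basis_proj_orth A u (c : J -> R[i]) :
  ip H (u - basis_proj A u) (\sum_(i <- A) c i *: e i) = 0.
Proof.
rewrite ip_sumr big_seq big1// => j jA.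
by rewrite ipZr ipBl ip_combination jA subrr mulr0.
Qed.

Lemma hnorm_basis_projB A u : hnorm (u - basis_proj A u) <= hnorm u.
Proof.
rewrite -ler_sqr ?nnegrE ?hnorm_ge0// -[in leRHS](subrK (basis_proj A u) u).
by rewrite (hnorm_pythagoras (basis_proj_orth _ _ _)) lerDl sqr_ge0.
Qed.

Lemma hnorm_basis_proj A u : hnorm (basis_proj A u) <= hnorm u.
Proof.
rewrite -ler_sqr ?nnegrE ?hnorm_ge0// -[in leRHS](subrK (basis_proj A u) u).
by rewrite (hnorm_pythagoras (basis_proj_orth _ _ _)) lerDr sqr_ge0.
Qed.

Lemma ip_basis_proj A u w :
  ip H (basis_proj A u) w = \sum_(i <- A) ip H u (e i) * ip H (e i) w.
Proof. by rewrite ip_suml; apply: eq_bigr => i _; rewrite ipZl. Qed.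

Lemma span_approx u (eps : R) : 0 < eps ->
  exists r : seq J, exists c : J -> R[i], hnorm (u - \sum_(i <- r) c i *: e i) < eps.
Proof.
move=> eps0; case: eb => _ cl.
have : closure [set x | exists (r : seq J) (c : J -> R[i]),
   x = \sum_(i <- r) c i *: e i] u by rewrite cl.
move=> /(_ (ball u eps%:C)) [].
  by apply: nbhsx_ballx; rewrite ltcR.
move=> _ [[r [c ->]]]; rewrite -ball_normE /= normr_hnorm ltcR.
by exists r, c.
Qed.

(** Combinations of the basis are dense, and the orthogonal projection onto the
    span of finitely many basis vectors is the best approximation in it. *)
Lemma basis_proj_cvg u (eps : R) : 0 < eps ->
  \forall A \near totally, hnorm (u - basis_proj A u) <= eps.
Proof.
move=> eps0; have [r [c rc]] := span_approx u eps0.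
exists [fset i in r]%fset => // A /fsubsetP rA.
apply: le_trans (ltW rc).
set v := \sum_(i <- r) c i *: e i.
have Pv : basis_proj A v = v.
  rewrite /basis_proj /v.
  transitivity (\sum_(i <- A) \sum_(k <- r) (c k * ip H (e k) (e i)) *: e i).
    apply: eq_bigr => i _; rewrite ip_suml scaler_suml.
    by apply: eq_bigr => k _; rewrite ipZl.
  rewrite exchange_big /= big_seq [RHS]big_seq; apply: eq_bigr => k kr.
  have kA : k \in A by apply: rA; rewrite !inE.
  rewrite (big_fsetD1 k)//= ip_basis eqxx mulr1 big_seq big1 ?addr0// => i.
  by rewrite !inE => /andP[ik _]; rewrite ip_basis eq_sym (negbTE ik) mulr0 scale0r.
have -> : u - basis_proj A u = (u - v) - basis_proj A (u - v).
  by rewrite basis_projB Pv opprB addrA subrK.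
exact: hnorm_basis_projB.
Qed.

Lemma orth_basis_eq0 u : (forall i, ip H u (e i) = 0) -> u = 0.
Proof.
move=> u0; apply: hnorm_eq0; apply/ler_addgt0Pr => eps eps0; rewrite add0r.
have [A] := filter_ex (basis_proj_cvg u eps0).
by rewrite /basis_proj big1 ?subr0// => i _; rewrite u0 scale0r.
Qed.

Lemma hnorm_basis i : hnorm (e i) = 1.
Proof.
have : (hnorm (e i) ^+ 2)%:C = 1%:C :> R[i] by rewrite -ip_hnorm ip_basis eqxx.
move=> /(@complexI R)/eqP; rewrite sqrf_eq1 => /orP[/eqP//|/eqP h].
by have := hnorm_ge0 (e i); rewrite h lerNr oppr0 ler10.
Qed.

End OrthonormalBases.

(** * Unordered sums and diagonal operators *)

Section AbsoluteSummability.
Context {I : choiceType}.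

Lemma big_fsetID_sub (V : zmodType) (A B : {fset I}) (u : I -> V) :
  (A `<=` B)%fset ->
  \sum_(i <- B) u i = \sum_(i <- A) u i + \sum_(i <- (B `\` A)%fset) u i.
Proof.
move=> AB; rewrite (big_fsetID _ (mem A))/=; congr (_ + _).
  apply: eq_fbigl => i; rewrite !inE /=; apply/andP/idP => [[]//|iA].
  by split => //; exact: (fsubsetP AB).
by apply: eq_fbigl => i; rewrite !inE /= andbC.
Qed.

(** Take for A0 a finite set whose sum is within eps of the supremum. *)
Lemma summable_tail (R : realType) (v : I -> R) (S : R) :
  (forall i, 0 <= v i) -> (forall A : {fset I}, \sum_(i <- A) v i <= S) ->
  forall eps : R, 0 < eps -> exists A0 : {fset I}, forall A : {fset I},
    (forall i, i \in A -> i \notin A0) -> \sum_(i <- A) v i <= eps.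
Proof.
move=> v0 vS eps eps0.
pose E := [set \sum_(i <- A) v i | A in [set: {fset I}]].
have hE : has_sup E.
  split; first by exists (\sum_(i <- fset0) v i), fset0.
  by exists S => _ [A _ <-].
have [_ [A0 _ <-] HA0] := sup_adherent eps0 hE.
exists A0 => A AA0.
have : \sum_(i <- (A0 `|` A)%fset) v i <= sup E.
  by apply: ub_le_sup; [case: hE|exists (A0 `|` A)%fset].
rewrite (big_fsetID_sub _ (fsubsetUl A0 A)).
have -> : ((A0 `|` A) `\` A0 = A)%fset.
  apply/fsetP => i; rewrite !inE; case: (boolP (i \in A0)) => //= iA0.
  by apply/esym/negP => /AA0; rewrite iA0.
by lra.
Qed.

Lemma is_cvg_partial_sum (K : numFieldType) (V : completeNormedModType K)
    (u : I -> V) :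
  (forall eps : K, 0 < eps -> exists A0 : {fset I}, forall A : {fset I},
    (forall i, i \in A -> i \notin A0) -> `|\sum_(i <- A) u i| <= eps) ->
  cvg (partial_sum u A @[A --> totally]).
Proof.
move=> H; apply: cauchy_cvg; apply: cauchy_exP => eps eps0.
have [A0 HA0] := H (eps / 2) (divr_gt0 eps0 (ltr0n _ 2)).
exists (\sum_(i <- A0) u i); exists A0 => // A /= A0A.
rewrite -ball_normE /= partial_sumE (big_fsetID_sub _ A0A) opprD addNKr normrN.
apply: le_lt_trans (HA0 _ _) _; first by move=> i; rewrite !inE => /andP[].
by rewrite ltr_pdivrMr ?ltr0n// ltr_pMr ?ltr1n.
Qed.

Lemma is_cvg_partial_sumC (R : realType) (u : I -> C R) (S : R) :
  (forall A : {fset I}, \sum_(i <- A) normc (u i : R[i]) <= S) ->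
  exists c : C R, partial_sum u A @[A --> totally] --> c.
Proof.
move=> uS.
have tail := summable_tail (fun i => normc_ge0 (u i : R[i])) uS.
have tailf (g : C R -> R) : (forall z, `|g z| <= normc (z : R[i])) ->
    cvg (partial_sum (fun i => g (u i) : R) A @[A --> totally]).
  move=> gle; apply: is_cvg_partial_sum => eps eps0.
  have [A0 HA0] := tail eps eps0; exists A0 => A AA0.
  apply: le_trans (HA0 _ AA0); apply: le_trans (ler_norm_sum _ _ _) _.
  exact: ler_sum.
have /cvg_ex[/= a ca] := tailf (@complex.Re R) (@normc_Re R).
have /cvg_ex[/= b cb] := tailf (@complex.Im R) (@normc_Im R).
exists (a +i* b); apply: cvg_complex => /=.
  apply: cvg_trans ca; apply: near_eq_cvg; near=> A.
  by rewrite !partial_sumE cRe_sum.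
apply: cvg_trans cb; apply: near_eq_cvg; near=> A.
by rewrite !partial_sumE cIm_sum.
Unshelve. all: end_near. Qed.

End AbsoluteSummability.

(** The operator sum_i mu_i <., phi_i> phi_i, for an absolutely summable family
    mu.  With mu_i = g(lam_i) it is the operator g(D): this is how the complex
    powers of D are constructed. *)
Section DiagonalOperator.
Context {R : realType} {H : hilbert R} {I : choiceType}.
Variables (phi : I -> H) (mu : I -> R[i]) (S : R).
Hypothesis phib : orthonormal_basis phi.
Hypothesis muS : forall A : {fset I}, \sum_(i <- A) normc (mu i) <= S.

Let summand x i : H := (mu i * ip H x (phi i)) *: phi i.

Let hnorm_summands x (A : {fset I}) :
  hnorm (\sum_(i <- A) summand x i) <= (\sum_(i <- A) normc (mu i)) * hnorm x.
Proof.
apply: le_trans (hnorm_sum _ _) _; rewrite mulr_suml; apply: ler_sum => i _.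
rewrite hnormZ (hnorm_basis phib) mulr1 normcM ler_wpM2l ?normc_ge0//.
by apply: le_trans (cauchy_schwarz _ _) _; rewrite (hnorm_basis phib) mulr1.
Qed.

Let tail (eps : R) : 0 < eps -> exists A0 : {fset I}, forall A : {fset I},
    (forall i, i \in A -> i \notin A0) -> \sum_(i <- A) normc (mu i) <= eps.
Proof. exact: summable_tail (fun i => normc_ge0 (mu i)) muS eps. Qed.

Let is_cvg_summands x : cvg (partial_sum (summand x) A @[A --> totally]).
Proof.
apply: is_cvg_partial_sum => e /posC_Re[e0 ->].
have d0 : 0 < complex.Re e / (hnorm x + 1).
  by rewrite divr_gt0// ltr_wpDl// hnorm_ge0.
have [A0 HA0] := tail d0; exists A0 => A AA0.
rewrite normr_hnorm lecR; apply: le_trans (hnorm_summands _ _) _.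
apply: le_trans (ler_wpM2r (hnorm_ge0 x) (HA0 _ AA0)) _.
rewrite mulrAC ler_pdivrMr ?ltr_wpDl ?hnorm_ge0//.
by rewrite ler_wpM2l ?(ltW e0)// lerDl.
Qed.

Definition diag_op x : H := lim (partial_sum (summand x) A @[A --> totally]).

Lemma diag_op_cvg x (d : R) : 0 < d ->
  \forall A \near totally,
    hnorm (diag_op x - \sum_(i <- (A : {fset I})) summand x i) <= d.
Proof.
move=> d0; have /cvgrPdist_le/(_ d%:C) := @is_cvg_summands x.
rewrite ltcR => /(_ d0); apply: filterS => A.
by rewrite partial_sumE normr_hnorm lecR.
Qed.

Lemma diag_op_tail (A0 : {fset I}) (eps : R) x :
  (forall A : {fset I}, (forall i, i \in A -> i \notin A0) ->
     \sum_(i <- A) normc (mu i) <= eps) ->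
  hnorm (diag_op x - \sum_(i <- A0) summand x i) <= eps * hnorm x.
Proof.
move=> tl; apply/ler_addgt0Pl => d d0.
have [A1 _ HA1] := diag_op_cvg x d0.
have := HA1 (A0 `|` A1)%fset (fsubsetUr _ _) => /=.
rewrite (big_fsetID_sub _ (fsubsetUl A0 A1)) => h.
set B := (_ `\` _)%fset in h.
have hB : hnorm (\sum_(i <- B) summand x i) <= eps * hnorm x.
  apply: le_trans (hnorm_summands _ _) _; rewrite ler_wpM2r ?hnorm_ge0//.
  by apply: tl => i; rewrite !inE => /andP[].
have -> : diag_op x - \sum_(i <- A0) summand x i =
    (diag_op x - (\sum_(i <- A0) summand x i + \sum_(i <- B) summand x i)) +
    \sum_(i <- B) summand x i by rewrite opprD addrA subrK.
by apply: le_trans (hnormD _ _) _; rewrite lerD.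
Qed.

Lemma diag_op_bounded : bounded_operator diag_op.
Proof.
split; last first.
  exists S => x; rewrite !normr_hnorm -rmorphM /= lecR.
  have := @diag_op_tail fset0 S x (fun A _ => muS A).
  by rewrite big_seq_fset0 subr0.
move=> a x y; apply/eqP; rewrite -subr_eq0; apply/eqP.
apply: hnorm_eq0; apply/ler_addgt0Pl => d d0; rewrite addr0.
pose d' := d / (normc a + 2).
have a2 : 0 < normc a + 2 by rewrite ltr_wpDl// normc_ge0.
have d'0 : 0 < d' by rewrite divr_gt0.
near (@totally I) => A.
have lin : \sum_(i <- A) summand (a *: x + y) i =
    a *: (\sum_(i <- A) summand x i) + \sum_(i <- A) summand y i.
  rewrite scaler_sumr -big_split /=; apply: eq_bigr => i _.
  by rewrite /summand ipDl ipZl mulrDr scalerDl scalerA mulrCA.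
have h1 : hnorm (diag_op (a *: x + y) - \sum_(i <- A) summand (a *: x + y) i) <= d'.
  by near: A; exact: diag_op_cvg.
have h2 : hnorm (diag_op x - \sum_(i <- A) summand x i) <= d'.
  by near: A; exact: diag_op_cvg.
have h3 : hnorm (diag_op y - \sum_(i <- A) summand y i) <= d'.
  by near: A; exact: diag_op_cvg.
have -> : diag_op (a *: x + y) - (a *: diag_op x + diag_op y) =
   (diag_op (a *: x + y) - \sum_(i <- A) summand (a *: x + y) i) -
   (a *: (diag_op x - \sum_(i <- A) summand x i) +
    (diag_op y - \sum_(i <- A) summand y i)).
  rewrite lin scalerBr -[RHS]addrA -opprD; congr (_ - _).
  by rewrite addrACA ![_ + (_ - _)]addrC !subrK.
apply: le_trans (hnormD _ _) _; rewrite hnormN.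
apply: le_trans (lerD h1 (le_trans (hnormD _ _) (lerD _ h3))) _.
  by rewrite hnormZ; apply: ler_wpM2l h2; exact: normc_ge0.
rewrite /d' (_ : _ + _ = d)//.
by field; rewrite gt_eqF.
Unshelve. all: end_near. Qed.

Lemma ip_diag_op x j : ip H (diag_op x) (phi j) = mu j * ip H x (phi j).
Proof.
apply/eqP; rewrite -subr_eq0; apply/eqP/normc_eq0/ler_addgt0Pl => d d0.
rewrite addr0; have [A1 _ HA1] := diag_op_cvg x d0.
have := HA1 (A1 `|` [fset j])%fset (fsubsetUl _ _) => /=.
set A := (A1 `|` _)%fset; move=> h.
have jA : j \in A by rewrite !inE eqxx orbT.
have -> : ip H (diag_op x) (phi j) - mu j * ip H x (phi j) =
    ip H (diag_op x - \sum_(i <- A) summand x i) (phi j).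
  by rewrite ipBl (ip_combination phib) jA.
apply: le_trans (cauchy_schwarz _ _) _.
by rewrite (hnorm_basis phib) mulr1.
Qed.

End DiagonalOperator.

(** * Functional calculus and traces of diagonal operators *)

Section BoundedOperators.
Context {R : realType} {H : hilbert R}.
Variable T : H -> H.
Hypothesis bT : bounded_operator T.

Lemma bounded_operatorD x y : T (x + y) = T x + T y.
Proof. by case: bT => lT _; have := lT 1 x y; rewrite !scale1r. Qed.

Lemma bounded_operator0 : T 0 = 0.
Proof.
by apply: (@addrI _ (T 0)); rewrite -bounded_operatorD !addr0.
Qed.

Lemma bounded_operatorZ a x : T (a *: x) = a *: T x.
Proof.
by case: bT => lT _; have := lT a x 0; rewrite bounded_operator0 !addr0.
Qed.

Lemma bounded_operatorB x y : T (x - y) = T x - T y.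
Proof. by rewrite bounded_operatorD -scaleN1r bounded_operatorZ scaleN1r. Qed.

Lemma bounded_operator_sum (I : Type) (r : seq I) (F : I -> H) :
  T (\sum_(i <- r) F i) = \sum_(i <- r) T (F i).
Proof.
by apply: (big_morph T) => [x y|]; rewrite ?bounded_operatorD ?bounded_operator0.
Qed.

Lemma bounded_operator_hnorm :
  exists2 M : R, 0 <= M & forall x, hnorm (T x) <= M * hnorm x.
Proof.
case: bT => _ [M HM]; exists `|M| => // x.
have := HM x; rewrite !normr_hnorm -rmorphM /= lecR => h.
by apply: le_trans h _; rewrite ler_wpM2r ?hnorm_ge0// ler_norm.
Qed.

End BoundedOperators.

Lemma bounded_operator_comp (R : realType) (H : hilbert R) (h T : H -> H) :
  bounded_operator h -> bounded_operator T -> bounded_operator (h \o T).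
Proof.
move=> bh bT; have [M M0 HM] := bounded_operator_hnorm bh.
have [N N0 HN] := bounded_operator_hnorm bT; split.
  by move=> a x y /=; case: bT => lT _; rewrite lT; case: bh => lh _; rewrite lh.
exists (M * N) => x; rewrite !normr_hnorm -rmorphM /= lecR.
by apply: le_trans (HM _) _; rewrite -mulrA ler_wpM2l.
Qed.

Lemma near_all_seq (T : Type) (F : set_system T) (FF : Filter F) (I : eqType)
    (r : seq I) (Q : I -> T -> Prop) :
  (forall i, \forall x \near F, Q i x) ->
  \forall x \near F, forall i, i \in r -> Q i x.
Proof.
move=> H; elim: r => [|i r IH]; first by apply: filterE.
apply: filterS2 (H i) IH => x Qi Qr j.
by rewrite inE => /predU1P[->//|]; exact: Qr.
Qed.

Section DiagonalTrace.
Context {R : realType} {H : hilbert R} {I : choiceType}.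
Variables (phi : I -> H) (mu : I -> R[i]) (S : R) (h : H -> H).
Hypothesis phib : orthonormal_basis phi.
Hypothesis muS : forall A : {fset I}, \sum_(i <- A) normc (mu i) <= S.
Hypothesis bh : bounded_operator h.

Let T := diag_op phi mu.

(** Every eigenvector of D has to be treated, not only the basis phi: as D is
    symmetric, an eigenvector for l is orthogonal to phi_i unless lam_i = l, so
    T and multiplication by g(l) give it the same coordinates. *)
Lemma diag_op_functional_calculus (D : linop H) (lam : I -> R) (g : R -> C R) :
  (forall x y, dom D x -> dom D y -> ip H (D x) y = ip H x (D y)) ->
  (forall i, dom D (phi i) /\ D (phi i) = (lam i)%:C *: phi i) ->
  (forall i, mu i = g (lam i)) -> functional_calculus D g T.
Proof.
move=> symD Dphi mug; split; first exact: diag_op_bounded muS.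
move=> l x dx Dx; apply/eqP; rewrite -subr_eq0; apply/eqP.
apply: (orth_basis_eq0 phib) => i.
rewrite ipBl ipZl (ip_diag_op phib muS) -mulrBl.
have [di Di] := Dphi i.
have [E|nE] := eqVneq (lam i) l; first by rewrite mug E subrr mul0r.
suff -> : ip H x (phi i) = 0 by rewrite mulr0.
have := symD x (phi i) dx di; rewrite Dx Di ipZl ipZr conjc_real => /eqP.
rewrite -subr_eq0 -mulrBl mulf_eq0 -rmorphB /= => /orP[|/eqP//].
by rewrite (fmorph_eq0 (real_complex R)) subr_eq0 eq_sym (negbTE nE).
Qed.

(** The diagonal of h T in an arbitrary basis e sums to its diagonal in phi.
    Truncating mu to a finite set A0 changes the sum over phi, and the sum over
    any finite part K of e, by at most the norm of h times the tail of mu.  For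
    mu supported in A0 the sum over K is
    sum_(i in A0) mu_i <P_K h phi_i, phi_i>, with P_K the projection onto the
    span of K, and P_K tends strongly to the identity. *)
Lemma diag_op_trace (c : C R) :
  partial_sum (fun i => mu i * ip H (h (phi i)) (phi i) : C R) A
    @[A --> totally] --> c ->
  is_trace (h \o T) c.
Proof.
move=> /cvgCP muc; split.
  by apply: bounded_operator_comp => //; exact: diag_op_bounded muS.
move=> J e eb; apply/cvgCP => eps eps0.
have [M M0 HM] := bounded_operator_hnorm bh.
have hphi i : hnorm (h (phi i)) <= M.
  by apply: le_trans (HM _) _; rewrite (hnorm_basis phib) mulr1.
have M1 : 0 < M + 1 by rewrite ltr_wpDl.
pose d := eps / 4 / (M + 1).
have d0 : 0 < d by rewrite !divr_gt0.
have Md : M * d <= eps / 4.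
  rewrite /d mulrA ler_pdivrMr// mulrC ler_wpM2l ?divr_ge0 ?(ltW eps0)//.
  by rewrite lerDl.
have [A0 HA0] := summable_tail (fun i => normc_ge0 (mu i)) muS d0.
pose P := basis_proj e.
pose c_ (A : {fset I}) : R[i] := \sum_(i <- A) mu i * ip H (h (phi i)) (phi i).
pose a_ (A : {fset I}) (K : {fset J}) : R[i] :=
  \sum_(i <- A) mu i * ip H (P K (h (phi i))) (phi i).
pose T_ (A : {fset I}) x : H := \sum_(i <- A) (mu i * ip H x (phi i)) *: phi i.
have a_E A K : a_ A K = \sum_(j <- K) ip H (h (T_ A (e j))) (e j).
  rewrite /a_ (eq_bigr (fun i => \sum_(j <- K)
    (mu i * ip H (h (phi i)) (e j) * ip H (e j) (phi i)))); last first.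
    move=> i _; rewrite ip_basis_proj mulr_sumr; apply: eq_bigr => j _.
    by rewrite mulrA.
  rewrite exchange_big /=; apply: eq_bigr => j _.
  rewrite /T_ (bounded_operator_sum bh) ip_suml; apply: eq_bigr => i _.
  by rewrite (bounded_operatorZ bh) ipZl mulrAC.
have split_le (v : I -> R[i]) (A : {fset I}) : (A0 `<=` A)%fset ->
    (forall i, normc (v i) <= M) ->
    normc (\sum_(i <- A) mu i * v i - \sum_(i <- A0) mu i * v i) <= eps / 4.
  move=> A0A vM; rewrite (big_fsetID_sub _ A0A) addrC addKr.
  apply: le_trans (normc_sum _ _ _) _.
  apply: (@le_trans _ _ (M * \sum_(i <- (A `\` A0)%fset) normc (mu i))).
    rewrite mulr_sumr; apply: ler_sum => i _.
    by rewrite normcM mulrC ler_wpM2r ?normc_ge0.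
  apply: le_trans (ler_wpM2l M0 (HA0 _ _)) Md.
  by move=> i; rewrite !inE => /andP[].
have cA0 : normc (c - c_ A0 : R[i]) <= eps / 4 + eps / 8.
  have e8 : 0 < eps / 8 by rewrite divr_gt0.
  have [A1 _ HA1] := muc _ e8.
  have := HA1 (A0 `|` A1)%fset (fsubsetUr _ _) => /=; rewrite partial_sumE => h1.
  have h2 := split_le (fun i => ip H (h (phi i)) (phi i)) _ (fsubsetUl A0 A1).
  have h3 : normc (c_ (A0 `|` A1)%fset - c_ A0) <= eps / 4.
    apply: h2 => i; apply: le_trans (cauchy_schwarz _ _) _.
    by rewrite (hnorm_basis phib) mulr1.
  have -> : (c - c_ A0 : R[i]) =
      (c_ (A0 `|` A1)%fset - c_ A0) - (c_ (A0 `|` A1)%fset - c).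
    by move: (c_ _) (c_ _) => x y; ring.
  apply: le_trans (normc_leB _ _) _; exact: lerD.
have SK (K : {fset J}) : normc (\sum_(j <- K) ip H (h (T (e j))) (e j) - a_ A0 K) <=
    eps / 4 + eps / 8.
  pose k : R := #|` K|%:R.
  have k1 : 0 < k + 1 by rewrite ltr_wpDl.
  pose d' := eps / 8 / ((M + 1) * (k + 1)).
  have d'0 : 0 < d' by rewrite !divr_gt0// mulr_gt0.
  have [A1 HA1] := summable_tail (fun i => normc_ge0 (mu i)) muS d'0.
  pose A := (A0 `|` A1)%fset.
  have tA (B : {fset I}) : (forall i, i \in B -> i \notin A) ->
      \sum_(i <- B) normc (mu i) <= d'.
    by move=> BA; apply: HA1 => i /BA; rewrite !inE negb_or => /andP[].
  have h1 : normc (\sum_(j <- K) ip H (h (T (e j))) (e j) - a_ A K) <= eps / 8.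
    rewrite a_E -sumrB; apply: le_trans (normc_sum _ _ _) _.
    apply: (@le_trans _ _ (\sum_(j <- K) M * d')).
      apply: ler_sum => j _; rewrite -ipBl -(bounded_operatorB bh).
      apply: le_trans (cauchy_schwarz _ _) _; rewrite (hnorm_basis eb) mulr1.
      apply: le_trans (HM _) _; rewrite ler_wpM2l//.
      have := diag_op_tail phib muS (e j) tA.
      by rewrite (hnorm_basis eb) mulr1.
    rewrite big_const_seq count_predT iter_addr_0 -[leLHS]mulr_natl -/k.
    have -> : k * (M * d') = (M * k) * (eps / 8) / ((M + 1) * (k + 1)).
      by rewrite /d'; field; rewrite !gt_eqF.
    rewrite ler_pdivrMr ?mulr_gt0// mulrC.
    rewrite ler_wpM2l ?divr_ge0 ?(ltW eps0)//.
    by rewrite ler_pM ?lerDl.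
  have h2 : normc (a_ A K - a_ A0 K) <= eps / 4.
    apply: split_le; first exact: fsubsetUl.
    move=> i; apply: le_trans (cauchy_schwarz _ _) _.
    by rewrite (hnorm_basis phib) mulr1 (le_trans (hnorm_basis_proj eb _ _)).
  have -> : \sum_(j <- K) ip H (h (T (e j))) (e j) - a_ A0 K =
     (a_ A K - a_ A0 K) + (\sum_(j <- K) ip H (h (T (e j))) (e j) - a_ A K).
    by rewrite [RHS]addrC addrA subrK.
  apply: le_trans (le_normcD _ _) _; exact: lerD.
pose d2 := eps / 8 / (`|S| + 1).
have S1 : 0 < `|S| + 1 by rewrite ltr_wpDl.
have d20 : 0 < d2 by rewrite !divr_gt0.
have nearK : \forall K \near totally, forall i, i \in enum_fset A0 ->
    hnorm (h (phi i) - P K (h (phi i))) <= d2.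
  by apply: near_all_seq => i; exact: basis_proj_cvg.
apply: filterS nearK => K HK.
rewrite -[X in normc (X - _)]/(partial_sum (fun j => ip H (h (T (e j))) (e j)) K).
rewrite partial_sumE.
have h3 : normc (a_ A0 K - c_ A0) <= eps / 8.
  rewrite -sumrB; apply: le_trans (normc_sum _ _ _) _.
  apply: (@le_trans _ _ (d2 * \sum_(i <- A0) normc (mu i))).
    rewrite mulr_sumr big_seq [leRHS]big_seq; apply: ler_sum => i iA0.
    rewrite -mulrBr -ipBl normcM mulrC ler_wpM2r ?normc_ge0//.
    apply: le_trans (cauchy_schwarz _ _) _; rewrite (hnorm_basis phib) mulr1.
    by rewrite hnormB HK.
  rewrite /d2 mulrAC ler_pdivrMr// ler_wpM2l ?divr_ge0 ?(ltW eps0)//.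
  by apply: le_trans (muS A0) _; apply: le_trans (ler_norm _) _; rewrite lerDl.
have := SK K; move: (\sum_(j <- K) _) => s hs.
have -> : (s - c : R[i]) = (s - a_ A0 K) + ((a_ A0 K - c_ A0) - (c - c_ A0)).
  by move: (a_ _ _) (c_ _) => x y; ring.
apply: le_trans (le_normcD _ _) _; apply: le_trans (lerD hs (normc_leB _ _)) _.
by lra.
Qed.

End DiagonalTrace.

(** * The function f and powers *)

Section CutoffProfile.
Context {R : realType}.
Variable f : R -> C R.
Hypothesis pcf : piecewise_continuous f.

Let measurable_finite (d : seq R) : measurable [set` d].
Proof.
apply: countable_measurable; last exact/finite_set_countable/finite_seq.
by move=> t; exact: measurable_set1.
Qed.

Let measurable_part (g : R -> R) :
  (forall x, {for x, continuous f} -> {for x, continuous g}) ->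
  measurable_fun setT g.
Proof.
move=> cg.
pose d n := sval (cid (pcf (- n%:R) n%:R)).
pose U n : set R := `]- n%:R, n%:R[ `\` [set` d n].
have oU n : open (U n).
  rewrite /U setDE; apply: openI; first exact: interval_open.
  apply: closed_openC.
  have := @accessible_finite_set_closed R; case=> + _; apply; last exact: finite_seq.
  by apply: hausdorff_accessible; exact: Rhausdorff.
have -> : [set: R] = \bigcup_n (U n `|` [set` d n]).
  apply/seteqP; split => // x _; exists (Num.truncn `|x|).+1 => //.
  have [xd|xd] := pselect ([set` d (Num.truncn `|x|).+1] x); [by right|left].
  split => //=; rewrite in_itv /= -ltr_norml; exact: truncnS_gt.
apply/measurable_fun_bigcup => n.
  by apply: measurableU => //; exact: open_measurable.
apply/measurable_funU => //; first exact: open_measurable.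
split.
  apply: open_continuous_measurable_fun => // x; rewrite inE => -[/=].
  rewrite in_itv /= => /andP[x1 x2] xd; apply: cg.
  have [] := svalP (cid (pcf (- n%:R) n%:R)) x; first by rewrite !ltW.
  by move=> H _ _; apply: H; apply/negP.
move=> _ Y mY; apply: countable_measurable; first by move=> t; exact: measurable_set1.
exact: sub_countable (subset_card_le (@subIsetl _ _ _))
  (finite_set_countable (finite_seq (d n))).
Qed.

(** Up to finitely many points, f is continuous on each open set ]-n, n[. *)
Lemma piecewise_continuous_measurable (A : set R) : cmeasurable A f.
Proof.
split; apply: measurable_funTS; apply: measurable_part => x cf.
  exact: cvg_Re.
exact: cvg_Im.
Qed.

(** One-sided limits bound f near every point; compactness does the rest. *)
Lemma piecewise_continuous_bounded (a b : R) :
  exists K : R, forall x, a <= x <= b -> normc (f x : R[i]) <= K.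
Proof.
have /compact_near_coveringP H := @segment_compact R a b.
have : \forall K \near +oo, `[a, b]%classic `<=` [set x | normc (f x : R[i]) <= K].
  apply: H => x; rewrite /= in_itv /= => xab.
  have [d Hd] := pcf a b.
  have [_ [l1 /cvgCP L1] [l2 /cvgCP L2]] := Hd x xab.
  have := L1 1 ltr01; have := L2 1 ltr01.
  rewrite !near_withinE => N2 N1.
  pose M := Num.max (normc (f x : R[i])) (Num.max (normc (l1 : R[i]) + 1) (normc (l2 : R[i]) + 1)).
  have NM : \forall y \near x, normc (f y : R[i]) <= M.
    apply: filterS2 N1 N2 => y h1 h2.
    have [yx|xy|->] := ltgtP y x.
    - rewrite /M !le_max; apply/orP; right; apply/orP; left.
      have := h1 yx; have := le_normcD (f y - l1) l1; rewrite subrK; lra.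
    - rewrite /M !le_max; apply/orP; right; apply/orP; right.
      have := h2 xy; have := le_normcD (f y - l2) l2; rewrite subrK; lra.
    - by rewrite /M le_max lexx.
  near=> y K => /=; apply: (@le_trans _ _ M); first by near: y.
  by near: K; apply: nbhs_pinfty_ge; exact: num_real.
move=> /filter_ex[K HK]; exists K => x xab; apply: HK.
by rewrite /= in_itv.
Unshelve. all: end_near. Qed.

Hypothesis rdf : rapidly_decreasing f.

(** The decay hypothesis only concerns large t; on the remaining segment f is
    bounded and t^(-N) is bounded below. *)
Lemma rapidly_decreasing_bound (N : R) : exists2 K : R, 0 <= K &
  forall t, 1 <= t -> normc (f t : R[i]) <= K * t `^ (- N).
Proof.
have [K [T [_ HT]]] := rdf N.
pose T1 := Num.max T 1.
have [K2 HK2] := piecewise_continuous_bounded 1 (T1 + 1).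
pose m := Num.min 1 ((T1 + 1) `^ (- N)).
have T10 : 1 <= T1 + 1 by rewrite lerDr le_max ler01 orbT.
have m0 : 0 < m by rewrite lt_min ltr01 powR_gt0// (lt_le_trans ltr01).
exists (`|K| + `|K2| / m); first by rewrite addr_ge0// divr_ge0// ltW.
move=> t t1; have t0 : 0 < t by rewrite (lt_le_trans ltr01).
have [tT|tT] := leP t (T1 + 1); last first.
  have := HT t; rewrite normr_normc lecR => h.
  apply: le_trans (h _) _.
    by apply: le_lt_trans tT; rewrite (@le_trans _ _ T1)// ?le_max ?lexx// lerDl.
  rewrite ler_wpM2r ?powR_ge0// (le_trans (ler_norm _))// lerDl.
  by rewrite divr_ge0// ltW.
apply: (@le_trans _ _ `|K2|).
  by rewrite (le_trans _ (ler_norm _))// HK2// t1.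
have mt : m <= t `^ (- N).
  rewrite /m ge_min; have [N0|N0] := leP 0 N.
    apply/orP; right; rewrite !powRN lef_pV2 ?posrE ?powR_gt0//; last first.
      by rewrite (lt_le_trans ltr01).
    by apply: ge0_ler_powR => //; rewrite nnegrE ltW// (lt_le_trans ltr01).
  by apply/orP; left; rewrite -[leLHS](powRr0 t) ler_powR// oppr_ge0 ltW.
apply: (@le_trans _ _ (`|K2| / m * m)); first by rewrite divfK// gt_eqF.
apply: ler_pM => //; first by rewrite divr_ge0// ltW.
  exact: ltW.
by rewrite lerDr.
Qed.

End CutoffProfile.

Section PowerDecay.
Context {R : realType}.

Lemma powRN_small (A g e : R) : 0 < g -> 0 < e ->
  \forall L \near +oo, A * L `^ (- g) <= e.
Proof.
move=> g0 e0; have A1 : 0 < `|A| + 1 by rewrite ltr_wpDl.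
pose L0 := ((`|A| + 1) / e) `^ g^-1.
have q0 : 0 < (`|A| + 1) / e by rewrite divr_gt0.
have L00 : 0 < L0 by rewrite powR_gt0.
near=> L.
have L0L : L0 <= L by near: L; apply: nbhs_pinfty_ge; exact: num_real.
have Lp : 0 < L by rewrite (lt_le_trans L00).
have h : (`|A| + 1) / e <= L `^ g.
  have -> : (`|A| + 1) / e = L0 `^ g.
    by rewrite /L0 -powRrM mulVf ?gt_eqF// powRr1// ltW.
  by apply: ge0_ler_powR => //; rewrite ?nnegrE ltW.
rewrite powRN ler_pdivrMr ?powR_gt0//.
move: h; rewrite ler_pdivrMr// => h.
by rewrite (le_trans (ler_norm _))// mulrC (le_trans _ h)// lerDl.
Unshelve. all: end_near. Qed.

(** On [d, 1] a power of t is bounded below by a positive constant, so it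
    dominates any bounded function there. *)
Lemma power_bound_unit (g : R -> R) (K a d C0 : R) : 0 < d ->
  (forall t, 0 < t -> t < d -> g t <= K * t `^ a) ->
  (forall t, d <= t -> t <= 1 -> g t <= C0) ->
  exists2 K', 0 <= K' & forall t, 0 < t -> t <= 1 -> g t <= K' * t `^ a.
Proof.
move=> d0 g0 g1; pose m := Num.min 1 (d `^ a).
have m0 : 0 < m by rewrite lt_min ltr01 powR_gt0.
exists (`|K| + `|C0| / m); first by rewrite addr_ge0// divr_ge0// ltW.
move=> t t0 t1; have [td|td] := ltP t d.
  apply: le_trans (g0 t t0 td) _; rewrite ler_wpM2r ?powR_ge0//.
  by rewrite (le_trans (ler_norm _))// lerDl divr_ge0// ltW.
have mt : m <= t `^ a.
  rewrite /m ge_min; have [a0|a0] := leP 0 a.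
    by apply/orP; right; apply: ge0_ler_powR => //; rewrite nnegrE ltW.
  apply/orP; left; rewrite -[leLHS](powRr0 t).
  by apply: ger_powR; rewrite ?t0// ltW.
apply: le_trans (g1 t td t1) _; apply: le_trans (ler_norm _) _.
apply: (@le_trans _ _ (`|C0| / m * m)); first by rewrite divfK// gt_eqF.
apply: ler_pM => //; first by rewrite divr_ge0// ltW.
  exact: ltW.
by rewrite lerDr.
Qed.

End PowerDecay.

(** * Bounds on the heat trace *)

Section ScalarMultiple.
Context {R : realType}.

Lemma cvgC_mull (T : Type) (F : set_system T) (FF : Filter F) (k : R[i])
    (f : T -> C R) (l : C R) :
  f x @[x --> F] --> l -> (k * f x : C R) @[x --> F] --> (k * l : C R).
Proof.
move=> /cvgCP fl; apply/cvgCP => e e0.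
have k1 : 0 < normc k + 1 by rewrite ltr_wpDl ?normc_ge0.
have := fl (e / (normc k + 1)); rewrite divr_gt0// => /(_ isT).
apply: filterS => x; rewrite ler_pdivlMr//; apply: le_trans.
have -> : k * f x - k * l = k * (f x - l) :> R[i].
  by move: (f x) l {fl} => A B; ring.
by rewrite normcM mulrC ler_wpM2l ?normc_ge0// lerDl.
Qed.

Lemma normc_cvg_le (T : Type) (F : set_system T) (FF : ProperFilter F)
    (f : T -> C R) (l : C R) (z : R[i]) (b : R) :
  f x @[x --> F] --> l -> (\forall x \near F, normc (f x - z : R[i]) <= b) ->
  normc (l - z : R[i]) <= b.
Proof.
move=> /cvgCP fl fb; apply/ler_addgt0Pl => e e0.
have [x [h1 h2]] := filter_ex (filterI (fl e e0) fb).
have -> : l - z = (f x - z) - (f x - l) :> R[i].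
  by rewrite opprB [RHS]addrC addrA subrK.
by apply: le_trans (normc_leB _ _) _; rewrite addrC lerD.
Qed.

Lemma powR_segment_le (b d t : R) : 0 < d -> d <= t -> t <= 1 ->
  t `^ b <= 1 + d `^ b.
Proof.
move=> d0 dt t1; have t0 : 0 < t by rewrite (lt_le_trans d0).
have [b0|/ltW b0] := leP 0 b.
  apply: (@le_trans _ _ 1); last by rewrite lerDl powR_ge0.
  by rewrite -[leRHS](powRr0 t); apply: ger_powR; rewrite ?t0.
apply: (@le_trans _ _ (d `^ b)); last by rewrite lerDr.
rewrite -[b]opprK ![_ `^ (- - b)]powRN lef_pV2 ?posrE ?powR_gt0//.
by apply: ge0_ler_powR => //; rewrite ?nnegrE ?oppr_ge0// ltW.
Qed.

End ScalarMultiple.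

Lemma Rpos_gt0 (R : realType) (t : R) : Rpos R t -> 0 < t.
Proof. by rewrite /= in_itv /= andbT. Qed.

Section HeatTrace.
Context {R : realType} {I : choiceType}.
Variables (lam : I -> R) (l0 : R) (a : I -> R[i]) (M K0 s0 : R) (theta : R -> C R).
Hypothesis l0_gt0 : 0 < l0.
Hypothesis lam_ge : forall i, l0 <= lam i.
Hypothesis aM : forall i, normc (a i) <= M.
Hypothesis M_ge0 : 0 <= M.
Hypothesis K0_ge0 : 0 <= K0.
Hypothesis heat0 : forall t, 0 < t -> t <= 1 -> forall J : {fset I},
  \sum_(i <- J) expR (- (t * lam i)) <= K0 * t `^ (- s0).
Hypothesis theta_sum : forall t, 0 < t ->
  partial_sum (fun i => a i * (expR (- (t * lam i)))%:C : C R) J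
    @[J --> totally] --> theta t.

(** Beyond t = 1 the least eigenvalue forces exponential decay. *)
Definition heat_bound t :=
  if t <= 1 then K0 * t `^ (- s0) else K0 * expR (- ((t - 1) * l0)).

Lemma heat_le t : 0 < t -> forall J : {fset I},
  \sum_(i <- J) expR (- (t * lam i)) <= heat_bound t.
Proof.
move=> t0 J; rewrite /heat_bound; case: ifPn => [t1|]; first exact: heat0.
rewrite -ltNge => t1.
have := heat0 ltr01 (lexx 1) J; rewrite powR1 mulr1 => h.
apply: (@le_trans _ _ ((\sum_(i <- J) expR (- (1 * lam i))) *
   expR (- ((t - 1) * l0)))); last by rewrite ler_wpM2r ?expR_ge0.
rewrite mulr_suml; apply: ler_sum => i _; rewrite -expRD ler_expR.
have : (t - 1) * l0 <= (t - 1) * lam i by rewrite ler_wpM2l// subr_ge0 ltW.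
by lra.
Qed.

Lemma theta_le t : 0 < t -> normc (theta t : R[i]) <= M * heat_bound t.
Proof.
move=> t0; rewrite -[theta t]subr0.
apply: (normc_cvg_le _ (theta_sum t0)); apply: nearW => J.
rewrite partial_sumE subr0; apply: le_trans (normc_sum _ _ _) _.
apply: (@le_trans _ _ (M * \sum_(i <- J) expR (- (t * lam i)))).
  rewrite mulr_sumr; apply: ler_sum => i _.
  by rewrite normcM normc_real ger0_norm ?expR_ge0// ler_wpM2r ?expR_ge0.
by rewrite ler_wpM2l// heat_le.
Qed.

Lemma heat_bound_decay (N : R) : exists2 K, 0 <= K &
  forall t, 1 <= t -> heat_bound t <= K * t `^ (- N).
Proof.
have [K K_ge0 HK] := @expRN_le_power R l0 (- N) l0_gt0.
exists (K0 * expR l0 * K + K0).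
  by rewrite addr_ge0// mulr_ge0// mulr_ge0// expR_ge0.
move=> t t1; rewrite /heat_bound; case: ifPn => [t1'|_].
  have -> : t = 1 by apply/le_anti; rewrite t1 t1'.
  by rewrite !powR1 !mulr1 lerDr !mulr_ge0// expR_ge0.
apply: (@le_trans _ _ (K0 * expR l0 * K * t `^ (- N))); last first.
  by rewrite ler_wpM2r ?powR_ge0// lerDl.
rewrite -!mulrA ler_wpM2l//.
have -> : - ((t - 1) * l0) = l0 + - (l0 * t) by ring.
by rewrite expRD ler_wpM2l ?expR_ge0// HK.
Qed.

Lemma heat_bound_two_powers (sigma : R) : exists2 K, 0 <= K &
  forall t, 0 < t ->
    t `^ (sigma - 1) * heat_bound t <= K * two_powers (sigma - s0) t.
Proof.
have [K K_ge0 HK] := heat_bound_decay (sigma + 1).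
exists (K0 + K); first exact: addr_ge0.
move=> t t0; rewrite /two_powers; case: ifPn => [t1|].
  rewrite /heat_bound t1 mulrCA -powRD; last by rewrite (gt_eqF t0) implybT.
  have -> : sigma - 1 + - s0 = sigma - s0 - 1 by ring.
  by rewrite ler_wpM2r ?powR_ge0// lerDl.
rewrite -ltNge => /ltW t1.
apply: le_trans (ler_wpM2l (powR_ge0 _ _) (HK t t1)) _.
rewrite mulrCA -powRD; last by rewrite (gt_eqF t0) implybT.
have -> : sigma - 1 + - (sigma + 1) = - 2 by ring.
by rewrite ler_wpM2r ?powR_ge0// lerDr.
Qed.

(** The integrand is positive, and at least exp(-2) on [1, 2] because
    sigma > 1. *)
Lemma normc_Gamma_gt0 (sigma : R) : 1 < sigma ->
  0 < normc (cGamma sigma%:C : R[i]).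
Proof.
move=> s1; have z0 : 0 < complex.Re (sigma%:C : R[i]) by rewrite /= (lt_trans ltr01).
have [ir _] := cintegrable_Gamma z0.
apply: lt_le_trans (normc_Re _); apply: lt_le_trans (ler_norm _).
pose g t := complex.Re (cpow t (sigma%:C - 1) * (expR (- t))%:C : R[i]) : R.
have gE t : 0 < t -> g t = t `^ (sigma - 1) * expR (- t).
  move=> t0; rewrite /g mulrC cReM_real.
  have -> : (sigma%:C - 1 : R[i]) = (sigma - 1)%:C.
    by apply: complex_eq; rewrite ?cReD ?cImD ?cReN ?cImN /= ?subr0.
  by rewrite cpow_real// mulrC.
change (0 < \int[lebesgue_measure]_(t in Rpos R) g t).
pose q (t : R) : R := if t \in `[1, 2] then expR (- 2) else 0.
have mq : measurable_fun (Rpos R) q.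
  have [mq _] := @cmeasurable_itv_if R `[1, 2] (Rpos R) (fun=> (expR (- 2))%:C)
     (fun=> 0) (measurable_itv _) (cmeasurable_cst _ _) (cmeasurable_cst _ _).
  by apply: eq_measurable_fun mq => t _; rewrite /q; case: ifP.
have qg t : Rpos R t -> `|q t| <= g t.
  rewrite /= in_itv /= andbT => t0; rewrite gE// /q in_itv /=.
  case: ifPn => [/andP[t1 t2]|_]; last first.
    by rewrite normr0 mulr_ge0 ?powR_ge0 ?expR_ge0.
  rewrite ger0_norm ?expR_ge0// -[leLHS]mul1r ler_pM ?expR_ge0//.
    by rewrite -[leLHS](powRr0 t) ler_powR// subr_ge0 ltW.
  by rewrite ler_expR lerN2.
have iq : lebesgue_measure.-integrable (Rpos R) (fun t => (q t)%:E).
  by apply: (integrable_le _ ir).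
apply: (@lt_le_trans _ _ (\int[lebesgue_measure]_(t in Rpos R) q t)); last first.
  apply: le_Rintegral => // t Rt; exact: le_trans (ler_norm _) (qg t Rt).
have -> : \int[lebesgue_measure]_(t in Rpos R) q t = expR (- 2).
  have := @cint_support R (Rpos R) `[1, 2]%classic (fun t => (q t)%:C).
  move=> /(_ _ _)/(congr1 (@complex.Re R)) /= ->.
  - rewrite (@eq_Rintegral _ _ _ _ _ (fun=> expR (- 2))); last first.
      by move=> t; rewrite inE /= /q => ->.
    rewrite Rintegral_cst//.
    have := @lebesgue_measure_itv R `[1, 2].
    rewrite /= lte_fin ltr1n /= -EFinB => -> /=.
    by rewrite (_ : 2 - 1 = 1 :> R) ?mulr1//; lra.
  - by move=> t _ /negP; rewrite /q => /negbTE ->.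
  - by move=> t /=; rewrite !in_itv /= => /andP[t1 _]; rewrite andbT (lt_le_trans ltr01).
exact: expR_gt0.
Qed.

(** The integral of the heat trace against t^(sigma-1) converges and bounds
    Gamma(sigma) sum lam^(-sigma); divide by Gamma(sigma). *)
Lemma zeta_summable (sigma : R) : 1 < sigma -> s0 < sigma ->
  exists S, forall J : {fset I}, \sum_(i <- J) lam i `^ (- sigma) <= S.
Proof.
move=> s1 ss; have z0 : 0 < complex.Re (sigma%:C : R[i]) by rewrite /= (lt_trans ltr01).
have [K K_ge0 HK] := heat_bound_two_powers sigma.
pose G t := K * two_powers (sigma - s0) t.
have iG : lebesgue_measure.-integrable (Rpos R) (fun t => (G t)%:E).
  by apply: integrable_scalel => //; apply: integrable_two_powers; rewrite subr_gt0.
exists ((2 * \int[lebesgue_measure]_(t in Rpos R) G t) / normc (cGamma sigma%:C : R[i])).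
move=> J; rewrite ler_pdivlMr ?normc_Gamma_gt0//.
pose w t : C R := cpow t (sigma%:C - 1).
have ie i : cintegrable (Rpos R) (fun t => w t * (expR (- (t * lam i)))%:C).
  apply: (cintegrable_le _ iG) => //.
    apply: cmeasurableM; first exact: measurable_cpow.
    exact: cmeasurable_expR.
  move=> t /Rpos_gt0 t0; rewrite /w normcM normc_cpow//.
  rewrite normc_real ger0_norm ?expR_ge0// cReD cReN /=.
  apply: le_trans (HK t t0); rewrite ler_wpM2l ?powR_ge0//.
  by have := heat_le t0 [fset i]%fset; rewrite big_seq_fset1.
have E : (cGamma sigma%:C * (\sum_(i <- J) lam i `^ (- sigma))%:C : R[i]) =
    cint (Rpos R) (fun t => \sum_(i <- J) w t * (expR (- (t * lam i)))%:C).
  rewrite cint_sum// rmorph_sum mulr_sumr; apply: eq_bigr => i _.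
  rewrite cint_Gamma_scale// ?(lt_le_trans l0_gt0)//; congr (_ * _).
  by rewrite -rmorphN /= cpow_real// (lt_le_trans l0_gt0).
have -> : (\sum_(i <- J) lam i `^ (- sigma)) * normc (cGamma sigma%:C : R[i]) =
    normc (cGamma sigma%:C * (\sum_(i <- J) lam i `^ (- sigma))%:C : R[i]).
  rewrite normcM normc_real ger0_norm ?sumr_ge0// => [|i _]; last exact: powR_ge0.
  exact: mulrC.
rewrite E; apply: normc_cint_le => //.
  apply: cmeasurable_sum => i; apply: cmeasurableM; first exact: measurable_cpow.
  exact: cmeasurable_expR.
move=> t /Rpos_gt0 t0; rewrite -mulr_sumr normcM /w normc_cpow//.
rewrite cReD cReN /=; apply: le_trans (HK t t0); rewrite ler_wpM2l ?powR_ge0//.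
apply: le_trans (heat_le t0 J); apply: le_trans (normc_sum _ _ _) _.
by apply: ler_sum => i _; rewrite normc_real ger0_norm ?expR_ge0.
Qed.

End HeatTrace.

(** * Meromorphic continuation of the zeta function *)

Lemma derivable_inv_sub (R : realType) (c : R[i]) (q : R) (z : C R) :
  z != q%:C -> derivable (fun w : C R => (c / (w - q%:C) : C R)) z 1.
Proof.
move=> zq; pose u : R[i] := z - q%:C.
have u0 : u != 0 by rewrite subr_eq0.
have nu : 0 < normc u.
  by rewrite lt_neqAle normc_ge0 andbT eq_sym; apply: contra u0 => /eqP/eq0_normc ->.
apply: (@derivableC_quadratic _ _ z (- c / u ^+ 2) (2 * normc c / normc u ^+ 3) (normc u / 2)).
  by rewrite divr_gt0.
move=> h hu.
have uh : normc u / 2 <= normc (u + h).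
  have := normc_leB (u + h) h; rewrite addrK; lra.
have nuh : 0 < normc (u + h) by rewrite (lt_le_trans _ uh)// divr_gt0.
have uh0 : u + h != 0 by apply: contraTneq nuh => ->; rewrite normc0 ltxx.
have -> : c / (z + h - q%:C) - c / (z - q%:C) - - c / u ^+ 2 * h =
    c * h ^+ 2 / (u ^+ 2 * (u + h)) :> R[i].
  have -> : z + h - q%:C = u + h :> R[i] by rewrite /u addrAC.
  by rewrite -/u; field; rewrite u0 uh0.
rewrite normcM normcV !normcM.
rewrite [leRHS](_ : _ = normc c * (normc h * normc h) * (2 / normc u ^+ 3)); last by ring.
rewrite ler_wpM2l ?mulr_ge0 ?normc_ge0//.
rewrite -[leRHS]invf_div lef_pV2 ?posrE ?mulr_gt0 ?invr_gt0 ?exprn_gt0//.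
rewrite exprSr expr2 -[leLHS]mulrA ler_wpM2l ?mulr_ge0 ?normc_ge0//.
Qed.

Lemma derivableC_sum (R : realType) (J : eqType) (r : seq J) (P : pred J)
    (F : J -> C R -> C R) (z : C R) :
  (forall j, P j -> derivable (F j) z 1) ->
  derivable (fun w => \sum_(j <- r | P j) F j w : C R) z 1.
Proof.
move=> dF; elim: r => [|j r IH].
  rewrite [X in derivable X](_ : _ = cst 0); first exact: derivable_cst.
  by apply/funext => w; rewrite big_nil.
have [Pj|nPj] := boolP (P j); last first.
  rewrite [X in derivable X](_ : _ = fun w => \sum_(j <- r | P j) F j w)//.
  by apply/funext => w; rewrite big_cons (negbTE nPj).
rewrite [X in derivable X](_ : _ = F j + (fun w => \sum_(j <- r | P j) F j w)).
  exact: (derivableD (dF j Pj) IH).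
by apply/funext => w; rewrite big_cons Pj.
Qed.

Section HeatExpansion.
Context {R : realType} {I : choiceType}.
Variables (lam : I -> R) (l0 : R) (a : I -> R[i]) (M K0 s0 : R) (theta : R -> C R).
Hypothesis l0_gt0 : 0 < l0.
Hypothesis lam_ge : forall i, l0 <= lam i.
Hypothesis aM : forall i, normc (a i) <= M.
Hypothesis M_ge0 : 0 <= M.
Hypothesis K0_ge0 : 0 <= K0.
Hypothesis heat0 : forall t, 0 < t -> t <= 1 -> forall J : {fset I},
  \sum_(i <- J) expR (- (t * lam i)) <= K0 * t `^ (- s0).
Hypothesis theta_sum : forall t, 0 < t ->
  partial_sum (fun i => a i * (expR (- (t * lam i)))%:C : C R) J
    @[J --> totally] --> theta t.
Variables (k : nat) (s : 'I_k.+1 -> R) (c : 'I_k.+1 -> C R) (s' K1 d : R).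
Hypothesis s_gt : forall i, s' < s i.
Hypothesis s_le : forall i, s i <= s0.
Hypothesis d_gt0 : 0 < d.
Hypothesis expansion : forall t, 0 < t -> t < d ->
  normc (theta t - \sum_i c i * (t `^ (- s i))%:C : R[i]) <= K1 * t `^ (- s').

Let B := heat_bound l0 K0 s0.
Let B_le := heat_le lam_ge heat0.
Let thetaB := theta_le lam_ge aM M_ge0 heat0 theta_sum.

Definition heat_principal (t : R) : C R := \sum_i c i * (t `^ (- s i))%:C.

Lemma heat_principal_le t : 0 < t ->
  normc (heat_principal t : R[i]) <= \sum_i normc (c i : R[i]) * t `^ (- s i).
Proof.
move=> t0; apply: le_trans (normc_sum _ _ _) _; apply: ler_sum => i _.
by rewrite normcM normc_real ger0_norm ?powR_ge0.
Qed.

Lemma remainder_unit : exists2 K, 0 <= K & forall t, 0 < t -> t <= 1 ->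
  normc (theta t - heat_principal t : R[i]) <= K * t `^ (- s').
Proof.
apply: (@power_bound_unit _ (fun t => normc (theta t - heat_principal t : R[i])) K1 _ d
  (M * (K0 * (1 + d `^ (- s0))) +
   \sum_i normc (c i : R[i]) * (1 + d `^ (- s i)))) => // t dt t1.
have t0 : 0 < t by rewrite (lt_le_trans d_gt0).
apply: le_trans (normc_leB _ _) _; apply: lerD.
  apply: le_trans (thetaB t0) _; rewrite ler_wpM2l// /heat_bound t1 ler_wpM2l//.
  exact: powR_segment_le.
apply: le_trans (heat_principal_le t0) _; apply: ler_sum => i _.
by rewrite ler_wpM2l ?normc_ge0// powR_segment_le.
Qed.

(** For large t there is no cancellation: the bound comes from
    - s i < - s' <= |s'|. *)
Lemma remainder_infty : exists2 K, 0 <= K & forall t, 1 <= t ->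
  normc (theta t - heat_principal t : R[i]) <= K * t `^ `|s'|.
Proof.
have [K K_ge0 HK] := heat_bound_decay s0 l0_gt0 K0_ge0 (- `|s'|).
exists (M * K + \sum_i normc (c i : R[i])).
  by rewrite addr_ge0 ?mulr_ge0// sumr_ge0// => i _; exact: normc_ge0.
move=> t t1; have t0 : 0 < t by rewrite (lt_le_trans ltr01).
apply: le_trans (normc_leB _ _) _; rewrite mulrDl; apply: lerD.
  apply: le_trans (thetaB t0) _; rewrite -mulrA ler_wpM2l//.
  by rewrite -[X in _ `^ X]opprK HK.
apply: le_trans (heat_principal_le t0) _; rewrite mulr_suml; apply: ler_sum => i _.
rewrite ler_wpM2l ?normc_ge0// ler_powR//.
by have := s_gt i; have := ler_norm (- s'); rewrite normrN; lra.
Qed.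

(** The expansion is subtracted on ]0, 1] only: this removes the singularity
    at 0 and leaves the rapid decay at infinity untouched. *)
Definition heat_remainder (t : R) : C R :=
  theta t - (if t \in `]0, 1] then heat_principal t else 0).

Lemma cmeasurable_heat_principal A : cmeasurable A heat_principal.
Proof.
apply: cmeasurable_sum => i; apply: cmeasurableM; first exact: cmeasurable_cst.
by apply: cmeasurable_real; apply: measurable_funTS; exact: measurable_powR.
Qed.

Lemma cmeasurable_theta : cmeasurable (Rpos R) theta.
Proof.
have h0 (t : R) : 0 < t -> forall J : {fset I},
    normc (0 : C R) * \sum_(i <- J) expR (- (t * lam i)) <= 0.
  by move=> _ J; rewrite normcC0 mul0r.
by case: (cint_heat_sum l0_gt0 lam_ge B_le aM theta_sum
  (cmeasurable_cst _ 0) (integrable0 _ _) h0).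
Qed.

Lemma cmeasurable_heat_remainder : cmeasurable (Rpos R) heat_remainder.
Proof.
have mp := @cmeasurable_itv_if R `]0, 1] (Rpos R) heat_principal (fun=> 0)
  (measurable_itv _) (@cmeasurable_heat_principal _) (cmeasurable_cst _ _).
have := cmeasurableD cmeasurable_theta
  (cmeasurableM (@cmeasurable_cst _ (Rpos R) (-1)) mp).
rewrite [X in cmeasurable _ X -> _](_ : _ = heat_remainder)//.
by apply/funext => t; rewrite /heat_remainder mulN1r.
Qed.

Lemma heat_remainder_unit : exists K, forall t, 0 < t -> t <= 1 ->
  normc (heat_remainder t : R[i]) <= K * t `^ (- s').
Proof.
have [K _ HK] := remainder_unit; exists K => t t0 t1.
by rewrite /heat_remainder in_itv /= t0 t1 /=; exact: HK.
Qed.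

Lemma heat_remainder_infty (N : R) : exists K, forall t, 1 <= t ->
  normc (heat_remainder t : R[i]) <= K * t `^ (- N).
Proof.
have [K K_ge0 HK] := heat_bound_decay s0 l0_gt0 K0_ge0 N.
exists (M * K + normc (heat_remainder 1 : R[i])) => t t1.
have t0 : 0 < t by rewrite (lt_le_trans ltr01).
have [t1'|t1'] := leP t 1.
  have -> : t = 1 by apply/le_anti; rewrite t1 t1'.
  by rewrite powR1 mulr1 lerDr mulr_ge0.
rewrite /heat_remainder [t \in _]in_itv /= t0 (leNgt t) t1' /= subr0.
apply: le_trans (thetaB t0) _.
apply: (@le_trans _ _ (M * (K * t `^ (- N)))); first by rewrite ler_wpM2l// HK.
by rewrite mulrA ler_wpM2r ?powR_ge0// lerDl normc_ge0.
Qed.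

(** The continuation of Gamma(z) tr (h D^(-z)).  The Mellin transform of
    c_i t^(-s_i) over ]0, 1] is c_i / (z - s_i), which makes sense for all
    z <> s_i, and that of the remainder is holomorphic for Re z > s'. *)
Definition zeta_cont (z : C R) : C R :=
  (\sum_i c i / (z - (s i)%:C) : R[i]) +
  cint (Rpos R) (fun t => cpow t (z - 1) * heat_remainder t).

(** All poles in the half-plane are simple and explicit; the sum collects the
    indices whose exponent sits at p, none if p is a regular point. *)
Lemma zeta_cont_principal (p : C R) : s' < complex.Re p ->
  principal_part zeta_cont p 1 (fun=> \sum_(i | (s i)%:C == p) c i).
Proof.
move=> sp; have [K HK] := heat_remainder_unit.
exists (fun z => (\sum_(i | (s i)%:C != p) c i / (z - (s i)%:C) : R[i]) +
  cint (Rpos R) (fun t => cpow t (z - 1) * heat_remainder t)); split; last first.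
  apply: nearW => z; rewrite big_ord1 /= /zeta_cont.
  rewrite (bigID (fun i => (s i)%:C == p)) /= addrA; congr (_ + _ + _).
  by rewrite mulr_suml; apply: eq_bigr => i /eqP ->.
have ne (i : 'I_k.+1) : exists2 e : R, 0 < e & forall z : C R,
    normc (z - p : R[i]) < e -> (s i)%:C != p -> z != (s i)%:C.
  have [E|nE] := eqVneq ((s i)%:C) p; first by exists 1.
  exists (normc ((s i)%:C - p : R[i])).
    rewrite lt_neqAle normc_ge0 andbT eq_sym.
    by apply: contra nE => /eqP/eq0_normc/eqP; rewrite subr_eq0.
  by move=> z + _; apply: contraTneq => ->; rewrite ltxx.
pose e (i : 'I_k.+1) := s2val (cid2 (ne i)).
pose e0 := \big[Num.min/(complex.Re p - s')]_i e i.
have e00 : 0 < e0.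
  rewrite /e0; elim/big_ind: _ => [|x y x0 y0|i _]; first by rewrite subr_gt0.
    by rewrite lt_min x0.
  by rewrite /e; case: cid2.
apply: (nearC e00) => z zp.
have sz : s' < complex.Re z.
  have : e0 <= complex.Re p - s' by exact: bigmin_le_id.
  have := le_lt_trans (normc_Re _) zp; rewrite cReD cReN ltr_norml => /andP[+ _].
  lra.
apply: derivableD; last first.
  exact: derivable_mellin cmeasurable_heat_remainder HK heat_remainder_infty _ sz.
apply: derivableC_sum => i ip; apply: derivable_inv_sub.
have : normc (z - p : R[i]) < e i.
  by apply: lt_le_trans zp _; exact: bigmin_le_cond.
rewrite /e; case: cid2 => e1 _ H1 /= h; exact: H1.
Qed.

End HeatExpansion.

Section ZetaResidue.
Context {R : realType} {I : choiceType}.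
Variables (lam : I -> R) (l0 : R) (a : I -> R[i]) (M K0 s0 : R) (theta : R -> C R).
Hypothesis l0_gt0 : 0 < l0.
Hypothesis lam_ge : forall i, l0 <= lam i.
Hypothesis aM : forall i, normc (a i) <= M.
Hypothesis M_ge0 : 0 <= M.
Hypothesis K0_ge0 : 0 <= K0.
Hypothesis heat0 : forall t, 0 < t -> t <= 1 -> forall J : {fset I},
  \sum_(i <- J) expR (- (t * lam i)) <= K0 * t `^ (- s0).
Hypothesis theta_sum : forall t, 0 < t ->
  partial_sum (fun i => a i * (expR (- (t * lam i)))%:C : C R) J
    @[J --> totally] --> theta t.
Variables (k : nat) (s : 'I_k.+1 -> R) (c : 'I_k.+1 -> C R) (s' K1 d : R).
Hypothesis s_gt : forall i, s' < s i.
Hypothesis s_le : forall i, s i <= s0.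
Hypothesis d_gt0 : 0 < d.
Hypothesis expansion : forall t, 0 < t -> t < d ->
  normc (theta t - \sum_i c i * (t `^ (- s i))%:C : R[i]) <= K1 * t `^ (- s').

Let B := heat_bound l0 K0 s0.
Let B_le := heat_le lam_ge heat0.
Let rho := heat_remainder theta s c.

Let mrho : cmeasurable (Rpos R) rho.
Proof.
exact: (cmeasurable_heat_remainder l0_gt0 lam_ge aM heat0 theta_sum s c).
Qed.

(** Integrate the heat trace term by term. *)
Lemma cint_cpow_theta (z cc : R[i]) : 0 < complex.Re z -> s0 < complex.Re z ->
  partial_sum (fun i => cpow (lam i) (- z) * a i : C R) J @[J --> totally] -->
    (cc : C R) ->
  cint (Rpos R) (fun t => cpow t (z - 1) * theta t) = cGamma z * cc :> R[i].
Proof.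
move=> z0 sz cccv.
have [K K_ge0 HK] := heat_bound_two_powers s0 l0_gt0 K0_ge0 (complex.Re z).
have iG : lebesgue_measure.-integrable (Rpos R)
    (fun t => (K * two_powers (complex.Re z - s0) t)%:E).
  by apply: integrable_scalel => //; apply: integrable_two_powers; rewrite subr_gt0.
have wG (t : R) : 0 < t -> forall J : {fset I},
    normc (cpow t (z - 1) : R[i]) * \sum_(i <- J) expR (- (t * lam i)) <=
    K * two_powers (complex.Re z - s0) t.
  move=> t0 J; rewrite normc_cpow// cReD cReN /=.
  by apply: le_trans (HK t t0); rewrite ler_wpM2l ?powR_ge0//; exact: B_le.
have [_ _ L1] := cint_heat_sum l0_gt0 lam_ge B_le aM theta_sum
  (@measurable_cpow _ (Rpos R) (z - 1)) iG wG.
have L2 := cvgC_mull eventually_filter (k := cGamma z)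
  (cvg_spectrum_upto_nat l0_gt0 lam_ge B_le cccv).
suff L3 : (\sum_(i <- spectrum_upto lam n%:R) a i * cint (Rpos R)
    (fun t => cpow t (z - 1) * (expR (- (t * lam i)))%:C) : C R)
    @[n --> \oo] --> (cGamma z * cc : C R).
  exact: (cvg_unique (@norm_hausdorff _ (C R)) L1 L3).
move/cvgCP: L2 => L2; apply/cvgCP => e e0.
have := L2 e e0; apply: filterS => n.
suff -> : \sum_(i <- spectrum_upto lam n%:R) a i * cint (Rpos R)
    (fun t => cpow t (z - 1) * (expR (- (t * lam i)))%:C) = cGamma z *
    \sum_(i <- spectrum_upto lam n%:R) cpow (lam i) (- z) * a i :> R[i] by [].
rewrite mulr_sumr; apply: eq_bigr => i _.
rewrite cint_Gamma_scale// ?(lt_le_trans l0_gt0)//.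
by move: (cGamma z) (cpow _ _) (a i) => x y u; ring.
Qed.

(** For Re z > s0 the expansion subtracted from theta can be integrated
    separately, and its integral is the sum of simple fractions. *)
Lemma zeta_cont_eq (z cc : R[i]) : 0 < complex.Re z -> s0 < complex.Re z ->
  s' < complex.Re z ->
  partial_sum (fun i => cpow (lam i) (- z) * a i : C R) J @[J --> totally] -->
    (cc : C R) ->
  zeta_cont theta s c z = cGamma z * cc :> R[i].
Proof.
move=> z0 sz s'z /(cint_cpow_theta z0 sz) <-.
have [K HK] := heat_remainder_unit lam_ge aM M_ge0 K0_ge0 heat0 theta_sum d_gt0 expansion.
have Hy := heat_remainder_infty l0_gt0 lam_ge aM M_ge0 K0_ge0 heat0 theta_sum s c.
have irho := cintegrable_mellin mrho HK Hy s'z.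
pose w t : C R := cpow t (z - 1).
pose v (i : 'I_k.+1) (t : R) : C R :=
  if t \in `]0, 1] then cpow t (z - (s i)%:C - 1) else 0.
have mv i : cmeasurable (Rpos R) (v i).
  by apply: cmeasurable_itv_if => //; exact: measurable_cpow.
have szi (i : 'I_k.+1) : 0 < complex.Re (z - (s i)%:C).
  by rewrite cReD cReN subr_gt0 (le_lt_trans (s_le i)).
have iv i : cintegrable (Rpos R) (v i).
  apply: (@cintegrable_two_powers _ _ (complex.Re (z - (s i)%:C)) 1) => // t t0.
  rewrite mul1r /v in_itv /= t0 /= /two_powers; case: ifP => _.
    by rewrite normc_cpow// !cReD !cReN.
  by rewrite normcC0 powR_ge0.
have ev i : cint (Rpos R) (v i) = (z - (s i)%:C)^-1 :> R[i].
  rewrite -cint_cpow_unit//.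
  rewrite (@cint_support _ _ `]0, 1]%classic).
  - by apply: eq_cint => t /= t01; rewrite /v t01.
  - by move=> t _ /negP; rewrite /v => /negbTE ->.
  - by move=> t /=; rewrite !in_itv /= => /andP[->].
rewrite /zeta_cont addrC.
have -> : (\sum_i c i / (z - (s i)%:C) : R[i]) =
    cint (Rpos R) (fun t => \sum_i c i * v i t).
  rewrite cint_sum//; last by move=> i; apply: cintegrableZ.
  by apply: eq_bigr => i _; rewrite cintZ// ev.
rewrite -cintD//; last by apply: cintegrable_sum => // i; exact: cintegrableZ.
apply: eq_cint => t /Rpos_gt0 t0; rewrite /heat_remainder /v.
case: ifPn => _; last first.
  by rewrite big1 ?addr0 ?subr0// => i _; exact: mulr0.
have -> : (\sum_i c i * cpow t (z - (s i)%:C - 1) : R[i]) =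
    cpow t (z - 1) * heat_principal s c t.
  rewrite /heat_principal mulr_sumr; apply: eq_bigr => i _.
  have -> : cpow t (z - (s i)%:C - 1) = cpow t (z - 1) * (t `^ (- s i))%:C :> R[i].
    rewrite -cpow_real// -cpowD; congr cpow.
    by rewrite rmorphN /=; ring.
  by move: (cpow _ _) (c i) => x y; ring.
by move: (cpow _ _) (heat_principal _ _ _) (theta t) => x y u; ring.
Qed.

End ZetaResidue.

(** * The cutoff sum *)

Section CutoffSum.
Context {R : realType} {I : choiceType}.
Variables (lam : I -> R) (l0 : R) (a : I -> R[i]) (M K0 s0 : R) (theta : R -> C R).
Hypothesis l0_gt0 : 0 < l0.
Hypothesis lam_ge : forall i, l0 <= lam i.
Hypothesis aM : forall i, normc (a i) <= M.
Hypothesis M_ge0 : 0 <= M.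
Hypothesis K0_ge0 : 0 <= K0.
Hypothesis heat0 : forall t, 0 < t -> t <= 1 -> forall J : {fset I},
  \sum_(i <- J) expR (- (t * lam i)) <= K0 * t `^ (- s0).
Hypothesis theta_sum : forall t, 0 < t ->
  partial_sum (fun i => a i * (expR (- (t * lam i)))%:C : C R) J
    @[J --> totally] --> theta t.
Variables (k : nat) (s : 'I_k.+1 -> R) (c : 'I_k.+1 -> C R) (s' K1 d : R).
Hypothesis s_gt : forall i, s' < s i.
Hypothesis s_le : forall i, s i <= s0.
Hypothesis d_gt0 : 0 < d.
Hypothesis expansion : forall t, 0 < t -> t < d ->
  normc (theta t - \sum_i c i * (t `^ (- s i))%:C : R[i]) <= K1 * t `^ (- s').
Variable f : R -> C R.
Hypothesis mf : cmeasurable (Rpos R) f.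
Hypothesis f0 : forall t, t < 1 -> f t = 0.
Hypothesis fN : forall N : R, exists2 K : R, 0 <= K &
  forall t, 1 <= t -> normc (f t : R[i]) <= K * t `^ (- N).
Hypothesis fmoment : forall i : 'I_k.+1,
  cint (Rpos R) (fun t => (t `^ (- s i))%:C * f t) = (i == ord_max)%:R :> R[i].

Let B := heat_bound l0 K0 s0.
Let B_le := heat_le lam_ge heat0.
Let moment N : R := \int[lebesgue_measure]_(t in Rpos R) (normc (f t : R[i]) * t `^ N).

Let integrable_moment N : lebesgue_measure.-integrable (Rpos R)
  (fun t => (normc (f t : R[i]) * t `^ N)%:E).
Proof.
have [K K_ge0 HK] := fN (N + 2).
have mg : cmeasurable (Rpos R) (fun t => f t * (t `^ N)%:C).
  apply: cmeasurableM => //; apply: cmeasurable_real; apply: measurable_funTS.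
  exact: measurable_powR.
have mn : measurable_fun (Rpos R) (fun t => normc (f t : R[i]) * t `^ N).
  apply: measurable_funM; last by apply: measurable_funTS; exact: measurable_powR.
  rewrite (_ : (fun t => normc (f t : R[i])) = fun t =>
     Num.sqrt (complex.Re (f t) ^+ 2 + complex.Im (f t) ^+ 2)); last first.
    by apply/funext => t; case: (f t).
  apply: measurableT_comp.
    by apply: continuous_measurable_fun; exact: sqrt_continuous.
  by apply: measurable_funD; apply: measurable_funX; [case: mf|case: mf].
apply: (@integrable_le _ _ _ (fun t => K * two_powers 1 t)) => //.
  by apply: integrable_scalel => //; exact: integrable_two_powers.
move=> t /Rpos_gt0 t0; rewrite ger0_norm ?mulr_ge0 ?normc_ge0 ?powR_ge0//.
have [t1|t1] := ltP t 1.
  by rewrite f0// normcC0 mul0r mulr_ge0// two_powers_ge0.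
apply: (@le_trans _ _ (K * t `^ (- (N + 2)) * t `^ N)).
  by rewrite ler_wpM2r ?powR_ge0// HK.
rewrite -mulrA -powRD; last by rewrite (gt_eqF t0) implybT.
rewrite (_ : - (N + 2) + N = - 2); last by ring.
rewrite ler_wpM2l// /two_powers; case: ifPn => [t1'|//].
have -> : t = 1 by apply/le_anti; rewrite t1 t1'.
by rewrite !powR1.
Qed.

Let moment_ge0 N : 0 <= moment N.
Proof. by apply: Rintegral_ge0 => t _; rewrite mulr_ge0 ?normc_ge0 ?powR_ge0. Qed.

(** Inserting the expansion of theta at e t, the term c_i (e t)^(-s_i)
    integrates to c_i e^(-s_i) times the moment of f of exponent -s_i, so only
    the last coefficient survives.  The power |s'| comes from e t > 1, where
    the expansion says nothing. *)
Lemma heat_integral_expansion : exists2 A : R, 0 <= A & forall e, 0 < e ->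
  normc (cint (Rpos R) (fun t => f t * theta (e * t)) -
         c ord_max * (e `^ (- s ord_max))%:C : R[i]) <=
    A * (e `^ (- s') + e `^ `|s'|).
Proof.
have [Ka Ka0 HKa] := remainder_unit lam_ge aM M_ge0 K0_ge0 heat0 theta_sum d_gt0 expansion.
have [Kb Kb0 HKb] := remainder_infty l0_gt0 lam_ge aM M_ge0 K0_ge0 heat0 theta_sum c s_gt.
exists (2 * (Ka * moment (- s') + Kb * moment `|s'|)).
  by rewrite mulr_ge0// addr_ge0// mulr_ge0.
move=> e e0.
pose r t : C R := theta t - heat_principal s c t.
have mth : cmeasurable (Rpos R) (fun t => theta (e * t)).
  have [mr mi] := cmeasurable_theta l0_gt0 lam_ge aM heat0 theta_sum.
  have me : measurable_fun (Rpos R) (fun t => e * t) by exact: mulrl_measurable.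
  have sub : [set e * t | t in Rpos R] `<=` Rpos R.
    by move=> _ [t /Rpos_gt0 t0 <-]; rewrite /= in_itv /= andbT mulr_gt0.
  by split; [apply: (measurable_comp _ sub mr me)|apply: (measurable_comp _ sub mi me)].
have mpol : cmeasurable (Rpos R) (fun t => heat_principal s c (e * t)).
  apply: cmeasurable_sum => i; apply: cmeasurableM; first exact: cmeasurable_cst.
  apply: cmeasurable_real.
  apply: (@measurableT_comp _ _ _ _ _ _ (fun x : R => x `^ (- s i)) _
    (fun t => e * t)); first exact: measurable_powR.
  exact: mulrl_measurable.
have mr : cmeasurable (Rpos R) (fun t => f t * r (e * t)).
  apply: cmeasurableM => //.
  have := cmeasurableD mth (cmeasurableM (@cmeasurable_cst _ (Rpos R) (-1)) mpol).
  rewrite [X in cmeasurable _ X -> _](_ : _ = fun t => r (e * t))//.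
  by apply/funext => t; rewrite /r mulN1r.
pose G t : R := Ka * e `^ (- s') * (normc (f t : R[i]) * t `^ (- s')) +
  Kb * e `^ `|s'| * (normc (f t : R[i]) * t `^ `|s'|).
have iG1 : lebesgue_measure.-integrable (Rpos R)
    (fun t => (Ka * e `^ (- s') * (normc (f t : R[i]) * t `^ (- s')))%:E).
  by apply: integrable_scalel => //; exact: integrable_moment.
have iG2 : lebesgue_measure.-integrable (Rpos R)
    (fun t => (Kb * e `^ `|s'| * (normc (f t : R[i]) * t `^ `|s'|))%:E).
  by apply: integrable_scalel => //; exact: integrable_moment.
have iG : lebesgue_measure.-integrable (Rpos R) (fun t => (G t)%:E).
  rewrite [X in integrable _ _ X](_ : _ = (fun t =>
      (Ka * e `^ (- s') * (normc (f t : R[i]) * t `^ (- s')))%:E) \+ (fun t =>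
      (Kb * e `^ `|s'| * (normc (f t : R[i]) * t `^ `|s'|))%:E))%E//.
  exact: integrableD.
have rG t : Rpos R t -> normc (f t * r (e * t) : R[i]) <= G t.
  move=> /Rpos_gt0 t0; have et0 : 0 < e * t by rewrite mulr_gt0.
  rewrite normcM /G.
  have -> : Ka * e `^ (- s') * (normc (f t : R[i]) * t `^ (- s')) +
    Kb * e `^ `|s'| * (normc (f t : R[i]) * t `^ `|s'|) =
    normc (f t : R[i]) * (Ka * (e * t) `^ (- s') + Kb * (e * t) `^ `|s'|).
    by rewrite !powRM ?(ltW e0) ?(ltW t0)//; ring.
  rewrite ler_wpM2l ?normc_ge0//; have [h|h] := leP (e * t) 1.
    by apply: le_trans (HKa _ et0 h) _; rewrite lerDl mulr_ge0// powR_ge0.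
  by apply: le_trans (HKb _ (ltW h)) _; rewrite lerDr mulr_ge0// powR_ge0.
have ir : cintegrable (Rpos R) (fun t => f t * r (e * t)).
  by apply: (cintegrable_le _ iG).
have ip (i : 'I_k.+1) : cintegrable (Rpos R) (fun t => (t `^ (- s i))%:C * f t).
  apply: (cintegrable_le _ (integrable_moment (- s i))) => //.
    apply: cmeasurableM => //; apply: cmeasurable_real; apply: measurable_funTS.
    exact: measurable_powR.
  by move=> t _; rewrite normcM normc_real ger0_norm ?powR_ge0// mulrC.
have -> : cint (Rpos R) (fun t => f t * theta (e * t)) -
    c ord_max * (e `^ (- s ord_max))%:C =
    cint (Rpos R) (fun t => f t * r (e * t)) :> R[i].
  have -> : c ord_max * (e `^ (- s ord_max))%:C = cint (Rpos R)
      (fun t => \sum_i (c i * (e `^ (- s i))%:C) * ((t `^ (- s i))%:C * f t)) :> R[i].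
    rewrite cint_sum//; last by move=> i; exact: cintegrableZ.
    rewrite (bigD1 ord_max)//= cintZ// fmoment eqxx mulr1 big1 ?addr0// => i im.
    by rewrite cintZ// fmoment (negbTE im) mulr0.
  have iS : cintegrable (Rpos R) (fun t =>
      \sum_i (c i * (e `^ (- s i))%:C) * ((t `^ (- s i))%:C * f t)).
    by apply: cintegrable_sum => // i; exact: cintegrableZ.
  apply/eqP; rewrite subr_eq; apply/eqP; rewrite -cintD//.
  apply: eq_cint => t /Rpos_gt0 t0.
  have -> : \sum_i (c i * (e `^ (- s i))%:C) * ((t `^ (- s i))%:C * f t) =
      f t * heat_principal s c (e * t) :> R[i].
    rewrite /heat_principal mulr_sumr; apply: eq_bigr => i _.
    rewrite powRM ?(ltW e0) ?(ltW t0)// rmorphM /=.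
    by move: (c i) (f t) => x y; ring.
  by rewrite /r; move: (f t) (theta _) (heat_principal _ _ _) => x y u; ring.
apply: le_trans (normc_cint_le _ iG mr rG) _ => //.
have -> : \int[lebesgue_measure]_(t in Rpos R) G t =
    Ka * e `^ (- s') * moment (- s') + Kb * e `^ `|s'| * moment `|s'|.
  by rewrite RintegralD// !RintegralZl//; exact: integrable_moment.
rewrite -[leRHS]mulrA ler_wpM2l//.
move: (moment_ge0 (- s')) (moment_ge0 `|s'|) (powR_ge0 e (- s'))
  (powR_ge0 e `|s'|) Ka0 Kb0.
move: (moment (- s')) (moment `|s'|) (e `^ (- s')) (e `^ `|s'|).
move=> m1 m2 x1 x2 m1_0 m2_0 p1 p2 {}Ka0 {}Kb0.
rewrite -subr_ge0 (_ : _ - _ = Ka * m1 * x2 + Kb * m2 * x1); last by ring.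
by rewrite addr_ge0// !mulr_ge0.
Qed.

Let lap x : C R := cint (Rpos R) (fun t => f t * (expR (- (t * x)))%:C).

(** The support of f in [1, +oo[ makes its Laplace transform decay like
    exp(-x). *)
Lemma laplace_decay x : 0 <= x -> normc (lap x : R[i]) <= 2 * moment 0 * expR (- x).
Proof.
move=> x0.
have iG : lebesgue_measure.-integrable (Rpos R)
    (fun t => (expR (- x) * (normc (f t : R[i]) * t `^ 0))%:E).
  by apply: integrable_scalel => //; exact: integrable_moment.
apply: le_trans (normc_cint_le _ iG _ _) _ => //.
- by apply: cmeasurableM => //; exact: cmeasurable_expR.
- move=> t _; rewrite normcM normc_real ger0_norm ?expR_ge0// powRr0 mulr1 mulrC.
  have [t1|t1] := ltP t 1; first by rewrite f0// normcC0 !mulr0.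
  by rewrite ler_wpM2r ?normc_ge0// ler_expR lerN2 ler_peMl.
rewrite RintegralZl//; last exact: integrable_moment.
by rewrite -/(moment 0) mulrCA mulrC.
Qed.

(** The integral of f(t) theta(e t) is the sum of a_i lap(lam_i e) over the whole
    spectrum; its part above L is bounded by a tail of the heat trace. *)
Lemma cutoff_error e eta L : 0 < e -> 0 < eta -> eta <= 1 ->
  normc (cint (Rpos R) (fun t => f t * theta (e * t)) -
         \sum_(i <- spectrum_upto lam L) a i * lap (lam i * e) : R[i]) <=
    M * (2 * moment 0) * (expR (- ((1 - eta) * (e * L))) * B (eta * e)).
Proof.
move=> e0 eta0 eta1.
pose lam' i := e * lam i.
have l0'_gt0 : 0 < e * l0 by rewrite mulr_gt0.
have lam'_ge i : e * l0 <= lam' i by rewrite ler_wpM2l// ltW.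
have heat' (t : R) : 0 < t -> forall J : {fset I},
    \sum_(i <- J) expR (- (t * lam' i)) <= B (e * t).
  move=> t0 J; rewrite (eq_bigr (fun i => expR (- ((e * t) * lam i)))).
    by apply: B_le; rewrite mulr_gt0.
  by move=> i _; rewrite /lam' mulrA [t * e]mulrC.
have theta' (t : R) : 0 < t ->
    partial_sum (fun i => a i * (expR (- (t * lam' i)))%:C : C R) J
      @[J --> totally] --> theta (e * t).
  move=> t0; have := theta_sum (mulr_gt0 e0 t0).
  rewrite (_ : (fun i => a i * (expR (- (t * lam' i)))%:C : C R) =
    (fun i => a i * (expR (- ((e * t) * lam i)))%:C : C R))//.
  by apply/funext => i; rewrite /lam' mulrA [t * e]mulrC.
pose G t : R := B e * (normc (f t : R[i]) * t `^ 0).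
have iG : lebesgue_measure.-integrable (Rpos R) (fun t => (G t)%:E).
  by apply: integrable_scalel => //; exact: integrable_moment.
have fG (t : R) : 0 < t -> forall J : {fset I},
    normc (f t : R[i]) * \sum_(i <- J) expR (- (t * lam' i)) <= G t.
  move=> t0 J; rewrite /G powRr0 mulr1 [leRHS]mulrC.
  have [t1|t1] := ltP t 1; first by rewrite f0// normcC0 !mul0r.
  rewrite ler_wpM2l ?normc_ge0//; apply: le_trans (B_le e0 J).
  apply: ler_sum => i _; rewrite ler_expR lerN2 /lam' ler_peMl//.
  by rewrite mulr_ge0 ?(ltW e0)// ltW// (lt_le_trans l0_gt0).
have [_ _ Lim] := cint_heat_sum l0'_gt0 lam'_ge heat' aM theta' mf iG fG.
have [v [vE v_le]] : exists v : I -> R[i],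
    (forall i, v i = lap (lam i * e)) /\
    forall i, normc (v i) <= 2 * moment 0 * expR (- (e * lam i)).
  exists (fun i => lap (lam i * e)); split=> // i; rewrite [e * _]mulrC.
  by apply: laplace_decay; rewrite mulr_ge0 ?(ltW e0)// ltW// (lt_le_trans l0_gt0).
have lapE (A : {fset I}) : \sum_(i <- A)
    a i * cint (Rpos R) (fun t => f t * (expR (- (t * lam' i)))%:C) =
    \sum_(i <- A) a i * v i :> R[i].
  by apply: eq_bigr => i _; rewrite vE /lam' [e * _]mulrC.
have -> : \sum_(i <- spectrum_upto lam L) a i * lap (lam i * e) =
    \sum_(i <- spectrum_upto lam L) a i * v i :> R[i].
  by apply: eq_bigr => i _; rewrite vE.
apply: (normc_cvg_le _ Lim).
have cof : \forall n \near \oo, (spectrum_upto lam L `<=` spectrum_upto lam' n%:R)%fset.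
  have := spectrum_upto_cofinal l0'_gt0 lam'_ge heat' (spectrum_upto lam L).
  exact: cvgr_idn.
apply: filterS cof => n sub.
rewrite lapE (big_fsetID_sub _ sub) addrAC subrr add0r.
apply: le_trans (normc_sum _ _ _) _.
set J := (_ `\` _)%fset.
apply: (@le_trans _ _ (M * (2 * moment 0) * \sum_(i <- J) expR (- (e * lam i)))).
  rewrite mulr_sumr; apply: ler_sum => i _.
  by rewrite normcM -mulrA; apply: ler_pM => //; exact: normc_ge0.
rewrite ler_wpM2l ?mulr_ge0//; apply: heat_tail_le => //.
move=> i; rewrite /J in_fsetD => /andP[+ _].
by rewrite (in_spectrum_upto B_le) -ltNge => /ltW.
Qed.

(** With eps L = m ln L, the tail above L is at most a constant times
    eps^(s_k) L^(-(1-eta) m) eps^(-s0), and eps^(s_k - s0) <= L^(s0 - s_k)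
    since eps >= 1/L.  So it tends to 0 as soon as (1 - eta) m > s0 - s_k,
    which holds for small eta because m > s0 - s_k. *)
Lemma cutoff_sum_cvg (m : R) : s0 - s ord_max < m ->
  ((cutoff_scale m L `^ s ord_max)%:C * (\sum_(i <- spectrum_upto lam L)
     a i * lap (lam i * cutoff_scale m L)) : C R) @[L --> +oo] --> c ord_max.
Proof.
have third (x : R) : x / 3 + x / 3 + x / 3 = x by lra.
move=> Dm; set sk := s ord_max; pose D := s0 - sk.
have D0 : 0 <= D by rewrite subr_ge0; exact: s_le.
have m0 : 0 < m by rewrite (le_lt_trans D0).
(* eta is chosen so that (1 - eta) m = D + beta lies midway between D and m. *)
pose beta := (m - D) / 2; have b0 : 0 < beta by rewrite divr_gt0// subr_gt0.
pose eta := beta / m.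
have eta0 : 0 < eta by rewrite divr_gt0.
have eta1 : eta <= 1 by rewrite ler_pdivrMr// /beta; lra.
have etam : (1 - eta) * m = D + beta.
  by rewrite /eta mulrBl divfK ?gt_eqF// /beta; lra.
have [A A0 HA] := heat_integral_expansion.
pose g1 := sk - s'; pose g2 := sk + `|s'|.
have g10 : 0 < g1 by rewrite subr_gt0; exact: s_gt.
have g20 : 0 < g2.
  by have := s_gt ord_max; have := ler_norm (- s'); rewrite normrN /g2 -/sk; lra.
pose A3 := M * (2 * moment 0) * (K0 * eta `^ (- s0)).
apply/cvgCP => e e0.
near=> L.
have L1 : 1 <= L by near: L; apply: nbhs_pinfty_ge; exact: num_real.
have L0 : 0 < L by rewrite (lt_le_trans ltr01).
pose eps := cutoff_scale m L.
have epsE : eps = m * ln L / L by rewrite /eps /cutoff_scale ln_powR mulrC.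
have mln : 1 <= m * ln L.
  have h : expR m^-1 <= L by near: L; apply: nbhs_pinfty_ge; exact: num_real.
  have h2 : m^-1 <= ln L by rewrite -[leLHS]expRK ler_ln ?posrE ?expR_gt0.
  by rewrite -[leLHS](mulfV (lt0r_neq0 m0)) ler_pM2l.
have eps0 : 0 < eps by rewrite epsE divr_gt0// (lt_le_trans ltr01).
have eps_half : eps <= 2 * m * L `^ (- 2^-1).
  have hL : ln L <= 2 * L `^ 2^-1.
    have := expR_ge1Dx (ln (L `^ 2^-1)).
    by rewrite lnK ?posrE ?powR_gt0// ln_powR; lra.
  have hp : L `^ (- 2^-1) * L = L `^ 2^-1.
    rewrite -{2}(powRr1 (ltW L0)) -powRD; last by rewrite (gt_eqF L0) implybT.
    by congr (_ `^ _); lra.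
  rewrite epsE ler_pdivrMr//.
  rewrite [leRHS](_ : _ = m * (2 * (L `^ (- 2^-1) * L))); last by ring.
  by rewrite hp ler_pM2l.
have eps1 : eps <= 1.
  apply: le_trans eps_half _; near: L.
  by apply: powRN_small.
(* As eps is O(L^(-1/2)), the errors of the leading term are powers of L. *)
have epspow g : 0 < g -> eps `^ g <= (2 * m) `^ g * L `^ (- (g / 2)).
  move=> g0; apply: (@le_trans _ _ ((2 * m * L `^ (- 2^-1)) `^ g)).
    apply: ge0_ler_powR => //; rewrite ?nnegrE ?(ltW g0) ?(ltW eps0)//.
    by rewrite !mulr_ge0 ?powR_ge0 ?(ltW m0).
  rewrite powRM ?mulr_ge0 ?powR_ge0 ?(ltW m0)// -powRrM.
  by rewrite mulNr [2^-1 * g]mulrC.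
have Leps : eps * L = m * ln L by rewrite epsE divfK// gt_eqF.
have tail_pow : eps `^ sk * (expR (- ((1 - eta) * (eps * L))) * B (eta * eps)) <=
    K0 * eta `^ (- s0) * L `^ (- beta).
  have etaeps : eta * eps <= 1 by rewrite -[leRHS]mulr1 ler_pM// ltW.
  rewrite Leps /B /heat_bound etaeps [(1 - eta) * _]mulrA etam.
  have -> : expR (- ((D + beta) * ln L)) = L `^ (- (D + beta)).
    by rewrite powR_expR// mulNr.
  rewrite powRM ?(ltW eta0) ?(ltW eps0)//.
  have -> : eps `^ sk * (L `^ (- (D + beta)) *
      (K0 * (eta `^ (- s0) * eps `^ (- s0)))) =
      K0 * eta `^ (- s0) * (L `^ (- (D + beta)) * (eps `^ sk * eps `^ (- s0))).
    by ring.
  rewrite ler_wpM2l ?mulr_ge0 ?powR_ge0//.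
  rewrite -powRD; last by rewrite (gt_eqF eps0) implybT.
  have -> : L `^ (- beta) = L `^ (- (D + beta)) * L `^ D.
    rewrite -powRD; last by rewrite (gt_eqF L0) implybT.
    by congr (_ `^ _); ring.
  rewrite ler_wpM2l ?powR_ge0//.
  have -> : sk - s0 = - D by rewrite /D opprB.
  have -> : L `^ D = (L^-1) `^ (- D).
    by rewrite -powR_inv1 ?(ltW L0)// -powRrM mulN1r opprK.
  rewrite !powRN lef_pV2 ?posrE ?powR_gt0 ?invr_gt0//.
  apply: ge0_ler_powR => //; rewrite ?nnegrE ?invr_ge0 ?(ltW L0) ?(ltW eps0)//.
  by rewrite epsE -[leLHS]mul1r ler_wpM2r// invr_ge0 ltW.
have n1 : A * (2 * m) `^ g1 * L `^ (- (g1 / 2)) <= e / 3.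
  by near: L; apply: powRN_small; rewrite divr_gt0.
have n2 : A * (2 * m) `^ g2 * L `^ (- (g2 / 2)) <= e / 3.
  by near: L; apply: powRN_small; rewrite divr_gt0.
have n3 : A3 * L `^ (- beta) <= e / 3.
  by near: L; apply: powRN_small; rewrite // divr_gt0.
rewrite -/eps.
have E1 := HA eps eps0; have E2 := @cutoff_error eps eta L eps0 eta0 eta1.
set S := \sum_(i <- _) _ in E2 *; set T := cint _ _ in E1 E2.
have -> : (eps `^ sk)%:C * S - c ord_max =
    (eps `^ sk)%:C * (T - c ord_max * (eps `^ (- sk))%:C) -
    (eps `^ sk)%:C * (T - S) :> R[i].
  have h : (eps `^ sk)%:C * (eps `^ (- sk))%:C = 1 :> R[i].
    rewrite -rmorphM /= -powRD; last by rewrite (gt_eqF eps0) implybT.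
    by rewrite subrr powRr0.
  have gen (x y S' T' c' : R[i]) : x * y = 1 ->
      x * S' - c' = x * (T' - c' * y) - x * (T' - S').
    by move=> xy; rewrite !mulrBr [x * (c' * y)]mulrCA xy mulr1; ring.
  exact: gen.
apply: le_trans (normc_leB _ _) _.
rewrite !normcM normc_real ger0_norm ?powR_ge0//.
have p0 := powR_ge0 eps sk.
have F1 : eps `^ sk * normc (T - c ord_max * (eps `^ (- sk))%:C : R[i]) <=
    e / 3 + e / 3.
  apply: le_trans (ler_wpM2l p0 E1) _.
  rewrite mulrCA mulrDr -!powRD; try by rewrite (gt_eqF eps0) implybT.
  rewrite mulrDr; apply: lerD.
    apply: le_trans n1; rewrite -mulrA ler_wpM2l//; exact: epspow.
  apply: le_trans n2; rewrite -mulrA ler_wpM2l//; exact: epspow.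
have F2 : eps `^ sk * normc (T - S : R[i]) <= e / 3.
  apply: le_trans (ler_wpM2l p0 E2) _; apply: le_trans n3.
  rewrite mulrCA /A3 -[leRHS]mulrA ler_wpM2l ?mulr_ge0//.
by apply: le_trans (lerD F1 F2) _; rewrite third.
Unshelve. all: end_near. Qed.

End CutoffSum.

(** * Spectral data of an elliptic operator *)

Section SpectralData.
Context {R : realType} {H : hilbert R} {I : choiceType}.
Variables (D : linop H) (phi : I -> H) (lam : I -> R).
Hypothesis phib : orthonormal_basis phi.
Hypothesis eig : forall i, dom D (phi i) /\ D (phi i) = (lam i)%:C *: phi i.

Lemma selfadjoint_symmetric : selfadjoint D ->
  forall x y, dom D x -> dom D y -> ip H (D x) y = ip H x (D y).
Proof.
by move=> [_ adj] x y Dx Dy; have [_ /(_ (conj Dy erefl))] := adj y (D y); apply.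
Qed.

(** The bounded inverse of D maps phi_i to phi_i / lam_i, so 1 / lam_i is
    bounded; positivity gives the sign of lam_i. *)
Lemma eigenvalues_bounded_below : positive D -> invertible D ->
  exists2 l0, 0 < l0 & forall i, l0 <= lam i.
Proof.
move=> pos [T [bT _ TD]]; have [N N0 HN] := bounded_operator_hnorm bT.
have N1 : 0 < N + 1 by rewrite ltr_wpDl.
exists (N + 1)^-1; rewrite ?invr_gt0// => i; have [Di Dphi] := eig i.
have lam_ge0 : 0 <= lam i.
  by have := pos _ Di; rewrite Dphi ipZl (ip_basis phib) eqxx mulr1 lecR.
have := HN (D (phi i)); have := TD _ Di; rewrite scale0r subr0 => ->.
rewrite (hnorm_basis phib) Dphi hnormZ (hnorm_basis phib) mulr1 normc_real.
rewrite ger0_norm// => le; rewrite -[_^-1]mul1r ler_pdivrMr//.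
by apply: le_trans le _; rewrite mulrC ler_wpM2l// lerDl.
Qed.

(** Whatever operator represents g(D), it multiplies phi_i by g(lam_i), and the
    trace may be computed in the basis phi. *)
Lemma is_trace_calculus_sum (h : H -> H) (g : R -> C R) (c : C R) :
  bounded_operator h -> is_trace_calculus h D g c ->
  partial_sum (fun i => ip H (h (phi i)) (phi i) * g (lam i) : C R) J
    @[J --> totally] --> c.
Proof.
move=> bh [T [[bT gT] [_ /(_ I phi phib)]]].
suff -> : (fun i => ip H ((h \o T) (phi i)) (phi i) : C R) =
  (fun i => ip H (h (phi i)) (phi i) * g (lam i)) by [].
apply/funext => i /=; have [Di Dphi] := eig i.
by rewrite (gT _ _ Di Dphi) (bounded_operatorZ bh) ipZl mulrC.
Qed.

(** The terms exp(-t lam_i) are positive, so every finite sum is at most the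
    trace, which is O(t^(-p0)) for the leading exponent p0.  The trace is
    nonincreasing in t, which takes care of the times far from 0. *)
Lemma heat_expansion_bound (p : nat -> R) (c : nat -> C R) (s0 : R) :
  heat_expansion D p c -> p 0%N <= s0 -> (forall i, 0 <= lam i) ->
  exists2 K0, 0 <= K0 & forall t, 0 < t -> t <= 1 -> forall J : {fset I},
    \sum_(i <- J) expR (- (t * lam i)) <= K0 * t `^ (- s0).
Proof.
move=> [pdec /(_ 1%N)[theta [tr [K [d /= d0 near0]]]]] ps0 lam_ge0.
have bid : bounded_operator (@id H).
  by split=> //; exists 1 => x; rewrite mul1r.
have sum t : 0 < t -> partial_sum (fun i => (expR (- (t * lam i)))%:C : C R) J
    @[J --> totally] --> theta t.
  move=> t0; have := is_trace_calculus_sum bid (tr t t0).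
  rewrite (_ : (fun i => _ * _) = (fun i => (expR (- (t * lam i)))%:C))//.
  by apply/funext => i /=; rewrite (ip_basis phib) eqxx mul1r.
have realsum t (J : {fset I}) :
    \sum_(i <- J) (expR (- (t * lam i)))%:C =
    (\sum_(i <- J) expR (- (t * lam i)))%:C :> R[i] by rewrite rmorph_sum.
have sum_ge0 t (J : {fset I}) : 0 <= \sum_(i <- J) expR (- (t * lam i)).
  by apply: sumr_ge0 => i _; exact: expR_ge0.
have le_theta t (J : {fset I}) : 0 < t ->
    \sum_(i <- J) expR (- (t * lam i)) <= normc (theta t : R[i]).
  move=> t0; apply/ler_addgt0Pr => e e0.
  have /cvgCP /(_ e e0)[A _ HA] := sum t t0.
  have /= := HA (A `|` J)%fset (fsubsetUl _ _).
  rewrite partial_sumE realsum => h.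
  apply: (@le_trans _ _ (\sum_(i <- (A `|` J)%fset) expR (- (t * lam i)))).
    rewrite (@big_fsetID_sub I R J (A `|` J)%fset) ?fsubsetUr// lerDl.
    by apply: sumr_ge0 => i _; exact: expR_ge0.
  rewrite -[leLHS]ger0_norm// -normc_real -[X in normc X](subrK (theta t)).
  by apply: le_trans (le_normcD _ _) _; rewrite addrC lerD2l.
have [K' K'0 HK'] : exists2 K', 0 <= K' & forall t, 0 < t -> t <= 1 ->
    normc (theta t : R[i]) <= K' * t `^ (- s0).
  apply: (@power_bound_unit R (fun t => normc (theta t : R[i]))
    (normc (c 0%N : R[i]) + `|K|) (- s0) (Num.min d 1)
    (normc (theta (Num.min d 1) : R[i]))).
  - by rewrite lt_min d0 ltr01.
  - move=> t t0; rewrite lt_min => /andP[td t1].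
    have := near0 t; rewrite /ball /= sub0r normrN gtr0_norm// => /(_ td t0).
    rewrite big_ord_recl big_ord0 addr0 normr_normc lecR => h.
    have pw q : q <= s0 -> t `^ (- q) <= t `^ (- s0).
      by move=> qs; apply: ger_powR; rewrite ?t0 ?(ltW t1)// lerN2.
    rewrite -[X in normc X](subrK (c 0%N * (t `^ (- p 0%N))%:C)) addrC mulrDl.
    apply: le_trans (le_normcD _ _) _; apply: lerD.
      rewrite normcM normc_real ger0_norm ?powR_ge0// ler_wpM2l ?normc_ge0//.
      exact: pw.
    apply: le_trans h _; apply: (@le_trans _ _ (`|K| * t `^ (- p 1%N))).
      by rewrite ler_wpM2r ?powR_ge0// ler_norm.
    rewrite ler_wpM2l// pw// (le_trans _ ps0)// ltW//; exact: pdec.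
  move=> t dt t1; have m0 : 0 < Num.min d 1 by rewrite lt_min d0 ltr01.
  have t0 : 0 < t by apply: lt_le_trans dt.
  rewrite -[theta t]subr0; apply: (normc_cvg_le _ (sum t t0)); apply: nearW => J.
  rewrite partial_sumE subr0 realsum normc_real ger0_norm//.
  apply: le_trans (le_theta _ J m0); apply: ler_sum => i _.
  by rewrite ler_expR lerN2 ler_wpM2r.
exists K' => // t t0 t1 J; exact: le_trans (le_theta t J t0) (HK' t t0 t1).
Qed.

End SpectralData.

(** * Residue and limit *)

Lemma spectrum_sumE (R : realType) (I : choiceType) (lam : I -> R) (B : R -> R)
    (u : I -> C R) (L : R) :
  (forall t, 0 < t -> forall J : {fset I},
     \sum_(i <- J) expR (- (t * lam i)) <= B t) -> (forall i, 0 <= lam i) ->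
  \sum_(i \in [set i | lam i \in `[0, L]]) u i =
  \sum_(i <- spectrum_upto lam L) u i :> C R.
Proof.
move=> heat lam_ge0.
rewrite (_ : [set i | _] = [set i | lam i <= L]); last first.
  by apply/seteqP; split=> i /=; rewrite in_itv /= lam_ge0.
rewrite fsbig_finite//; exact: (finite_spectrum heat).
Qed.

Theorem theorem3p1 (R : realType) (H : hilbert R) (k : nat)
    (s : 'I_k.+1 -> R) (f : R -> C R) (D : linop H) (h : H -> H) (m : R)
    (I : choiceType) (phi : I -> H) (lam : I -> R) :
  (forall i j : 'I_k.+1, (i < j)%N -> s j < s i) ->
  piecewise_continuous f ->
  (forall t, t < 1 -> f t = 0) ->
  rapidly_decreasing f ->
  (forall i : 'I_k.+1, (i < k)%N ->
     cint `[0, +oo[ (fun t => (t `^ (- s i))%:C * f t) = 0) ->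
  cint `[0, +oo[ (fun t => (t `^ (- s ord_max))%:C * f t) = 1 ->
  elliptic_class s D ->
  bounded_operator h ->
  (* For h = id this follows from elliptic_class s D.  For a general bounded h
     it does not, and neither the residue nor the limit need exist then. *)
  (exists (c : 'I_k.+1 -> C R) (s' : R),
     s' < s ord_max /\ heat_expansion_upto h D s c s') ->
  orthonormal_basis phi ->
  (forall i, dom D (phi i) /\ D (phi i) = (lam i)%:C *: phi i) ->
  s ord0 - s ord_max < m ->
  exists r : C R,
    zeta_residue h D (s ord_max)%:C r /\
    (fun L : R => (cutoff_scale m L `^ s ord_max)%:C *
       \sum_(i \in [set i | lam i \in `[0, L]])
         ip H (h (phi i)) (phi i) * laplace f (lam i * cutoff_scale m L) : C R)
      @ +oo --> r.
Proof.
move=> s_dec pcf f0 rdf mom0 mom1 [p [[[pos inv sa _ _] [cp hexp]] psub]] bh.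
move=> [c [s' [s's [theta [tr_theta [K1 [d /= d0 near0]]]]]]] phib eig Dm.
have s_le i : s i <= s ord0.
  have [->//|i0] := eqVneq i ord0; apply/ltW/s_dec; by rewrite lt0n.
have s_ge i : s ord_max <= s i.
  have [->//|im] := eqVneq i ord_max; apply/ltW/s_dec => /=.
  by rewrite ltn_neqAle leq_ord andbT.
have s_gt i : s' < s i by exact: lt_le_trans s's (s_ge i).
have p0 : p 0%N <= s ord0.
  have [sp|/ltW ps] := leP (s ord_max) (p 0%N); last exact: le_trans ps (s_ge _).
  have [|i _ <-] := psub (p 0%N); last exact: s_le.
  by split; [exists 0%N | rewrite /= in_itv /= sp].
have [l0 l0_gt0 lam_ge] := eigenvalues_bounded_below phib eig pos inv.
have lam_gt0 i : 0 < lam i by exact: lt_le_trans l0_gt0 (lam_ge i).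
have lam_ge0 i := ltW (lam_gt0 i).
have [K0 K0_ge0 heat0] := heat_expansion_bound phib eig hexp p0 lam_ge0.
pose a i : R[i] := ip H (h (phi i)) (phi i).
have [M M_ge0 hM] := bounded_operator_hnorm bh.
have aM i : normc (a i) <= M.
  apply: le_trans (cauchy_schwarz _ _) _.
  by rewrite (hnorm_basis phib) mulr1; have := hM (phi i); rewrite (hnorm_basis phib) mulr1.
have theta_sum t (t0 : 0 < t) := is_trace_calculus_sum phib eig bh (tr_theta t t0).
have expansion t : 0 < t -> t < d ->
    normc (theta t - \sum_i c i * (t `^ (- s i))%:C : R[i]) <= K1 * t `^ (- s').
  move=> t0 td; have := near0 t.
  rewrite /ball /= sub0r normrN gtr0_norm// => /(_ td t0).
  by rewrite normr_normc lecR.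
have heat := heat_le lam_ge heat0.
have sum_spec u L := spectrum_sumE (I := I) u L heat lam_ge0.
exists (c ord_max); split; last first.
  have mf := piecewise_continuous_measurable pcf (Rpos R).
  have cintE g : (forall t, t < 1 -> g t = 0) ->
      cint `[0, +oo[ g = cint (Rpos R) g.
    move=> g0; apply: cint_support => [t _ nt|t /=].
      apply: g0; rewrite ltNge; apply/negP => t1; apply: nt.
      by rewrite /= in_itv /= andbT (lt_le_trans ltr01).
    by rewrite !in_itv /= !andbT => /ltW.
  have fmoment i : cint (Rpos R) (fun t => (t `^ (- s i))%:C * f t) =
      (i == ord_max)%:R :> R[i].
    rewrite -cintE; last by move=> t t1; rewrite f0// mulr0.
    have [->//|im] := eqVneq i ord_max; apply: mom0.
    by rewrite ltn_neqAle leq_ord andbT.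
  have := cutoff_sum_cvg l0_gt0 lam_ge aM M_ge0 K0_ge0 heat0 theta_sum s_gt s_le
    d0 expansion mf f0 (rapidly_decreasing_bound pcf rdf) fmoment Dm.
  apply: cvg_trans; apply: near_eq_cvg; apply: nearW => L.
  rewrite sum_spec; congr (_ * _); apply: eq_bigr => i _; congr (_ * _).
  rewrite /laplace cintE; last by move=> t t1; rewrite f0// mulr0.
  by apply: eq_cint => t _; rewrite mulrC [t * _]mulrC.
pose x := Num.max 1 (Num.max (s ord0) s').
exists x, s', (zeta_cont theta s c); split.
- by split=> //; rewrite /x !le_max ler01.
- move=> z; rewrite /x !gt_max => /and3P[z1 zs zs'].
  have [S HS] := zeta_summable l0_gt0 lam_ge K0_ge0 heat0 z1 zs.
  pose mu i : R[i] := cpow (lam i) (- z).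
  have muS (A : {fset I}) : \sum_(i <- A) normc (mu i) <= S.
    apply: le_trans (HS A); apply: ler_sum => i _.
    by rewrite normc_cpow// cReN.
  have [cc Hcc] : exists cc : C R,
      partial_sum (fun i => mu i * a i : C R) A @[A --> totally] --> cc.
    apply: (@is_cvg_partial_sumC _ _ _ (S * M)) => A.
    apply: le_trans (_ : (\sum_(i <- A) normc (mu i)) * M <= _).
      by rewrite mulr_suml; apply: ler_sum => i _; rewrite normcM ler_wpM2l ?normc_ge0.
    by rewrite ler_wpM2r.
  exists cc; split.
    exists (diag_op phi mu); split; last exact: (diag_op_trace phib muS bh Hcc).
    exact: (diag_op_functional_calculus phib muS (selfadjoint_symmetric sa) eig).
  apply: (zeta_cont_eq l0_gt0 lam_ge aM M_ge0 K0_ge0 heat0 theta_sum s_le d0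
    expansion _ zs zs' Hcc).
  exact: lt_trans z1.
- move=> q /= qs; exists 1%N; eexists.
  exact: (zeta_cont_principal l0_gt0 lam_ge aM M_ge0 K0_ge0 heat0 theta_sum d0
    expansion qs).
- exists 0%N; eexists; split.
    exact: (zeta_cont_principal l0_gt0 lam_ge aM M_ge0 K0_ge0 heat0 theta_sum d0
      expansion (p := (s ord_max)%:C) s's).
  rewrite /= (big_pred1 ord_max)// => i /=.
  have [->|im] := eqVneq i ord_max; first by rewrite eqxx.
  apply/eqP => /complexI si; have := s_dec i ord_max.
  by rewrite ltn_neqAle im leq_ord si ltxx => /(_ isT).
Qed.
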